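(* Let $q$ be a prime power, let $n\geq 7$ and $U=U_n(q)$. Each irreducible character of $U$ of degree $q^{\mu(n)-2}$ (third largest degree) is of one of the following forms, where characters of the subgroups $U_{\alpha_{a,b}}$ are regarded as characters of $U$ by inflation: (i) the tensor product of an almost faithful elementary character of $U$ with an irreducible character of $U_{\alpha_{2,n-2}}\simeq U_{n-2}(q)$ of degree $q^{\mu(n-2)-2}$; (ii) the tensor product of an irreducible constituent of ${\lambda_1}^U\otimes{\lambda_2}^U$, where ${\lambda_1}^U,{\lambda_2}^U$ are elementary characters associated to $\alpha_{1,n-2}$ and $\alpha_{2,n-1}$ respectively, with an irreducible character of $U_{\alpha_{3,n-3}}\simeq U_{n-4}(q)$ of degree $q^{\mu(n-4)-1}$; (iii) the tensor product of an irreducible constituent of a tensor product of three elementary characters associated to $\alpha_{2,n-3}$, $\alpha_{1,n-2}$ and $\alpha_{3,n-1}$ respectively, with an irreducible character of $U_{\alpha_{4,n-4}}\simeq U_{n-6}(q)$ of degree $q^{\mu(n-6)}$; (iv) the tensor product of an irreducible constituent of a tensor product of three elementary characters associated to $\alpha_{1,n-3}$, $\alpha_{3,n-2}$ and $\alpha_{2,n-1}$ respectively, with an irreducible character of $U_{\alpha_{4,n-4}}\simeq U_{n-6}(q)$ of degree $q^{\mu(n-6)}$; (v) the tensor product of an irreducible constituent of degree $q^{3n-14}$ of a tensor product of three elementary characters associated to $\alpha_{1,n-3}$, $\alpha_{2,n-2}$ and $\alpha_{3,n-1}$ respectively, with an irreducible character of $U_{\alpha_{4,n-4}}\simeq U_{n-6}(q)$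 of degree $q^{\mu(n-6)}$. Therefore, \[N_{n,\mu(n)-2}(q)=(q-1)N_{n-2,\mu(n-2)-2}(q)+q(q-1)^2N_{n-4,\mu(n-4)-1}(q)+(2q^2+q-1)(q-1)^3N_{n-6,\mu(n-6)}(q).\]
   Context: Let $q$ be a prime power and $U=U_n(q)$ the group of upper triangular $n\times n$ matrices over $\mathbb{F}_q$ with all diagonal entries $1$. All characters are complex. For $1\le i\le j\le n-1$, $\alpha_{i,j}=\alpha_i+\dots+\alpha_j$ denotes the positive roots of type $A_{n-1}$; $\Sigma^+$ is the set of all of them, and $X_{\alpha_{i,j}}=\{I_n+c\,e_{i,j+1}:c\in\mathbb{F}_q\}$ is the root subgroup, where $e_{i,j+1}$ is the matrix unit. For $\alpha=\alpha_{i,j}$: $arm(\alpha)=\{\alpha_{i,t}: i\le t<j\}$; $V_\alpha=\langle X_\beta:\beta\in\Sigma^+\setminus arm(\alpha)\rangle$. $\mathrm{Irr}(V_\alpha/[V_\alpha,V_\alpha])^*$ denotes the set of the $q-1$ linear characters $\lambda$ of $V_\alpha$ with $\lambda|_{X_\alpha}\ne 1_{X_\alpha}$ and $\lambda|_{X_\beta}=1_{X_\beta}$ for all $X_\beta\subset V_\alpha$, $\beta\neq\alpha$. For such $\lambda$, the induced character $\lambda^U$ is called an elementary character associated to $\alpha$. A character $\chi$ of a group $G$ is almost faithful if $\chi|_{Z(G)}\ne\chi(1)1_{Z(G)}$ (the almost faithful elementary characters of $U$ are those associated to $\alpha_{1,n-1}$). $U_{\alpha_{a,b}}=\langle X_{\alpha_{s,t}}: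 a\le s\le t\le b\rangle$ (interpreted as the trivial group when $b=a-1$), and $R_{\alpha_{a,b}}$ is the normal subgroup of $U$ generated by all $X_\beta$ not contained in $U_{\alpha_{a,b}}$. One has $U=R_{\alpha_{a,b}}\rtimes U_{\alpha_{a,b}}$, and characters of $U_{\alpha_{a,b}}$ are inflated to $U$ with $R_{\alpha_{a,b}}$ in the kernel. $N_{n,e}(q)$ is the number of irreducible characters of $U_n(q)$ of degree $q^e$. $\mu(n)=m(m-1)$ if $n=2m$ and $\mu(n)=m^2$ if $n=2m+1$; the irreducible character degrees of $U_n(q)$ are precisely $q^e$, $0\le e\le\mu(n)$. *)

(* Defs.v *)
From HB Require Import structures.
From mathcomp Require Import all_boot all_order all_algebra all_fingroup.
From mathcomp Require Import all_solvable all_field all_character.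

Set Implicit Arguments.
Unset Strict Implicit.
Unset Printing Implicit Defensive.

Import GroupScope GRing.Theory Num.Theory.

(* A positive root alpha_{i,j} of type A_{n-1} is given by its two indices,   *)
(* 1 <= i <= j <= n-1. Matrix indices are 0-based ordinals, so the matrix     *)
(* unit e_{i,j+1} of the 1-based convention sits in row i-1 and column j.     *)
(* The size of the matrices of {'GL_n[F]} is n.-1.+1, which is n for n > 0.   *)

Section Unitriangular.

Variables (F : finFieldType) (n : nat).
Implicit Types (g h : {'GL_n[F]}) (i j s t a b : nat).

Definition unitri_set : {set {'GL_n[F]}} :=
  [set g : {'GL_n[F]} | [forall r : 'I_n.-1.+1, forall c : 'I_n.-1.+1,
    (c <= r) ==> (GLval g r c == (r == c)%:R%R)]].

Lemma unitriP g :
  reflect (forall r c : 'I_n.-1.+1, (c <= r)%N -> GLval g r c = (r == c)%:R%R)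
          (g \in unitri_set).
Proof.
rewrite inE; apply: (iffP forallP) => [H r c le_cr | H r].
  by have /forallP/(_ c)/implyP/(_ le_cr)/eqP := H r.
by apply/forallP=> c; apply/implyP=> le_cr; apply/eqP; apply: H.
Qed.

Lemma unitri_group_set : group_set unitri_set.
Proof.
apply/group_setP; split=> [|g h /unitriP Ug /unitriP Uh].
  by apply/unitriP=> r c _; rewrite GL_1E mxE.
apply/unitriP=> r c le_cr; rewrite GL_MxE mxE (bigD1 r) //= Ug // eqxx mul1r.
rewrite Uh // big1 ?addr0 // => k kr.
have [le_kr | lt_rk] := leqP k r.
  by rewrite Ug // eq_sym (negbTE kr) mul0r.
rewrite Uh; last exact: leq_trans le_cr (ltnW lt_rk).
by case: eqP le_cr lt_rk => [-> | _]; rewrite ?mulr0 // leqNgt => /negbTE ->.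
Qed.

Canonical unitri := Group unitri_group_set.

Definition Xroot i j : {set {'GL_n[F]}} :=
  [set g : {'GL_n[F]} | [exists c : F,
    GLval g == 1%:M + c *: delta_mx (inord i.-1) (inord j)]%R].

(* The subgroup generated by the root subgroups X_beta, for the positive      *)
(* roots beta = alpha_{s,t} such that P s t.                                  *)
Definition Xgen (P : nat -> nat -> bool) : {group {'GL_n[F]}} :=
  <<\bigcup_(s < n) \bigcup_(t < n | (0 < s <= t) && P s t) Xroot s t>>%G.

Definition in_arm i j s t : bool := (s == i) && (i <= t < j).

Definition Valpha i j : {group {'GL_n[F]}} := Xgen (fun s t => ~~ in_arm i j s t).

(* lambda ranges over Irr(V_alpha / [V_alpha, V_alpha])^* for alpha_{i,j}.    *)
Definition elementary_lin i j (lambda : 'CF(Valpha i j)) : Prop :=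
  [/\ lambda \is a linear_char,
      exists2 x, x \in Xroot i j & lambda x != 1%R
    & forall s t, 0 < s <= t -> t < n -> Xroot s t \subset Valpha i j ->
        (s, t) != (i, j) -> forall x, x \in Xroot s t -> lambda x = 1%R].

Definition elementary i j (theta : 'CF(unitri)) : Prop :=
  exists2 lambda : 'CF(Valpha i j),
    elementary_lin lambda & theta = ('Ind[unitri] lambda)%R.

(* U_{alpha_{a,b}}, trivial when b < a; Rsub a b is R_{alpha_{a,b}}.          *)
Definition Usub a b : {group {'GL_n[F]}} := Xgen (fun s t => (a <= s) && (t <= b)).

Definition Rsub a b : {group {'GL_n[F]}} :=
  <<class_support
      (\bigcup_(s < n) \bigcup_(t < n | (0 < s <= t)
                                      && ~~ (Xroot s t \subset Usub a b)) Xroot s t)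
      unitri>>%G.

Lemma XP i j g :
  reflect (exists c : F, GLval g =
             1%:M + c *: delta_mx (inord i.-1) (inord j))%R (g \in Xroot i j).
Proof. by rewrite inE; apply: (iffP existsP) => -[c /eqP]; exists c => //; apply/eqP. Qed.

Lemma Xval s t r c : 0 < s <= t -> t < n ->
  (delta_mx (inord s.-1) (inord t) : 'M[F]_n.-1.+1)%R r c
    = ((r.+1 == s) && (nat_of_ord c == t))%:R%R.
Proof.
case/andP=> s_gt0 le_st lt_tn; have n_gt0 : 0 < n by apply: leq_ltn_trans lt_tn.
rewrite mxE -!val_eqE /= !inordK ?prednK //; last first.
  by rewrite ltnW // (leq_ltn_trans le_st).
by rewrite -(prednK s_gt0) eqSS.
Qed.

Lemma X_sub_unitri s t : 0 < s <= t -> t < n -> Xroot s t \subset unitri.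
Proof.
move=> le_st lt_tn; apply/subsetP=> g /XP[c Dg]; apply/unitriP=> r k le_kr.
rewrite Dg mxE [X in (_ + X)%R]mxE Xval // mxE.
case: andP => [[/eqP Dr /eqP Dk]|]; last by rewrite mulr0 addr0.
by case/andP: le_st => _; rewrite -Dr -Dk ltnNge le_kr.
Qed.

Lemma X_sub_Xgen (P : nat -> nat -> bool) s t :
  0 < s <= t -> t < n -> P s t -> Xroot s t \subset Xgen P.
Proof.
move=> le_st lt_tn Pst; have lt_sn : s < n.
  by case/andP: le_st => _ /leq_ltn_trans; apply.
apply: subset_trans (subset_gen _).
apply: (bigcup_max (Ordinal lt_sn)) => //=.
by apply: (bigcup_max (Ordinal lt_tn)) => //=; rewrite le_st.
Qed.

Lemma Xgen_sub (P : nat -> nat -> bool) (H : {group {'GL_n[F]}}) :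
  (forall s t, 0 < s <= t -> t < n -> P s t -> Xroot s t \subset H) ->
  Xgen P \subset H.
Proof.
move=> sXH; rewrite gen_subG; apply/bigcupsP=> s _; apply/bigcupsP=> t.
by case/andP=> ? ?; apply: sXH.
Qed.

Lemma unitri_gen : unitri \subset Xgen (fun _ _ => true).
Proof.
have [n_le1 | n_gt1] := leqP n 1.
  apply/subsetP=> g /unitriP Ug; suff ->: g = 1 by apply: group1.
  apply/val_inj/matrixP=> r c; rewrite mxE; apply: Ug.
  have lt1 (k : 'I_n.-1.+1) : nat_of_ord k = 0.
    by case: k => -[|k] //= ; case: n n_le1 => [|[]].
  by rewrite !lt1.
have En : n.-1.+1 = n by rewrite prednK // ltnW.
pose nz g := #|[set rc : 'I_n.-1.+1 * 'I_n.-1.+1 |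
                (rc.1 < rc.2) && (GLval g rc.1 rc.2 != 0%R)]|.
apply/subsetP=> g Ug; have [m] := ubnP (nz g); elim: m g Ug => // m IHm g Ug.
rewrite ltnS => le_nz; have /unitriP Ug' := Ug.
pose bad (r : 'I_n.-1.+1) := [exists c : 'I_n.-1.+1, (r < c) && (GLval g r c != 0%R)].
have [/existsP[r0 bad0] | /existsPn good] := boolP [exists r, bad r]; last first.
  suff ->: g = 1 by apply: group1.
  apply/val_inj/matrixP=> r c; have [le_cr | lt_rc] := leqP c r.
    by rewrite mxE; apply: Ug'.
  have /existsPn/(_ c) := good r; rewrite lt_rc negbK => /eqP E.
  by rewrite [LHS]E mxE -val_eqE /= ltn_eqF.
case: (@arg_maxnP _ r0 bad (@nat_of_ord _) bad0) => r bad_r max_r.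
have [c /andP[lt_rc nz_rc]] := existsP bad_r.
have row_c k : GLval g c k = (c == k)%:R%R.
  have [le_kc | lt_ck] := leqP k c; first exact: Ug'.
  apply/eqP; rewrite -val_eqE /= ltn_eqF //; apply: contraTT lt_rc => nz_ck.
  by rewrite -leqNgt; apply: max_r; apply/existsP; exists k; rewrite lt_ck.
pose E : 'M[F]_n.-1.+1 := delta_mx r c; pose d := GLval g r c.
have EE0 : (E *m E)%R = 0%R.
  by rewrite mul_delta_mx_0 // -val_eqE /= gtn_eqF.
have inv1 (e : F) : ((1%:M + e *: E) *m (1%:M - e *: E) = 1%:M)%R.
  rewrite mulmxBr mulmx1 mulmxDl mul1mx -scalemxAl -scalemxAr EE0 !scaler0 addr0.
  by rewrite addrK.
have [Ux _] := mulmx1_unit (inv1 (- d)%R).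
pose x : {'GL_n[F]} := FinRing.unit _ Ux.
have Xx : x \in Xroot r.+1 c.
  by apply/XP; exists (- d)%R; rewrite /= !inord_val.
have lt_cn : c < n by rewrite -[X in _ < X]En.
have rc_ok : 0 < r.+1 <= c by [].
have xH : x \in Xgen (fun _ _ => true).
  by apply: subsetP Xx; apply: X_sub_Xgen.
have Ux' : x \in unitri by apply: subsetP Xx; apply: X_sub_unitri.
rewrite -(groupMl _ xH); apply: IHm; first by rewrite groupM.
apply: leq_trans le_nz; apply: proper_card.
have xg_val k l : GLval (x * g) k l =
    (GLval g k l - ((k == r) && (l == c))%:R * d)%R.
  rewrite GL_MxE /= mulmxDl mul1mx mxE -scalemxAl [X in (_ + X)%R]mxE.
  rewrite [(E *m _)%R k l]mxE (bigD1 c) //= big1 ?addr0; last first.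
    by move=> k' /negbTE nk'; rewrite mxE nk' andbF mul0r.
  rewrite mxE eqxx andbT row_c -natrM mulnb mulNr [(d * _)%R]mulrC.
  by rewrite [c == l]eq_sym.
apply/properP; split.
  apply/subsetP=> -[k l]; rewrite !inE /= xg_val => /andP[-> ].
  case: andP => [[/eqP-> /eqP->]|]; first by rewrite mul1r subrr eqxx.
  by rewrite mul0r subr0.
exists (r, c); rewrite !inE /= ?lt_rc //=.
by rewrite xg_val !eqxx mul1r subrr eqxx.
Qed.

Lemma Xgen_sub_unitri (P : nat -> nat -> bool) : Xgen P \subset unitri.
Proof. by apply: Xgen_sub => s t ? ? _; apply: X_sub_unitri. Qed.

Lemma Rsub_normal a b : Rsub a b <| unitri.
Proof.
apply/andP; split; last exact/norms_gen/class_support_norm.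
rewrite gen_subG class_support_subG //.
apply/bigcupsP=> s _; apply/bigcupsP=> t /andP[? _].
exact: X_sub_unitri.
Qed.

Section Projection.

Variables a b : nat.
Let S (r : 'I_n.-1.+1) := (a <= r.+1) && (r <= b).
Let D : 'M[F]_n.-1.+1 := (\matrix_(r, c) ((r == c) && S r)%:R)%R.

Let mulD (A : 'M[F]_n.-1.+1) r c : ((D *m A) r c = (S r)%:R * A r c)%R.
Proof.
rewrite mxE (bigD1 r) //= big1 ?addr0 ?mxE ?eqxx //.
by move=> k; rewrite mxE eq_sym => /negbTE->; rewrite mul0r.
Qed.

Let mulDr (A : 'M[F]_n.-1.+1) r c : ((A *m D) r c = A r c * (S c)%:R)%R.
Proof.
rewrite mxE (bigD1 c) //= big1 ?addr0 ?mxE ?eqxx //.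
by move=> k; rewrite mxE => /negbTE->; rewrite mulr0.
Qed.

Let D2 : (D *m D = D)%R.
Proof.
apply/matrixP=> r c; rewrite mulD mxE -natrM mulnb.
by case: (S r); rewrite ?andbT ?andbF.
Qed.

Let U0 g (r c : 'I_n.-1.+1) : g \in unitri -> c < r -> GLval g r c = 0%R.
Proof.
move=> /unitriP Ug lt_cr; have -> := Ug r c (ltnW lt_cr).
by case: eqP lt_cr => // ->; rewrite ltnn.
Qed.

Let projM g h : g \in unitri -> h \in unitri ->
  (D *m GLval (g * h) *m D = (D *m GLval g *m D) *m (D *m GLval h *m D))%R.
Proof.
move=> Ug Uh; rewrite -!mulmxA (mulmxA D D) D2.
apply/matrixP=> r c; rewrite !mulD; case Sr: (S r); last by rewrite !mul0r.
rewrite !mul1r !mulmxA mulDr -(mulmxA (GLval g)) mulDr.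
case Sc: (S c); last by rewrite !mulr0.
rewrite !mulr1 [LHS]mxE [RHS]mxE; apply: eq_bigr => k _; rewrite -/(GLval g) -/(GLval h).
rewrite mulD; case Sk: (S k); first by rewrite mul1r.
rewrite mul0r mulr0; have [lt_kr | le_rk] := ltnP k r.
  by rewrite U0 ?mul0r.
have [lt_ck | le_kc] := ltnP c k; first by rewrite [X in (_ * X)%R]U0 ?mulr0.
case/andP: Sr Sc => le_ar _ /andP[_ le_cb]; move: Sk; rewrite /S.
by rewrite (leq_trans le_ar) ?ltnS //= (leq_trans le_kc).
Qed.

Let K : {set {'GL_n[F]}} := [set g in unitri | (D *m GLval g *m D == D)%R].

Let inK g : (g \in K) = (g \in unitri) && (D *m GLval g *m D == D)%R.
Proof. exact: in_set. Qed.

Let K_group_set : group_set K.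
Proof.
apply/group_setP; split=> [|g h]; first by rewrite inK group1 mulmx1 D2 eqxx.
rewrite !inK => /andP[Ug /eqP Dg] /andP[Uh /eqP Dh].
by rewrite groupM // projM // Dg Dh D2 eqxx.
Qed.

Let K_norm : unitri \subset 'N(Group K_group_set).
Proof.
apply/subsetP=> x Ux; rewrite inE; apply/subsetP=> _ /imsetP[g Kg ->].
move: Kg; rewrite !inK => /andP[Ug /eqP Dg]; rewrite groupJ //; apply/eqP.
rewrite conjgE !projM ?groupM ?groupV // Dg.
have -> : (D *m (D *m GLval x *m D) = D *m GLval x *m D)%R by rewrite !mulmxA D2.
by rewrite -projM ?groupV // mulVg mulmx1 D2.
Qed.

Let W : {set {'GL_n[F]}} :=
  [set g in unitri | (GLval g == D *m GLval g *m D + (1%:M - D))%R].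

Let inW g :
  (g \in W) = (g \in unitri) && (GLval g == D *m GLval g *m D + (1%:M - D))%R.
Proof. exact: in_set. Qed.

Let W_group_set : group_set W.
Proof.
apply/group_setP; split=> [|g h].
  by rewrite inW group1 mulmx1 D2 addrC subrK /=.
rewrite !inW => /andP[Ug /eqP Dg] /andP[Uh /eqP Dh].
rewrite groupM //; apply/eqP; rewrite projM // GL_MxE.
set A := (D *m GLval g *m D)%R in Dg *; set B := (D *m GLval h *m D)%R in Dh *.
have AD : (A *m D = A)%R by rewrite /A -mulmxA D2.
have DB : (D *m B = B)%R by rewrite /B !mulmxA D2.
rewrite [in LHS]Dg [in LHS]Dh !(mulmxDl, mulmxDr) !(mulNmx, mulmxN).
by rewrite !mulmx1 !mul1mx AD DB D2 !subrr !addr0 [(B + _)%R]addrC addrK.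
Qed.

Lemma Rsub_Usub_TI : Rsub a b :&: Usub a b = 1.
Proof.
have sUW : Usub a b \subset Group W_group_set.
  apply: Xgen_sub => s t le_st lt_tn /andP[le_as le_tb].
  apply/subsetP=> g Xg; rewrite inW (subsetP (X_sub_unitri le_st lt_tn)) //=.
  have [c ->] := XP _ _ _ Xg; set E := delta_mx _ _.
  have DED : (D *m E *m D = E)%R.
    apply/matrixP=> r k; rewrite mulDr mulD Xval //.
    case: andP => [[/eqP Dr /eqP Dk]|]; last by rewrite mulr0 mul0r.
    case/andP: le_st => _ le_st.
    rewrite /S Dr Dk le_as le_tb (leq_trans le_as) ?(leq_trans le_st) //=.
    by rewrite (leq_trans _ le_tb) ?(leq_trans _ le_st) -?Dr //= mul1r mulr1.
  rewrite mulmxDr mulmx1 mulmxDl D2 -scalemxAr -scalemxAl DED.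
  by rewrite addrAC [(D + (_ - _))%R]addrC subrK.
have sRK : Rsub a b \subset Group K_group_set.
  rewrite gen_subG; apply: class_support_sub_norm K_norm.
  apply/bigcupsP=> s _; apply/bigcupsP=> t /andP[le_st nUst].
  apply/subsetP=> g Xg; rewrite inK (subsetP (X_sub_unitri le_st _)) //=.
  have [c ->] := XP _ _ _ Xg; set E := delta_mx _ _.
  have DED : (D *m E *m D = 0)%R.
    apply/matrixP=> r k; rewrite mulDr mulD Xval // mxE.
    case: andP => [[/eqP Dr /eqP Dk]|]; last by rewrite mulr0 mul0r.
    case: (boolP (S r && S k)) => [/andP[Sr Sk] | ]; last first.
      by rewrite negb_and; case: (S r); case: (S k) => //; rewrite ?mulr0 ?mul0r.
    case/negP: nUst; apply: X_sub_Xgen => //.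
    by case/andP: Sr; case/andP: Sk; rewrite Dr Dk => _ -> ->.
  by rewrite mulmxDr mulmx1 mulmxDl D2 -scalemxAr -scalemxAl DED scaler0 addr0.
apply/trivgP/subsetP=> g /setIP[/(subsetP sRK) + /(subsetP sUW)].
rewrite inK inW => /andP[_ /eqP->] /andP[_ /eqP Dg].
apply/set1P/val_inj; rewrite /= Dg addrC subrK //.
Qed.

End Projection.

Lemma Rsub_sdprod a b : Rsub a b ><| Usub a b = unitri.
Proof.
have [sRU nRU] := andP (Rsub_normal a b).
have sUU : Usub a b \subset unitri by apply: Xgen_sub_unitri.
rewrite sdprodEY ?Rsub_Usub_TI ?(subset_trans sUU) //.
apply/eqP; rewrite eqEsubset join_subG sRU sUU /=.
apply: subset_trans unitri_gen _.
apply: (@Xgen_sub _ (Rsub a b <*> Usub a b)%G) => s t le_st lt_tn _.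
have [sXU | nsXU] := boolP (Xroot s t \subset Usub a b).
  exact: subset_trans sXU (joing_subr _ _).
apply: subset_trans (joing_subl _ _).
apply: subset_trans (subset_gen _); apply: subset_trans (sub_class_support _ _).
have lt_sn : s < n by case/andP: le_st => _ /leq_ltn_trans; apply.
apply: (bigcup_max (Ordinal lt_sn)) => //=.
by apply: (bigcup_max (Ordinal lt_tn)) => //=; rewrite le_st.
Qed.

(* cfSdprod is the inflation along U -> U / R_{alpha_{a,b}} ~ U_{alpha_{a,b}}. *)
Definition inflate a b (phi : 'CF(Usub a b)) : 'CF(unitri) :=
  cfSdprod (Rsub_sdprod a b) phi.

End Unitriangular.

Definition almost_faithful (gT : finGroupType) (G : {group gT})
    (chi : 'CF(G)) : Prop :=
  ('Res['Z(G)] chi != chi 1%g *: 1)%R.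

Definition mu (n : nat) : nat :=
  (if odd n then n./2 ^ 2 else n./2 * n./2.-1)%N.

(* N_{n,e}(q), with F the field of q elements. *)
Definition num_irr (F : finFieldType) (n e : nat) : nat :=
  #|[set k : Iirr (unitri F n) |
     ('chi_k 1%g == (#|F| ^ e)%N%:R)%R]|.

(* Main.v *)
Require Import Defs.
From mathcomp Require Import all_boot all_order all_algebra all_fingroup.
From mathcomp Require Import all_solvable all_field all_character.
From mathcomp Require Import zify ring.

(** Let Y_s be the abelian normal subgroup of U formed by the matrices 1 + z with
    z supported in the rows before s and the columns from s on. With a nontrivial
    additive character psi of F, its irreducible characters are the
    lam_B : g -> psi (tr (B (g - 1))), for B in the transposed block, and
    conjugation by u in U replaces B by the corresponding block of u^-1 B u. Every
    irreducible character chi of U lies over a U-orbit of such B, for every s.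

    Upper bounds. The character lam_B extends to a linear character of its inertia
    group, given by the trace form tr (B u e u^-1), e being the projection to the
    coordinates from s on (ext_exists). So chi (1) is at most |U : A| for any A
    between Y_s and the inertia group with derived group in Y_s (over_bound). Since
    |U : Y_s| = q^mu(n) for s the lower or upper half of n, three independent
    commuting nilpotent matrices that fix B bring the degree below q^(mu(n)-2)
    (bound3). If chi has degree q^(mu(n)-2), there is no such triple, and this
    leaves five possibilities for the lower left corner of B, up to row and
    column operations by elements of U: a monomial matrix of size k = 1, 2 or 3,
    with permutation 1, 12, 213, 132 or 123 (classification).

    Exact parametrisation. For a monomial corner of size k, take s = n - k. The
    inertia group is Y_s (S x K), where K is U_alpha for the middle coordinates and
    S is a group of matrices acting on the first k coordinates and, through B, on
    the last k ones. By Clifford theory the characters over B are the products of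
    Ind (f sigma), f extending lam_B and sigma in Irr S, with a beta inflated from
    Irr K, of degree |U : T| sigma (1) beta (1) (corner_param). In the first four
    cases S is abelian of order 1, q, q^2 and q^2; in the last one it is U_3, and
    the required degree is reached exactly by its q - 1 characters of degree q
    (num_irr_3) and by the beta of largest degree.

    Elementary characters. On the intersection of T with the groups V_alpha for the
    k roots of the corner, f sigma is sigma (1) times the product of the linear
    characters that induce the elementary characters. A positivity form of Mackey's
    formula makes Ind (f sigma) a constituent of their product (constt_prod3_Ind).
    For k = 1 degrees show that it is the elementary character itself.

    Counting. The B below a given chi form one orbit, and the corner entries that
    carry the type and the scalars of a normal form are invariants of the orbit
    (label_uniq). So the characters of the given degree are counted by summing,
    over the five types and their nonzero scalars, the numbers of characters over
    the corresponding corners (num_irr_third). *)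

Set Implicit Arguments.
Unset Strict Implicit.
Unset Printing Implicit Defensive.

Import GRing.Theory Num.Theory.
Local Open Scope group_scope.
Local Open Scope ring_scope.

(** * Constituents of restricted and induced characters *)

Section CharacterGeneralities.

Variable gT : finGroupType.
Implicit Types A G H K M T V Y : {group gT}.

Lemma conjg_class_fun_char H (phi : 'CF(H)) M (y : gT) :
  phi \is a character -> M :^ y \subset H ->
  exists2 phiy : 'CF(M), phiy \is a character &
    {in M, forall k, phiy k = phi (k ^ y)%g}.
Proof.
move=> Nphi sMyH; pose f := conjgm M y.
have sfH : f @* M \subset H by rewrite morphim_conj setIid.
exists (cfMorph ('Res[f @* M] phi)); first by rewrite cfMorph_char ?cfRes_char.
by move=> k Mk; rewrite cfMorphE ?cfResE ?mem_morphim.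
Qed.

(** By Mackey's formula the inner product is a sum over double cosets of inner
    products of characters, all nonnegative; the hypothesis says that the trivial
    double coset already contributes. *)
Lemma cfdot_Res_Ind_neq0 G H K (xi : 'CF(K)) (phi : 'CF(H)) :
    K \subset G -> H \subset G -> xi \is a character -> phi \is a character ->
    '['Res[H :&: K] xi, 'Res[H :&: K] phi] != 0 ->
  '[xi, 'Res[K] ('Ind[G] phi)] != 0.
Proof.
move=> sKG sHG Nxi Nphi nz.
(* Up to a positive factor, A0 y is the contribution of y to Mackey's formula. *)
pose A0 y := \sum_(k in K) xi k * (phi (k ^ y)%g)^*.
have Age0 y : y \in G -> 0 <= A0 y.
  move=> Gy; pose M := (K :&: H :^ y^-1)%G.
  have sMyH : M :^ y \subset H by rewrite conjIg conjsgKV subsetIr.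
  have [phiy Nphiy Dphiy] := conjg_class_fun_char Nphi sMyH.
  have -> : A0 y = #|M|%:R * '['Res[M] xi, phiy].
    rewrite cfdotE mulrA divff ?mul1r ?neq0CG // /A0.
    rewrite (big_setID (H :^ y^-1)) /= addrC big1 ?add0r => [|k /setDP[_ nHk]].
      apply: eq_bigr => k Mk; rewrite Dphiy // cfResE ?subsetIl //.
    rewrite [phi _]cfun0 ?conjC0 ?mulr0 //; apply: contra nHk => Hky.
    by rewrite mem_conjgV.
  by rewrite mulr_ge0 ?ler0n // natr_ge0 // Cnat_cfdot_char ?cfRes_char.
have -> : '[xi, 'Res[K] ('Ind[G] phi)]
    = #|K|%:R^-1 * (#|H|%:R^-1 * \sum_(y in G) A0 y).
  rewrite cfdotE; congr (_ * _); rewrite exchange_big mulr_sumr /=.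
  apply: eq_bigr => k Kk; rewrite cfResE // cfIndE // rmorphM /= fmorphV /= rmorph_nat.
  rewrite mulrCA rmorph_sum /= mulr_sumr; congr (_ * _); exact: eq_bigr.
rewrite !mulf_neq0 ?invr_eq0 ?neq0CG //; apply: contraNneq nz.
move/(psumr_eq0P Age0)/(_ 1%g (group1 G)) => A1.
suff: '['Res[H :&: K] xi, 'Res[H :&: K] phi] = #|H :&: K|%:R^-1 * A0 1%g.
  by move->; rewrite A1 mulr0.
rewrite cfdotE /A0 [in RHS](big_setID H) /= [in RHS]addrC; congr (_ * _).
rewrite [X in _ = X + _]big1 ?add0r => [|k /setDP[_ nHk]].
  apply: eq_big => [k | k /setIP[Hk Kk]]; first by rewrite !inE andbC.
  by rewrite conjg1 !cfResE ?subsetIl ?subsetIr // inE Hk.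
by rewrite conjg1 [phi k]cfun0 ?conjC0 ?mulr0.
Qed.

Lemma cfdotMr G (a b c : 'CF(G)) : '[a, b * c] = '[a * b^*%CF, c].
Proof.
rewrite !cfdotE; congr (_ * _); apply: eq_bigr => x _.
by rewrite !cfunE rmorphM /= mulrA.
Qed.

Lemma cfdot_prod_Ind_neq0 G (V1 V2 : {group gT}) (chi : 'CF(G)) (phi1 : 'CF(V1)) (phi2 : 'CF(V2)) :
    V1 \subset G -> V2 \subset G -> chi \is a character ->
    phi1 \is a character -> phi2 \is a character ->
    '['Res[V2 :&: V1] chi, 'Res[V2 :&: V1] phi1 * 'Res[V2 :&: V1] phi2] != 0 ->
  '[chi, 'Ind[G] phi1 * 'Ind[G] phi2] != 0.
Proof.
move=> sV1 sV2 Nchi N1 N2 nz.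
rewrite -cfIndM // -cfdot_Res_l cfdotMr.
apply: cfdot_Res_Ind_neq0; rewrite ?rpredM ?cfConjC_char ?cfRes_char //.
rewrite rmorphM /= cfResRes ?subsetIr // -conj_cfRes -cfdotMr //.
Qed.

(** Used with psi the linear extension (times a character) that induces a given
    irreducible character, and phi1, phi2, phi3 the linear characters that induce
    elementary ones: agreement on the common subgroup is enough to make the
    former a constituent of the product, because no cancellation can occur in
    cfdot_Res_Ind_neq0. *)
Lemma constt_prod3_Ind G T (V1 V2 V3 : {group gT}) (psi : 'CF(T)) (phi1 : 'CF(V1))
    (phi2 : 'CF(V2)) (phi3 : 'CF(V3)) (l : Iirr G) c :
    T \subset G -> V1 \subset G -> V2 \subset G -> V3 \subset G ->
    psi \is a character -> phi1 \is a linear_char -> phi2 \is a linear_char ->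
    phi3 \is a linear_char -> 'chi_l = 'Ind[G] psi -> c != 0 ->
    (forall u, u \in T -> u \in V1 -> u \in V2 -> u \in V3 ->
      psi u = c * (phi1 u * phi2 u * phi3 u)) ->
  l \in irr_constt ('Ind[G] phi1 * 'Ind[G] phi2 * 'Ind[G] phi3).
Proof.
move=> sTG sV1 sV2 sV3 Npsi L1 L2 L3 Dl nzc Epsi.
have N1 := lin_charW L1; have N2 := lin_charW L2; have N3 := lin_charW L3.
have Nl := irr_char l.
pose M := (V2 :&: V1)%G; pose M' := (V3 :&: M)%G; pose P := (T :&: M')%G.
have sMG : M \subset G by rewrite subIset ?sV2.
have sM'G : M' \subset G by rewrite subIset ?sV3.
have sM'1 : M' \subset V1 := subset_trans (subsetIr _ _) (subsetIr _ _).
have sM'2 : M' \subset V2 := subset_trans (subsetIr _ _) (subsetIl _ _).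
have sM'3 : M' \subset V3 := subsetIl _ _.
have sPM' : P \subset M' by apply: subsetIr.
rewrite irr_consttE cfdotC conjC_eq0 mulrC cfdotMr.
apply: cfdot_prod_Ind_neq0; rewrite ?rpredM ?cfConjC_char ?cfInd_char //.
pose lam := 'Res[M] phi1 * 'Res[M] phi2.
have Nlam : lam \is a character by rewrite rpredM ?cfRes_char.
rewrite -/M -/lam rmorphM /= -conj_cfRes -cfdotMr mulrC cfdotMr.
apply: cfdot_Res_Ind_neq0; rewrite ?rpredM ?cfConjC_char ?cfRes_char //.
rewrite rmorphM /= cfResRes ?subsetIr // -conj_cfRes -cfdotMr -/M'.
have NX : 'Res[M'] lam * 'Res[M'] phi3 \is a character by rewrite rpredM ?cfRes_char.
rewrite cfdotC conjC_eq0 Dl; apply: cfdot_Res_Ind_neq0 => //; rewrite -/P.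
have LX : 'Res[P] ('Res[M'] lam * 'Res[M'] phi3) \is a linear_char.
  by rewrite !(rpredM, rmorphM) ?cfRes_lin_char.
have -> : 'Res[P] psi = c *: 'Res[P] ('Res[M'] lam * 'Res[M'] phi3).
  apply/cfun_inP=> u Pu; have /setIP[Tu M'u] := Pu.
  have /setIP[V3u Mu] := M'u; have /setIP[V2u V1u] := Mu.
  rewrite !(cfResE, cfunE) ?subsetIl ?subsetIr ?Epsi //.
by rewrite cfdotZr mulf_neq0 ?conjC_eq0 // (irrWnorm (lin_char_irr LX)) oner_eq0.
Qed.

Lemma constt_Res_conjg G M (i : Iirr G) (j k : Iirr M) :
    M <| G -> j \in irr_constt ('Res[M] 'chi_i) -> k \in irr_constt ('Res[M] 'chi_i) ->
  exists2 u, u \in G & 'chi_k = ('chi_j ^ u)%CF.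
Proof.
move=> nMG Cj; rewrite irr_consttE (Clifford_Res_sum_cfclass nMG Cj) cfdotZl.
rewrite reindex_cfclass // cfdot_suml mulf_eq0 => /norP[_ nz].
suff /cfclassP[u Gu ->]: 'chi_k \in ('chi_j ^: G)%CF by exists u.
apply: contraNT nz => nk; rewrite big1 // => m Cm; rewrite cfdot_irr.
by case: eqP => // Dm; case/negP: nk; rewrite -Dm.
Qed.

Lemma constt_Res_conjg_closed G M (i : Iirr G) (j k : Iirr M) u :
    u \in G -> 'chi_k = ('chi_j ^ u)%CF -> j \in irr_constt ('Res[M] 'chi_i) ->
  k \in irr_constt ('Res[M] 'chi_i).
Proof. by move=> Gu Dk; rewrite !irr_consttE Dk cfdot_Res_conjg. Qed.

(** Restricting in two ways to M: the constituent m of chi over j must come from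
    some constituent of the restriction of chi to H2. *)
Lemma constt_Res_extend G (H1 H2 : {group gT}) M (i : Iirr G) (j : Iirr H1) (m : Iirr M) :
    M \subset H1 -> M \subset H2 -> H1 \subset G -> H2 \subset G ->
    j \in irr_constt ('Res[H1] 'chi_i) -> m \in irr_constt ('Res[M] 'chi_j) ->
  exists2 k : Iirr H2, k \in irr_constt ('Res[H2] 'chi_i) &
     m \in irr_constt ('Res[M] 'chi_k).
Proof.
move=> sM1 sM2 s1G s2G Cj Cm.
have Cm': m \in irr_constt ('Res[M] ('Res[H2] 'chi_i)).
  rewrite cfResRes // -(cfResRes _ sM1) //.
  by apply: constt_Res_trans Cj _ Cm; rewrite cfRes_char ?irr_char.
move: Cm'; rewrite irr_consttE {1}['Res[H2] _]cfun_sum_constt linear_sum cfdot_suml.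
case: (pickP [pred k | (k \in irr_constt ('Res[H2] 'chi_i))
                     && (m \in irr_constt ('Res[M] 'chi_k))]) => [k /andP[]|none].
  by exists k.
rewrite big1 ?eqxx // => k Ck; rewrite linearZ cfdotZl /=.
have := none k; rewrite /= Ck irr_consttE /= => /negbFE/eqP->.
by rewrite mulr0.
Qed.

(** A character over an invariant linear t restricts to a multiple of t, which
    the linear extension f cancels. *)
Lemma divide_by_lin_ext Y A (t : Iirr Y) (f : 'CF(A)) (s : Iirr A) :
    Y <| A -> f \is a linear_char -> 'Res[Y] f = 'chi_t ->
    t \in irr_constt ('Res[Y] 'chi_s) ->
  f^-1 * 'chi_s \in irr A /\ Y \subset cfker (f^-1 * 'chi_s).
Proof.
move=> nYA Lf Rf Cst; have [sYA /subsetP nYA'] := andP nYA.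
have It : A \subset 'I['chi_t].
  apply/subsetP=> a Aa; rewrite inE nYA' //=.
  apply/eqP/cfun_inP=> y Yy; rewrite cfConjgE ?nYA' // -Rf.
  have Yya : (y ^ a^-1)%g \in Y by rewrite memJ_norm // groupV nYA'.
  rewrite !cfResE //; by rewrite cfunJ ?groupV.
pose g := f^-1 * 'chi_s; rewrite -/g.
have Lf' : f^-1 \is a linear_char by rewrite rpredV.
have Ig : g \in irr A by rewrite mul_lin_irr ?mem_irr.
split=> //; apply/subsetP=> y Yy; have /irrP[j Dg] := Ig.
rewrite Dg cfkerEirr inE -Dg.
have RsY : 'Res[Y] 'chi_s = 'chi_s 1%g *: 'chi_t.
  have := Clifford_Res_sum_cfclass nYA Cst; rewrite cfclass_invariant // big_seq1 => D.
  have := congr1 (fun h : 'CF(Y) => h 1%g) D; rewrite [in RHS]cfunE cfRes1.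
  have -> : 'chi_t 1%g = 1 by rewrite -Rf cfRes1 lin_char1.
  by rewrite mulr1 => ->.
have Ay := subsetP sYA y Yy.
have := congr1 (fun h : 'CF(Y) => h y) RsY; rewrite cfunE cfResE // => Dy.
rewrite /g invr_lin_char // !cfunE Dy -Rf cfResE // mulrCA [_ * f y]mulrC -normCK.
by rewrite normC_lin_char // expr1n (lin_char1 Lf) rmorph1 mulr1 mul1r.
Qed.

Lemma Inertia_bijection G Y T (t : Iirr Y) : Y <| G -> T :=: 'I_G['chi_t] ->
  [/\ {in irr_constt ('Ind[T] 'chi_t), forall s, 'Ind[G] 'chi_s \in irr G},
      {in irr_constt ('Ind[T] 'chi_t) &, injective (Ind_Iirr G)}
    & Ind_Iirr G @: irr_constt ('Ind[T] 'chi_t) =i irr_constt ('Ind[G] 'chi_t)].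
Proof.
move=> nYG Tt; have {Tt}-> : T = 'I_G['chi_t]%G by apply: val_inj.
by case: (constt_Inertia_bijection t nYG).
Qed.

Section Clifford.

Variables (G Y T C : {group gT}) (t : Iirr Y) (f : 'CF(T)).
Hypotheses (nYG : Y <| G) (Tt : T :=: 'I_G['chi_t]) (defT : Y ><| C = T).
Hypotheses (Lf : f \is a linear_char) (Rf : 'Res[Y] f = 'chi_t).

Let sTG : T \subset G. Proof. by rewrite Tt subsetIl. Qed.
Let sYT : Y \subset T. Proof. by case/sdprod_context: defT => /andP[]. Qed.
Let nYT : Y <| T. Proof. by case/sdprod_context: defT. Qed.

Lemma mul_sdprod_irr (c : Iirr C) : f * cfSdprod defT 'chi_c \in irr T.
Proof. by rewrite mul_lin_irr // cfSdprod_irr mem_irr. Qed.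

Definition liftT c := cfIirr (f * cfSdprod defT 'chi_c).

Lemma liftTE c : 'chi_(liftT c) = f * cfSdprod defT 'chi_c.
Proof. by rewrite cfIirrE ?mul_sdprod_irr. Qed.

Lemma Res_liftT c : 'Res[Y] 'chi_(liftT c) = 'chi_c 1%g *: 'chi_t.
Proof.
apply/cfun_inP=> y Yy; rewrite liftTE cfResE // !cfunE -Rf cfResE // mulrC.
congr (_ * _); rewrite -{1}[y]mulg1 cfSdprodE //.
Qed.

Lemma constt_liftT c : t \in irr_constt ('Res[Y] 'chi_(liftT c)).
Proof. by rewrite Res_liftT irr_consttE cfdotZl cfnorm_irr mulr1 irr1_neq0. Qed.

Lemma liftT_inj : injective liftT.
Proof.
move=> c d /(congr1 (fun i => 'chi_i)); rewrite !liftTE => /(mulrI (lin_char_unitr Lf)).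
by move/cfSdprod_inj/irr_inj.
Qed.

Lemma liftT_onto (s : Iirr T) :
  t \in irr_constt ('Res[Y] 'chi_s) -> exists c, s = liftT c.
Proof.
move=> Cs; pose g := f^-1 * 'chi_s.
have [Ig kerg] := divide_by_lin_ext nYT Lf Rf Cs; rewrite -/g in Ig kerg.
have Dg : g = cfSdprod defT ('Res[C] g) by rewrite cfRes_sdprodK.
have Ic : 'Res[C] g \in irr C by rewrite -(cfSdprod_irr defT) -Dg.
exists (cfIirr ('Res[C] g)); apply: irr_inj; rewrite liftTE cfIirrE // -Dg.
by rewrite /g mulrA mulrV ?mul1r // lin_char_unitr.
Qed.

(** The Clifford correspondence, composed with multiplication by the linear
    extension f and inflation through T / Y. *)
Definition Cliff c := Ind_Iirr G (liftT c).

Let bij := Inertia_bijection nYG Tt.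

Lemma Cliff_irr c : 'Ind[G] (f * cfSdprod defT 'chi_c) \in irr G.
Proof.
rewrite -liftTE; case: bij => H _ _.
by apply: H; rewrite constt_Ind_Res constt_liftT.
Qed.

Lemma CliffE c : 'chi_(Cliff c) = 'Ind[G] (f * cfSdprod defT 'chi_c).
Proof. by rewrite /Cliff cfIirrE liftTE // Cliff_irr. Qed.

Lemma Cliff_inj : injective Cliff.
Proof.
case: bij => _ H _ c d /H E; apply: liftT_inj.
by apply: E; rewrite constt_Ind_Res constt_liftT.
Qed.

Lemma Cliff_codom i : (i \in codom Cliff) = (t \in irr_constt ('Res[Y] 'chi_i)).
Proof.
rewrite -constt_Ind_Res; case: bij => _ _ <-.
apply/codomP/imsetP => [[c ->]|[s]].
  by exists (liftT c) => //; rewrite constt_Ind_Res constt_liftT.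
by rewrite constt_Ind_Res => /liftT_onto[c ->] ->; exists c.
Qed.

Lemma Cliff1 c : 'chi_(Cliff c) 1%g = #|G : T|%:R * 'chi_c 1%g.
Proof.
by rewrite CliffE cfInd1 // cfunE lin_char1 // mul1r cfSdprod1.
Qed.

End Clifford.

(** Dividing by f a constituent of the restriction to A leaves a character of
    the abelian group A / Y, so that constituent is linear; Frobenius reciprocity
    then bounds the degree by that of an induced linear character. *)
Lemma constt_lin_ext_bound G Y A (t : Iirr Y) (f : 'CF(A)) (i : Iirr G) :
    Y <| G -> Y \subset A -> A \subset G -> A^`(1)%g \subset Y ->
    f \is a linear_char -> 'Res[Y] f = 'chi_t ->
    t \in irr_constt ('Res[Y] 'chi_i) ->
  'chi_i 1%g <= #|G : A|%:R.
Proof.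
move=> nYG sYA sAG dA Lf Rf Ct.
have [|s Cs Cst] := @constt_Res_extend G Y A Y i t t (subxx _) sYA (normal_sub nYG) sAG Ct.
  by rewrite cfRes_id irr_consttE cfnorm_irr oner_eq0.
have nYA := normalS sYA sAG nYG.
have [/irrP[j Dj] kerg] := divide_by_lin_ext nYA Lf Rf Cst.
have lins : 'chi_s 1%g = 1.
  have Lg : 'chi_j \is a linear_char.
    by rewrite lin_irr_der1 -Dj (subset_trans dA).
  have := lin_char1 Lg; rewrite -Dj cfunE lin_char1 ?rpredV //.
  by rewrite mul1r.
have Nind : 'Ind[G] 'chi_s \is a character by rewrite cfInd_char ?irr_char.
move: Cs; rewrite -constt_Ind_Res => /(char1_ge_constt Nind).
by rewrite cfInd1 // lins mulr1.
Qed.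

End CharacterGeneralities.

Lemma isog_irr (aT rT : finGroupType) (G : {group aT}) (H : {group rT}) :
  G \isog H -> exists2 g : Iirr G -> Iirr H, bijective g &
    forall i, 'chi_(g i) 1%g = 'chi_i 1%g.
Proof.
case/isogP=> f injf fG; have isoGH : isom G H f by apply/isomP.
exists (isom_Iirr isoGH); last by move=> i; rewrite isom_IirrE cfIsom1.
by exists (isom_Iirr (isom_sym isoGH)); [apply: isom_IirrK | apply: isom_IirrKV].
Qed.

Lemma card_irr_isog (aT rT : finGroupType) (G : {group aT}) (H : {group rT}) d :
  G \isog H -> #|[set i : Iirr G | 'chi_i 1%g == d]|
             = #|[set i : Iirr H | 'chi_i 1%g == d]|.
Proof.
case/isog_irr=> g bij_g g1; rewrite -(card_imset _ (bij_inj bij_g)).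
apply: eq_card => i; have [h _ gK] := bij_g.
apply/imsetP/idP => [[j + ->]|]; rewrite !inE ?g1 // => di.
by exists (h i); rewrite ?inE -?g1 gK // di.
Qed.

(** * Linear characters from additive functions *)

Section AdditiveCharacter.

Variable F : finFieldType.

Lemma field_group_neq1 : [set: F]%G :!=: 1%g.
Proof.
apply/trivgPn; exists (1%R : F); rewrite ?inE //.
exact: oner_neq0.
Qed.

(** A fixed nontrivial character of the additive group of F. *)
Definition psi (x : F) : algC := 'chi_(sval (has_nonprincipal_irr field_group_neq1)) x.

Lemma psi_lin : 'chi_(sval (has_nonprincipal_irr field_group_neq1)) \is a linear_char.
Proof. by apply/char_abelianP; apply/centsP=> x _ y _; apply: addrC. Qed.

Lemma psiD x y : psi (x + y) = psi x * psi y.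
Proof. by rewrite /psi -(lin_charM psi_lin) ?inE. Qed.

Lemma psi0 : psi 0 = 1.
Proof. exact: (lin_char1 psi_lin). Qed.

Lemma psi_faithful a : (forall x, psi (x * a) = 1) -> a = 0.
Proof.
move=> triv; apply/eqP; apply: contraT => nza.
have := svalP (has_nonprincipal_irr field_group_neq1); case/eqP.
apply: irr_inj; rewrite irr0; apply/cfun_inP=> x _; rewrite cfun1E inE.
by have := triv (x / a); rewrite divfK.
Qed.

Lemma psi_inj a b : (forall x, psi (x * a) = psi (x * b)) -> a = b.
Proof.
move=> E; apply/eqP; rewrite -subr_eq0; apply/eqP/psi_faithful => x.
rewrite mulrBr psiD E -psiD subrr; exact: psi0.
Qed.

Variable gT : finGroupType.

Lemma additive_lin_char (H : {group gT}) (h : gT -> F) :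
    {in H &, forall u v, h (u * v)%g = h u + h v} ->
  exists2 f : 'CF(H), f \is a linear_char & {in H, forall u, f u = psi (h u)}.
Proof.
move=> hM; pose hm := Morphism (hM : {in H &, {morph h : u v / (u * v)%g}}).
pose t := 'chi_(sval (has_nonprincipal_irr field_group_neq1)).
exists (cfMorph ('Res[hm @* H] t)).
  by rewrite cfMorph_lin_char // cfRes_lin_char // psi_lin.
by move=> u Hu; rewrite cfMorphE // cfResE ?subsetT ?mem_morphim.
Qed.

End AdditiveCharacter.

(** * Idempotents and block matrices *)

Section RingFacts.

Variable R : pzRingType.

Lemma proj_conj_l (e u u' g : R) :
  e * u' * e = e * u' -> e * u * e = e * u -> u' * u = 1 -> e * g = e ->
  e * (u' * g * u) = e.
Proof.
by move=> h' h uu eg; rewrite !mulrA -h' -(mulrA _ e) eg h' -mulrA uu mulr1.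
Qed.

Lemma proj_conj_r (e u u' g : R) :
  e * u' * e = u' * e -> e * u * e = u * e -> u' * u = 1 -> g * e = e ->
  u' * g * u * e = e.
Proof.
move=> h' h uu ge; rewrite -!mulrA -h !mulrA -(mulrA u' g) ge.
by rewrite -!mulrA (mulrA e) h mulrA uu mul1r.
Qed.

Lemma mul_sub1 (a b : R) : (a - 1) * (b - 1) = 0 -> a * b - 1 = (a - 1) + (b - 1).
Proof.
move=> ab0; rewrite -[in LHS](subrK 1 a) -[in LHS](subrK 1 b).
by rewrite mulrDl mul1r mulrDr mulr1 ab0 add0r addrA addrK.
Qed.

Lemma proj_compl (e u : R) : e * e = e -> e * u * e = e * u ->
  (1 - e) * u * (1 - e) = u * (1 - e).
Proof.
move=> ee eue; rewrite mulrBl mul1r mulrBl !mulrBr !mulr1 eue.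
by rewrite subrr subr0.
Qed.

(** The two sides say that the conjugate of b by u has corner b', once as an
    equation with the inverse of u and once without it: the second form is linear
    in the entries of u. *)
Lemma conj_corner (e u u' b b' : R) :
  e * u * e = e * u -> e * u' * e = e * u' -> u' * u = 1 -> u * u' = 1 ->
  e * b = b -> e * b' = b' ->
  e * u' * b * u * (1 - e) = b' <-> b * u * (1 - e) = e * u * b'.
Proof.
move=> h h' uu uu' eb eb'; split=> [<-|H].
  by rewrite !mulrA h -(mulrA e u u') uu' mulr1 eb.
by rewrite -(mulrA (e * u') b) -(mulrA (e * u')) H !mulrA h' -(mulrA e u') uu mulr1 eb'.
Qed.

Lemma conj_proj_sub (e v v' : R) :
  e * e = e -> e * v * e = e * v -> e * v' * e = e * v' -> v * v' = 1 ->
  (1 - e) * (v * e * v' - e) * e = v * e * v' - e.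
Proof.
move=> ee h h' vv; have ew : e * (v * e * v') = e by rewrite !mulrA h -mulrA vv mulr1.
have we : v * e * v' * e = v * e * v' by rewrite -!mulrA (mulrA e v') h'.
by rewrite mulrBl mul1r mulrBr ew ee subrr subr0 mulrBl we ee.
Qed.

Lemma block_conj (e u u' b : R) :
  u * (1 - e) = 1 - e -> e * u' = e -> u * u' = 1 -> (u - 1) + (u' - 1) = 0 ->
  b * e = 0 -> b * u * e * u' = b * (u - 1).
Proof.
move=> ue eu' uu uD be; have {}ue : u * e = u - (1 - e).
  by rewrite -ue mulrBr mulr1 opprB addrC subrK.
rewrite -(mulrA b u) ue -mulrA mulrBl uu mulrBl mul1r eu' opprB addrCA.
by move/eqP: uD; rewrite addr_eq0 opprB => /eqP <-; rewrite mulrDr be add0r.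
Qed.

Lemma commuting_stab (e b c : R) : e * b = b -> b * e = 0 ->
  e * c = c * e -> c * b = b * c -> b * (1 + c) * (1 - e) = e * (1 + c) * b.
Proof.
move=> eb be ec cscal; rewrite mulrBr mulr1 mulrDr mulr1 mulrDl be add0r.
rewrite -(mulrA b c e) -ec !mulrA be mul0r subr0 mulrDr mulr1 mulrDl eb.
by rewrite ec -(mulrA c) eb cscal.
Qed.

End RingFacts.

(** Fixing the finite group structure once avoids inferring it again for every
    group operation on invertible matrices. *)
Definition GLt (F : finFieldType) (p : nat) : finGroupType :=
  [the finGroupType of {'GL_p.+1[F]}].

Section Matrices.

Variables (F : finFieldType) (p : nat).
Local Notation n := p.+1.
Local Notation Mn := 'M[F]_n.
Local Notation GL := (GLt F p).
Local Notation U := (unitri F n : {group GL}).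
Implicit Types (g h u v : GL) (A B M N : Mn).

(** The matrix of a group element, kept opaque so that the ring operations on
    matrices are never confused with the group operations. *)
Definition mx g : Mn := GLval g.
Definition mkGL (A : Mn) : GL := insubd (1%g : {'GL_n[F]}) A.

Lemma mx_inj : injective mx. Proof. exact: val_inj. Qed.
Lemma mxval (g : {'GL_n[F]}) : GLval g = mx (g : GL). Proof. by []. Qed.
Lemma mx1 : mx 1%g = 1. Proof. by []. Qed.
Lemma mxM g h : mx (g * h)%g = mx g * mx h. Proof. by []. Qed.
Lemma mxVK g : mx g^-1%g * mx g = 1. Proof. by rewrite -mxM mulVg. Qed.
Lemma mxKV g : mx g * mx g^-1%g = 1. Proof. by rewrite -mxM mulgV. Qed.
Lemma mxJ g h : mx (g ^ h)%g = mx h^-1%g * mx g * mx h.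
Proof. by rewrite conjgE !mxM mulrA. Qed.

Lemma mkGLK A : A \in unitmx -> mx (mkGL A) = A.
Proof. by move=> uA; rewrite /mx /mkGL /= insubdK. Qed.

Lemma mkGL_inv A B : A * B = 1 -> mx (mkGL A) = A.
Proof. by move=> AB; apply: mkGLK; case/mulmx1_unit: AB. Qed.

Lemma mulmxEij A B i j : (A * B) i j = \sum_k A i k * B k j.
Proof. by rewrite -mulmxE mxE. Qed.

Lemma mxsubE A B i j : (A - B) i j = A i j - B i j.
Proof. by rewrite !mxE. Qed.

Lemma mxaddE A B i j : (A + B) i j = A i j + B i j.
Proof. by rewrite mxE. Qed.

Lemma trC A B : \tr (A * B) = \tr (B * A).
Proof. exact: mxtrace_mulC. Qed.

Definition upper (P : rel 'I_n) := forall i j, P i j -> (i < j)%N.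
Definition supp (P : rel 'I_n) A := [forall i, forall j, ~~ P i j ==> (A i j == 0)].

Lemma suppP (P : rel 'I_n) A :
  reflect (forall i j, ~~ P i j -> A i j = 0) (supp P A).
Proof.
apply: (iffP forallP) => [H i j nP | H i].
  by have /forallP/(_ j)/implyP/(_ nP)/eqP := H i.
by apply/forallP=> j; apply/implyP=> nP; rewrite H.
Qed.

(** The matrices that differ from 1 only at the positions of P. This is a group
    only for closed sets of positions, but its cardinality does not depend on that. *)
Definition patset (P : rel 'I_n) : {set GL} := [set g | supp P (mx g - 1)].

Lemma patsetP (P : rel 'I_n) g :
  reflect (forall i j, ~~ P i j -> mx g i j = (i == j)%:R) (g \in patset P).
Proof.
rewrite inE; apply: (iffP (suppP _ _)) => H i j nP.
  by move: (H i j nP); rewrite !mxE => /subr0_eq.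
by rewrite !mxE H // subrr.
Qed.

Definition ltord : rel 'I_n := fun i j => (i < j)%N.

Lemma UP g : reflect (forall i j : 'I_n, (j <= i)%N -> mx g i j = (i == j)%:R) (g \in U).
Proof. exact (unitriP g). Qed.

Lemma U_patset : U = patset ltord :> {set GL}.
Proof.
apply/setP=> g; apply/UP/patsetP => H i j.
  by rewrite -leqNgt; apply: H.
by rewrite leqNgt; apply: H.
Qed.

Lemma patset_sub_U P : upper P -> patset P \subset U.
Proof.
move=> uP; apply/subsetP=> g /patsetP H; apply/UP=> i j le_ji; apply: H.
by apply: contraL le_ji => /uP; rewrite ltnNge.
Qed.

(** A unitriangular matrix has determinant 1. *)
Lemma unitr_upper P A : upper P -> supp P A -> 1 + A \in unitmx.
Proof.
move=> uP /suppP sA; rewrite unitmxE -det_tr det_trig.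
  rewrite big1 ?unitr1 // => i _; rewrite !mxE eqxx sA ?addr0 //.
  by apply/negP=> /uP; rewrite ltnn.
apply/is_trig_mxP=> i j lt_ij; rewrite !mxE sA.
  by rewrite -val_eqE /= gtn_eqF ?add0r.
by apply/negP=> /uP; rewrite ltnNge ltnW.
Qed.

Lemma mkGL_upper P A : upper P -> supp P A -> mx (mkGL (1 + A)) = 1 + A.
Proof. by move=> uP sA; rewrite mkGLK ?(unitr_upper uP). Qed.

Lemma mkGL_patset P A : upper P -> supp P A -> mkGL (1 + A) \in patset P.
Proof. by move=> uP sA; rewrite inE (mkGL_upper uP) // addrC addKr. Qed.

Lemma card_supp P : #|[set A | supp P A]| = (#|F| ^ #|[pred ij | P ij.1 ij.2]|)%N.
Proof.
pose f (h : {ffun 'I_n * 'I_n -> F}) : Mn := \matrix_(i, j) h (i, j).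
have fI : injective f.
  move=> h h' /matrixP E; apply/ffunP=> -[i j]; have := E i j; by rewrite !mxE.
rewrite -[in RHS](card_pffun_on (0 : F) [pred ij : 'I_n * 'I_n | P ij.1 ij.2] predT).
rewrite -(card_imset _ fI); apply: eq_card => A; rewrite inE.
apply/suppP/imsetP => [sA | [h /pffun_onP[/subsetP sh _] ->] i j nP].
  exists [ffun ij => A ij.1 ij.2]; last by apply/matrixP=> i j; rewrite mxE ffunE.
  apply/pffun_onP; split=> //; apply/subsetP=> -[i j].
  by rewrite !inE ffunE /=; apply: contraR => nP; rewrite sA.
by rewrite mxE; apply/eqP; apply: contraR nP => nz; apply: (sh (i, j)).
Qed.

Lemma card_patset P : upper P -> #|patset P| = (#|F| ^ #|[pred ij | P ij.1 ij.2]|)%N.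
Proof.
move=> uP; rewrite -card_supp -[RHS](@card_in_imset _ _ (fun A => mkGL (1 + A))).
  apply: eq_card => g; apply/idP/imsetP => [Pg | [A]].
    exists (mx g - 1); first by rewrite inE; move: Pg; rewrite inE.
    by apply: mx_inj; rewrite addrC subrK (mkGL_inv (mxKV g)).
  by rewrite inE => sA ->; apply: mkGL_patset.
move=> A B; rewrite !inE => sA sB /(congr1 mx); rewrite !(mkGL_upper uP) //.
exact: addrI.
Qed.

(** The idempotent e of the coordinates from s on. For u in U the space e is
    stable, which is the identity e u e = e u of U_Eproj. *)
Definition tail_proj s : Mn := \matrix_(i, j) ((i == j) && (s <= i)%N)%:R.
Local Notation E := tail_proj.

Lemma mulEl s A i j : (E s * A) i j = (s <= i)%:R * A i j.
Proof.
rewrite mulmxEij (bigD1 i) //= big1 ?addr0 ?mxE ?eqxx // => k.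
by rewrite mxE eq_sym => /negbTE->; rewrite mul0r.
Qed.

Lemma mulEr s A i j : (A * E s) i j = A i j * (s <= j)%:R.
Proof.
rewrite mulmxEij (bigD1 j) //= big1 ?addr0 ?mxE ?eqxx // => k.
by rewrite mxE => /negbTE->; rewrite mulr0.
Qed.

Lemma EE s t : E s * E t = E (maxn s t).
Proof.
apply/matrixP=> i j; rewrite mulEl !mxE geq_max.
by case: (s <= i)%N; rewrite ?andbF ?mul0r ?mul1r.
Qed.

Lemma Eidem s : E s * E s = E s. Proof. by rewrite EE maxnn. Qed.

Lemma U_Eproj s u : u \in U -> E s * mx u * E s = E s * mx u.
Proof.
move=> /UP Uu; apply/matrixP=> i j; rewrite mulEr !mulEl.
case: leqP => si; last by rewrite !mul0r.
case: leqP => sj; rewrite ?mulr1 // !mulr0 mul1r Uu -?val_eqE /=.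
  by rewrite gtn_eqF ?(leq_trans sj).
by rewrite ltnW // (leq_trans sj).
Qed.

End Matrices.

Arguments patset {F p} P.
Arguments mx {F p} g.
Arguments mkGL {F p} A.
#[global] Opaque mx tail_proj mkGL.

(** * The abelian normal subgroups of block matrices *)

Section Blocks.

Variables (F : finFieldType) (p : nat).
Local Notation n := p.+1.
Local Notation Mn := 'M[F]_n.
Local Notation GL := (GLt F p).
Local Notation U := (unitri F n : {group GL}).
Local Notation E := (tail_proj F p).
Implicit Types (g h u v : GL) (A B M N : Mn).

Variable s : nat.
Local Notation e := (E s).

Let ee : e * e = e. Proof. exact: Eidem. Qed.

Lemma U_Eproj' u : u \in U -> (1 - e) * mx u * (1 - e) = mx u * (1 - e).
Proof.
by move=> Uu; apply: proj_compl ee (U_Eproj s Uu).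
Qed.

(** Y is the group of block matrices 1 + z with z in the rows before s and the
    columns from s on; all its commutation properties follow from these two
    identities with e. *)
Definition Yset : {set GL} :=
  [set g | (e * mx g == e) && (mx g * (1 - e) == 1 - e)].

Lemma YP g : reflect (e * mx g = e /\ mx g * (1 - e) = 1 - e) (g \in Yset).
Proof. by rewrite inE; apply: (iffP andP) => -[/eqP-> /eqP->]. Qed.

Lemma Y_group_set : group_set Yset.
Proof.
apply/group_setP; split=> [|g h /YP[g1 g2] /YP[h1 h2]].
  by apply/YP; rewrite mx1 mulr1 mul1r.
by apply/YP; rewrite mxM mulrA g1 h1 -mulrA h2 g2.
Qed.
Canonical Ygroup := Group Y_group_set.
Definition Yblock : {group GL} := Ygroup.
Local Notation Y := Yblock.

Definition blockpos : rel 'I_n := fun i j => (i < s <= j)%N.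

Lemma blockpos_upper : upper blockpos.
Proof. by move=> i j /andP[]; apply: leq_trans. Qed.

Lemma Y_patset : Y = patset blockpos :> {set GL}.
Proof.
apply/setP=> g; apply/YP/patsetP => [[g1 g2] i j|H].
  rewrite negb_and -leqNgt -ltnNge => /orP[le_si | lt_js].
    have /matrixP/(_ i j) := g1; rewrite mulEl le_si mul1r => ->.
    by rewrite mxE le_si andbT.
  have /matrixP/(_ i j) := g2; rewrite mulrBr mulr1 !mxsubE mulEr leqNgt lt_js.
  by rewrite mulr0 subr0 => ->; rewrite !mxE; case: eqP => [->|_]; rewrite ?subr0 // leqNgt lt_js subr0.
split; apply/matrixP=> i j.
  rewrite mulEl mxE; case: leqP => si; last by rewrite andbF mul0r.
  by rewrite andbT mul1r H // negb_and -leqNgt si.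
rewrite mulrBr mulr1 !mxsubE mulEr [in RHS]mxE [e i j]mxE; case: (leqP s j) => sj.
  rewrite mulr1 subrr; case: eqP => [->|_]; by rewrite ?sj ?subrr ?subr0.
rewrite mulr0 subr0 H ?negb_and -?ltnNge ?sj ?orbT //.
by case: eqP => [->|_]; rewrite ?(leqNgt s j) ?sj ?subr0.
Qed.

Lemma YsubU : Y \subset U.
Proof. by rewrite Y_patset patset_sub_U //; apply: blockpos_upper. Qed.

Lemma Yconj u g : u \in U -> g \in Y -> (g ^ u)%g \in Y.
Proof.
move=> Uu /YP[g1 g2]; have Uu' : u^-1%g \in U by rewrite groupV.
apply/YP; rewrite mxJ; split.
  exact: proj_conj_l (U_Eproj s Uu') (U_Eproj s Uu) (mxVK u) g1.
exact: proj_conj_r (U_Eproj' Uu') (U_Eproj' Uu) (mxVK u) g2.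
Qed.

Lemma YnormU : Y <| U.
Proof.
rewrite /normal YsubU; apply/subsetP=> u Uu; rewrite inE; apply/subsetP=> _ /imsetP[g Yg ->].
exact: Yconj.
Qed.

Lemma Ysub1 g : g \in Y -> (mx g - 1) * (1 - e) = 0 /\ e * (mx g - 1) = 0.
Proof. by case/YP=> g1 g2; rewrite mulrBl mul1r g2 mulrBr mulr1 g1 !subrr. Qed.

Lemma Ysub1e g : g \in Y -> (1 - e) * (mx g - 1) * e = mx g - 1.
Proof.
case/Ysub1=> g1 g2; rewrite mulrBl mul1r g2 subr0; apply/eqP.
by rewrite -subr_eq0 -opprB oppr_eq0 -{1}[mx g - 1]mulr1 -mulrBr g1.
Qed.

Lemma Ymul g h : g \in Y -> h \in Y -> mx (g * h)%g - 1 = (mx g - 1) + (mx h - 1).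
Proof.
move=> Yg Yh; have : (mx g - 1) * (mx h - 1) = 0.
  have [g1 _] := Ysub1 Yg; have [_ h2] := Ysub1 Yh.
  rewrite -(Ysub1e Yh) !mulrA g1 !mul0r //.
by rewrite mxM => /mul_sub1.
Qed.

(** The trace form pairs Y with the matrices supported in the transposed block. *)
Definition lamfun B g : F := \tr (B * (mx g - 1)).

Lemma lamfunD B : {in Y &, forall u v, lamfun B (u * v)%g = lamfun B u + lamfun B v}.
Proof. by move=> u v Yu Yv; rewrite /lamfun Ymul // mulrDr mxtraceD. Qed.

Lemma lam_exists B : exists t : Iirr Y, [forall u in Y, 'chi_t u == psi (lamfun B u)].
Proof.
have [f Lf Df] := additive_lin_char (@lamfunD B).
have /irrP[t Dt] := lin_char_irr Lf; exists t.
by apply/forall_inP=> u Yu; rewrite -Dt Df.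
Qed.

Definition lam B : Iirr Y := xchoose (lam_exists B).

Lemma lamE B u : u \in Y -> 'chi_(lam B) u = psi (lamfun B u).
Proof. by move=> Yu; have /forall_inP/(_ u Yu)/eqP := xchooseP (lam_exists B). Qed.

Lemma lam1 B : 'chi_(lam B) 1%g = 1.
Proof. by rewrite lamE // /lamfun mx1 subrr mulr0 mxtrace0 psi0. Qed.

Definition elt (x : F) (i j : 'I_n) : GL := mkGL (1 + x *: delta_mx i j).

Lemma mx_elt x (i j : 'I_n) : (i < j)%N -> mx (elt x i j) = 1 + x *: delta_mx i j.
Proof.
move=> lt_ij; apply: (@mkGL_upper _ _ (fun k l => (k == i) && (l == j))).
  by move=> k l /andP[/eqP-> /eqP->].
by apply/suppP=> k l /negbTE nP; rewrite !mxE nP mulr0.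
Qed.

Lemma elt_in_pat (P : rel 'I_n) x (i j : 'I_n) : (i < j)%N -> P i j -> elt x i j \in patset P.
Proof.
move=> lt_ij Pij; apply/patsetP=> k l nP; rewrite mx_elt // !mxE.
by case: andP => [[/eqP Dk /eqP Dl]|_]; rewrite ?mulr0 ?addr0 //; rewrite Dk Dl Pij in nP.
Qed.

Lemma elt_in_U x (i j : 'I_n) : (i < j)%N -> elt x i j \in U.
Proof. by move=> lt_ij; rewrite U_patset elt_in_pat. Qed.

Lemma elt_in_Y x (i j : 'I_n) : (i < s <= j)%N -> elt x i j \in Y.
Proof. by move=> ij; rewrite Y_patset elt_in_pat // blockpos_upper. Qed.

Lemma trace_delta B (i j : 'I_n) : \tr (B * delta_mx i j) = B j i.
Proof.
rewrite /mxtrace (bigD1 j) //= big1 ?addr0 => [|k nk]; rewrite mulmxEij (bigD1 i) //=.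
  by rewrite mxE !eqxx mulr1 big1 ?addr0 // => l nl; rewrite mxE (negbTE nl) mulr0.
rewrite mxE (negbTE nk) andbF mulr0 big1 ?addr0 // => l nl.
by rewrite mxE (negbTE nl) mulr0.
Qed.

Lemma lamfun_elt B x (i j : 'I_n) : (i < j)%N -> lamfun B (elt x i j) = x * B j i.
Proof.
move=> lt_ij; rewrite /lamfun mx_elt // addrC addKr -scalerAr mxtraceZ.
by rewrite trace_delta.
Qed.

Definition lowpos : rel 'I_n := fun i j => (j < s <= i)%N.
Definition low B := supp lowpos B.

Lemma lowP B : reflect (e * B = B /\ B * e = 0) (low B).
Proof.
apply: (iffP (suppP _ _)) => [H | [H1 H2] i j].
  split; apply/matrixP=> i j.
    rewrite mulEl; case: leqP => si; rewrite ?mul1r // mul0r H //.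
    by rewrite negb_and -!ltnNge si orbT.
  rewrite mulEr [RHS]mxE; case: leqP => sj; rewrite ?mulr0 // mulr1 H //.
  by rewrite negb_and -!leqNgt sj.
rewrite negb_and -leqNgt -ltnNge => /orP[sj | si].
  by have /matrixP/(_ i j) := H2; rewrite mulEr sj mulr1 mxE.
by rewrite -H1 mulEl leqNgt si mul0r.
Qed.

(** The values of the functional on elementary matrices are the entries of B. *)
Lemma lam_inj_low B B' : lam B = lam B' ->
  forall i j : 'I_n, (j < s <= i)%N -> B i j = B' i j.
Proof.
move=> eqB i j ij; apply: psi_inj => x.
have lt_ji : (j < i)%N by case/andP: ij; apply: leq_trans.
by rewrite -!lamfun_elt // -!lamE ?elt_in_Y // eqB.
Qed.

Lemma low_eq B B' : low B -> low B' ->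
  (forall i j : 'I_n, (j < s <= i)%N -> B i j = B' i j) -> B = B'.
Proof.
move=> /suppP lB /suppP lB' H; apply/matrixP=> i j.
by have [/H//|nP] := boolP (lowpos i j); rewrite lB ?lB'.
Qed.

Lemma Yabelian : abelian Y.
Proof.
apply/centsP=> g Yg h Yh; apply: mx_inj; apply: (addIr (-1)).
by rewrite !Ymul // addrC.
Qed.

(** The q^(s(n-s)) matrices of the lower left block give distinct characters of
    the abelian group Y, which has only that many. *)
Lemma lam_onto t : exists2 B, low B & t = lam B.
Proof.
have: lam @: [set B | low B] == setT.
  rewrite eqEcard subsetT /= card_in_imset; last first.
    by move=> B B'; rewrite !inE => lB lB' /lam_inj_low; apply: low_eq.
  rewrite cardsT card_Iirr_abelian ?Yabelian // Y_patset card_patset.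
    rewrite card_supp leq_eqVlt; apply/orP; left; apply/eqP; congr (_ ^ _)%N.
    have swapI : injective (fun ij : 'I_n * 'I_n => (ij.2, ij.1)).
      by case=> i j [k l] [-> ->].
    rewrite -(card_imset _ swapI); apply: eq_card => -[i j].
    apply/imsetP/idP => [[[k l] + [-> ->]] | H]; first by rewrite !inE.
    by exists (j, i).
  exact: blockpos_upper.
move/eqP/setP/(_ t); rewrite inE => /imsetP[B]; rewrite inE => lB ->.
by exists B.
Qed.

End Blocks.

(** * Characters lying over a block, inertia groups and extensions *)

Section Over.

Variables (F : finFieldType) (p : nat).
Local Notation n := p.+1.
Local Notation Mn := 'M[F]_n.
Local Notation GL := (GLt F p).
Local Notation U := (unitri F n : {group GL}).
Local Notation E := (tail_proj F p).
Implicit Types (g h u v : GL) (A B M N : Mn).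

Variable s : nat.
Local Notation e := (E s).
Local Notation Y := (Yblock F p s).
Local Notation lam := (@lam F p s).

Let ee : e * e = e. Proof. exact: Eidem. Qed.

(** Conjugation by u moves the functional of B to that of u^-1 B u, by invariance
    of the trace. *)
Definition conjM u B : Mn := mx u^-1%g * B * mx u.

Lemma lamfunJ B u g : lamfun B (g ^ u^-1)%g = lamfun (conjM u B) g.
Proof.
rewrite /lamfun /conjM mxJ invgK.
have -> : mx u * mx g * mx u^-1%g - 1 = mx u * (mx g - 1) * mx u^-1%g.
  by rewrite mulrBr mulr1 mulrBl mxKV.
by rewrite !mulrA [LHS]mxtrace_mulC -mulmxE !mulmxA.
Qed.

Lemma supp_low_Y g (i j : 'I_n) : g \in Y -> ~~ (i < s <= j)%N -> (mx g - 1) i j = 0.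
Proof.
by rewrite Y_patset inE => /suppP H nP; apply: H.
Qed.

Lemma eq_lamfun B B' g : (forall i j : 'I_n, (j < s <= i)%N -> B i j = B' i j) ->
  g \in Y -> lamfun B g = lamfun B' g.
Proof.
move=> eqB Yg; rewrite /lamfun /mxtrace; apply: eq_bigr => i _.
rewrite !mulmxEij; apply: eq_bigr => j _.
have [/eqB->//|nP] := boolP (j < s <= i)%N.
by rewrite (supp_low_Y Yg nP) !mulr0.
Qed.

Lemma lam_eqP B B' : (lam B = lam B') <->
  (forall i j : 'I_n, (j < s <= i)%N -> B i j = B' i j).
Proof.
split=> [|eqB]; first exact: lam_inj_low.
apply: irr_inj; apply/cfun_inP=> g Yg; rewrite !lamE //.
by rewrite (eq_lamfun eqB).
Qed.

Lemma lam_conj B u : u \in U -> ('chi_(lam B) ^ u)%CF = 'chi_(lam (conjM u B)).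
Proof.
move=> Uu; have nYu := subsetP (normal_norm (YnormU F p s)) u Uu.
apply/cfun_inP=> g Yg; rewrite cfConjgE // !lamE ?lamfunJ //.
by rewrite memJ_norm // groupV.
Qed.

Lemma corner_entry A (i j : 'I_n) :
  (e * A * (1 - e)) i j = if (j < s <= i)%N then A i j else 0.
Proof.
rewrite mulrBr mulr1 mxsubE mulEr !mulEl.
case: (leqP s i); case: (leqP s j); rewrite ?mul1r ?mul0r ?mulr0 ?mulr1 ?subr0 ?subrr //=.
Qed.

Lemma corner_eqP A B' : low s B' ->
  (forall i j : 'I_n, (j < s <= i)%N -> A i j = B' i j) <-> e * A * (1 - e) = B'.
Proof.
move=> /suppP lB; split=> [H | <- i j ij]; last by rewrite corner_entry ij.
apply/matrixP=> i j; rewrite corner_entry; case: ifP => [/H//|nP].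
by rewrite lB // /lowpos nP.
Qed.

Lemma conj_lowP B B' u : u \in U -> low s B -> low s B' ->
  lam (conjM u B) = lam B' <-> B * mx u * (1 - e) = e * mx u * B'.
Proof.
move=> Uu lB lB'; have Uu' : u^-1%g \in U by rewrite groupV.
apply: (iff_trans (lam_eqP _ _)); apply: (iff_trans (corner_eqP _ lB')).
rewrite /conjM !mulrA.
have [eB _] := lowP _ _ lB; have [eB' _] := lowP _ _ lB'.
exact: conj_corner (U_Eproj s Uu) (U_Eproj s Uu') (mxVK u) (mxKV u) eB eB'.
Qed.

Definition lies_over (i : Iirr U) B : bool := lam B \in irr_constt ('Res[Y] 'chi_i).

Lemma over_exists i : exists2 B, low s B & lies_over i B.
Proof.
have : 'Res[Y] 'chi_i != 0 by rewrite cfRes_eq0 ?irr_char ?irr_neq0.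
case/neq0_has_constt=> t Ct; have [B lB Dt] := lam_onto t.
by exists B; rewrite // /lies_over -Dt.
Qed.

(** The characters of Y below an irreducible character of U form a whole orbit. *)
Lemma over_conj i B B' u : u \in U -> low s B -> low s B' ->
  B * mx u * (1 - e) = e * mx u * B' -> lies_over i B -> lies_over i B'.
Proof.
move=> Uu lB lB' /(conj_lowP Uu lB lB') eqB.
by apply: (constt_Res_conjg_closed Uu); rewrite -eqB lam_conj.
Qed.

Definition stabT B : {group GL} := ('I_U['chi_(lam B)])%G.
Local Notation T := stabT.

Lemma TP B u : low s B ->
  reflect (u \in U /\ B * mx u * (1 - e) = e * mx u * B) (u \in T B).
Proof.
move=> lB; apply: (iffP setIP) => -[Uu Iu]; split=> //.
  apply/(conj_lowP Uu lB lB); apply: irr_inj.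
  by rewrite -lam_conj // inertiaJ.
rewrite inE (subsetP (normal_norm (YnormU F p s))) //=.
by rewrite lam_conj // (proj2 (conj_lowP Uu lB lB) Iu).
Qed.

Lemma TsubU B : T B \subset U. Proof. exact: subsetIl. Qed.
Lemma YsubT B : Y \subset T B. Proof. exact: sub_Inertia (YsubU F p s). Qed.

(** On Y this is the trace form tr(B(u-1)); the factor e u^-1 is what makes it
    additive on the whole inertia group. *)
Definition extfun B u : F := \tr (B * mx u * e * mx u^-1%g).

Lemma tr_corner A N : (1 - e) * N * e = N -> \tr (A * N) = \tr (e * A * (1 - e) * N).
Proof. by move=> {1}<-; rewrite !mulrA trC !mulrA. Qed.

(** Writing the value at v as a trace against v e v^-1 - e, which is supported in the
    upper right block, only the corner of the functional B matters, and this corner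
    is fixed by u. *)
Lemma extfunM B : low s B ->
  {in T B &, forall u v, extfun B (u * v)%g = extfun B u + extfun B v}.
Proof.
move=> lB u v /(TP _ lB)[Uu Hu] /(TP _ lB)[Uv Hv].
have [eB Be] := lowP _ _ lB.
have Uu' : u^-1%g \in U by rewrite groupV.
have Uv' : v^-1%g \in U by rewrite groupV.
have Cu : e * mx u^-1%g * B * mx u * (1 - e) = B.
  exact/(conj_corner (U_Eproj s Uu) (U_Eproj s Uu') (mxVK u) (mxKV u) eB eB).
pose D := mx v * e * mx v^-1%g - e.
have De : (1 - e) * D * e = D.
  exact: conj_proj_sub ee (U_Eproj s Uv) (U_Eproj s Uv') (mxKV v).
have -> : extfun B v = \tr (B * D).
  by rewrite /D mulrBr raddfB /= Be mxtrace0 subr0 /extfun !mulrA.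
have -> : extfun B u = \tr (mx u^-1%g * B * mx u * e).
  by rewrite /extfun trC !mulrA.
have -> : \tr (B * D) = \tr (mx u^-1%g * B * mx u * D).
  by rewrite [RHS]tr_corner // !mulrA Cu.
rewrite -mxtraceD -mulrDr /D addrC subrK /extfun invMg !mxM !mulrA.
by rewrite trC !mulrA.
Qed.

Lemma extfun_lamfun B : low s B -> {in Y, forall u, extfun B u = lamfun B u}.
Proof.
move=> lB u Yu; have [eB Be] := lowP _ _ lB.
have /YP[u1 u2] := Yu; have Yu' : u^-1%g \in Y by rewrite groupV.
have /YP[v1 v2] := Yu'.
rewrite /extfun /lamfun (block_conj u2 v1 (mxKV u)) //.
by rewrite -(Ymul Yu Yu') mulgV mx1 subrr.
Qed.

Lemma ext_exists B (A : {group GL}) : low s B -> Y \subset A -> A \subset T B ->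
  exists f : 'CF(A), [/\ f \is a linear_char, {in A, forall u, f u = psi (extfun B u)}
    & 'Res[Y] f = 'chi_(lam B)].
Proof.
move=> lB sYA sAT; have [u v Au Av|f Lf Df] := @additive_lin_char _ _ A (extfun B).
  by rewrite extfunM ?(subsetP sAT).
exists f; split=> //; apply/cfun_inP=> u Yu.
by rewrite cfResE // Df ?(subsetP sYA) // extfun_lamfun // lamE.
Qed.

Lemma over_bound i B (A : {group GL}) : low s B -> lies_over i B ->
    Y \subset A -> A \subset T B -> A^`(1)%g \subset Y ->
  'chi_i 1%g <= #|U : A|%:R.
Proof.
move=> lB Oi sYA sAT dA; have [f [Lf _ Rf]] := ext_exists lB sYA sAT.
exact: constt_lin_ext_bound (YnormU F p s) sYA (subset_trans sAT (TsubU B)) dA Lf Rf Oi.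
Qed.

End Over.

(** * Comparing two blocks *)

Section TwoBlocks.

Variables (F : finFieldType) (p : nat).
Local Notation n := p.+1.
Local Notation Mn := 'M[F]_n.
Local Notation GL := (GLt F p).
Local Notation U := (unitri F n : {group GL}).
Variables (s s' : nat).
Local Notation Y' := (Yblock F p s').
Local Notation Y := (Yblock F p s).

Let M := (Y :&: Y')%G.
Let nMU : M <| U. Proof. by apply: normalI; apply: YnormU. Qed.

Let Res_lin (r : nat) (B : Mn) (sM : M \subset Yblock F p r) :
  exists2 m, 'Res[M] 'chi_(@lam F p r B) = 'chi_m &
     m \in irr_constt ('Res[M] 'chi_(@lam F p r B)).
Proof.
have : 'Res[M] 'chi_(@lam F p r B) \in irr M.
  by rewrite lin_char_irr // cfRes_lin_char // qualifE /= irr_char lam1 eqxx.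
by case/irrP=> m Dm; exists m; rewrite // Dm irr_consttE cfnorm_irr oner_eq0.
Qed.

(** Both blocks contain their intersection M, and the characters lam B and lam B'
    agree on M exactly when the matrices agree at the common positions. *)
Lemma over_other_block (i : Iirr U) B : lies_over s i B ->
  exists B', [/\ low s' B', lies_over s' i B' &
    forall k l : 'I_n, (l < s <= k)%N -> (l < s' <= k)%N -> B k l = B' k l].
Proof.
move=> Oi; have [sM sM'] : M \subset Y /\ M \subset Y' by rewrite subsetIl subsetIr.
have [m Dm Cm] := Res_lin B sM.
have [|t Ct Cm'] := constt_Res_extend sM sM' _ (YsubU F p s') Oi Cm.
  exact: YsubU.
have [B' lB' Dt] := @lam_onto F p s' t; exists B'; split; [exact: lB' | by rewrite /lies_over -Dt |].
have [m' Dm' _] := Res_lin B' sM'.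
have E : 'Res[M] 'chi_(@lam F p s B) = 'Res[M] 'chi_(@lam F p s' B').
  rewrite Dm Dm'; congr 'chi_ _; move: Cm'; rewrite Dt Dm' irr_consttE cfdot_irr.
  by case: (m' =P m) => [->|_] //; rewrite eqxx.
move=> k l kl kl'; apply: psi_inj => x.
have lt_lk : (l < k)%N by case/andP: kl; apply: leq_trans.
have Mx : elt x l k \in M by rewrite inE !elt_in_Y.
have := congr1 (fun f : 'CF(M) => f (elt x l k)) E.
by rewrite !cfResE // !lamE ?elt_in_Y // !lamfun_elt.
Qed.

(** The restrictions to M, the intersection of the two blocks, lie below the same
    irreducible character of U, hence are conjugate. *)
Lemma over_uniq (i : Iirr U) B B' : lies_over s i B -> lies_over s' i B' ->
  exists2 u, u \in U & forall k l : 'I_n, (l < s <= k)%N -> (l < s' <= k)%N ->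
    conjM u B k l = B' k l.
Proof.
move=> Oi Oi'; have [sM sM'] : M \subset Y /\ M \subset Y' by rewrite subsetIl subsetIr.
have [m Dm Cm] := Res_lin B sM; have [m' Dm' Cm'] := Res_lin B' sM'.
have C1 : m \in irr_constt ('Res[M] 'chi_i).
  rewrite -(cfResRes _ sM) ?YsubU //; apply: constt_Res_trans Oi _ Cm.
  by rewrite cfRes_char ?irr_char.
have C2 : m' \in irr_constt ('Res[M] 'chi_i).
  rewrite -(cfResRes _ sM') ?YsubU //; apply: constt_Res_trans Oi' _ Cm'.
  by rewrite cfRes_char ?irr_char.
have [u Uu Du] := constt_Res_conjg nMU C1 C2; exists u => // k l kl kl'.
apply: psi_inj => x.
have lt_lk : (l < k)%N by case/andP: kl; apply: leq_trans.
have Yx : elt x l k \in Y by rewrite elt_in_Y.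
have Mx : elt x l k \in M by rewrite inE !elt_in_Y.
have nMu := subsetP (normal_norm nMU) u Uu.
have nYu := subsetP (normal_norm (YnormU F p s)) u Uu.
have := congr1 (fun f : 'CF(M) => f (elt x l k)) Du.
rewrite cfConjgE // -Dm -Dm' !cfResE // ?memJ_norm ?groupV //.
rewrite !lamE ?elt_in_Y ?memJ_norm ?groupV // lamfunJ.
by rewrite !lamfun_elt // => ->.
Qed.

End TwoBlocks.

(** * Orders and degree bounds *)

Section Orders.

Variables (F : finFieldType) (p : nat).
Local Notation n := p.+1.
Local Notation Mn := 'M[F]_n.
Local Notation GL := (GLt F p).
Local Notation U := (unitri F n : {group GL}).
Local Notation q := #|F|.
Local Notation Y := (Yblock F p).

Lemma card_lt_ord m k : (k <= m)%N -> #|[pred i : 'I_m | (i < k)%N]| = k.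
Proof.
move=> le_km; rewrite -sum1_card -(big_mkord (fun i => i < k)%N (fun=> 1%N)).
by rewrite -(big_nat_widen 0 k m predT) // sum_nat_const_nat subn0 muln1.
Qed.

Lemma card_ge_ord m k : (k <= m)%N -> #|[pred i : 'I_m | (k <= i)%N]| = (m - k)%N.
Proof.
move=> le_km; have := cardC [pred i : 'I_m | (i < k)%N].
rewrite card_ord card_lt_ord // => /(canRL (addKn _)) <-.
by apply: eq_card => i; rewrite !inE -leqNgt.
Qed.

Lemma card_U : #|U| = (q ^ 'C(n, 2))%N.
Proof.
rewrite U_patset card_patset //; congr (_ ^ _)%N.
rewrite -bin2_sum big_mkord -sum1_card.
transitivity (\sum_(j < n) \sum_(i < n | (i < j)%N) 1)%N; last first.
  apply: eq_bigr => j _; rewrite sum1_card; exact: (card_lt_ord (ltnW (ltn_ord j))).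
rewrite (exchange_big_dep predT) //=.
rewrite pair_big_dep; apply: eq_bigl => -[i j]; rewrite !inE //.
Qed.

Lemma card_Y s : (s <= n)%N -> #|Y s| = (q ^ (s * (n - s)))%N.
Proof.
move=> le_sn; rewrite Y_patset card_patset; last exact: blockpos_upper.
congr (_ ^ _)%N.
rewrite -[RHS](congr2 muln (card_lt_ord le_sn) (card_ge_ord le_sn)) -cardX.
by apply: eq_card => -[i j]; rewrite !inE.
Qed.

Lemma card_F_gt1 : (1 < q)%N. Proof. exact: finNzRing_gt1. Qed.

Lemma twice_bin2 m : (2 * 'C(m, 2) = m * (m - 1))%N.
Proof. by rewrite mul_bin_left bin1 mulnC. Qed.

(** mu n is the codimension of the largest abelian block subgroup. *)
Lemma mu_half s : (s = n./2 \/ s = uphalf n) -> ('C(n, 2) = mu n + s * (n - s))%N.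
Proof.
have := twice_bin2 n; have := odd_double_half n; rewrite uphalf_half /mu.
case: (odd n) => /=; set h := n./2; rewrite -muln2 => Dn b2 [] ->; nia.
Qed.

Lemma half_le s : (s = n./2 \/ s = uphalf n) -> (s <= n)%N.
Proof. by case=> ->; lia. Qed.

Lemma index_Y s : (s = n./2 \/ s = uphalf n) -> #|U : Y s| = (q ^ mu n)%N.
Proof.
move=> Ds; apply/eqP; rewrite -(eqn_pmul2l (cardG_gt0 (Y s))) Lagrange ?YsubU //.
by rewrite card_U card_Y ?half_le // (mu_half Ds) expnD mulnC.
Qed.

(** A character of the abelian subgroup Y of index q^mu(n) induces to a character
    that contains the given one. *)
Lemma irr_bound (i : Iirr U) : 'chi_i 1%g <= (q ^ mu n)%:R.
Proof.
have Ds : n./2 = n./2 \/ n./2 = uphalf n by left.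
rewrite -(index_Y Ds); have [B lB OB] := over_exists n./2 i.
apply: (over_bound lB OB); rewrite ?YsubT //.
by rewrite (derG1P (Yabelian _ _ _)) sub1G.
Qed.

Section Family.

Variables (s m : nat) (B : Mn) (N : 'I_m -> Mn).
Local Notation e := (tail_proj F p s).
Hypotheses (lB : low s B) (uN : forall k, supp (@ltord p) (N k)).
Hypotheses (eN : forall k, e * N k = N k * e) (NB : forall k, N k * B = B * N k).
Hypothesis NN : forall k l, N k * N l = 0.
Hypothesis freeN : forall v : 'rV[F]_m, \sum_k v 0 k *: N k = 0 -> v = 0.

Let comb (v : 'rV[F]_m) : Mn := \sum_k v 0 k *: N k.

Let combD v w : comb (v + w) = comb v + comb w.
Proof. by rewrite -big_split; apply: eq_bigr => k _; rewrite mxE scalerDl. Qed.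

Let combM v w : comb v * comb w = 0.
Proof.
rewrite mulr_suml big1 // => k _; rewrite mulr_sumr big1 // => l _.
by rewrite -scalerAl -scalerAr NN !scaler0.
Qed.

Let comb_supp v : supp (@ltord p) (comb v).
Proof.
apply/suppP=> i j nP; rewrite summxE big1 // => k _.
by rewrite mxE (suppP _ _ (uN k) _ _ nP) mulr0.
Qed.

Let mx_comb v : mx (mkGL (1 + comb v)) = 1 + comb v.
Proof. by apply: (@mkGL_upper _ _ (@ltord p)). Qed.

Let A0set : {set GL} := [set g | [exists v, mx g == 1 + comb v]].

Let A0P g : reflect (exists v, mx g = 1 + comb v) (g \in A0set).
Proof. by rewrite inE; apply: (iffP existsP) => -[v /eqP]; exists v => //; apply/eqP. Qed.

Let A0M v w : (1 + comb v) * (1 + comb w) = 1 + comb (v + w).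
Proof. by rewrite mulrDl mul1r mulrDr mulr1 combM addr0 combD addrAC addrA. Qed.

Let A0_group_set : group_set A0set.
Proof.
apply/group_setP; split=> [|g h /A0P[v Dv] /A0P[w Dw]]; apply/A0P.
  by exists 0; rewrite mx1 /comb big1 ?addr0 // => k _; rewrite mxE scale0r.
by exists (v + w); rewrite mxM Dv Dw A0M.
Qed.

Let A0 := Group A0_group_set.

Let A0abel : abelian A0.
Proof.
apply/centsP=> g /A0P[v Dv] h /A0P[w Dw]; apply: mx_inj.
by rewrite !mxM Dv Dw !A0M (addrC v).
Qed.

Let comb_inj : injective comb.
Proof.
move=> v w E; apply/eqP; rewrite -subr_eq0; apply/eqP/freeN.
transitivity (comb (v - w)) => //; apply: (addIr (comb w)).
by rewrite -combD subrK add0r.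
Qed.

Let card_A0 : #|A0| = (q ^ m)%N.
Proof.
rewrite -[m]mul1n -(card_mx F 1 m) -cardsT.
rewrite -(@card_in_imset _ _ (fun v => mkGL (1 + comb v))); last first.
  by move=> v w _ _ /(congr1 mx); rewrite !mx_comb => /addrI/comb_inj.
apply: eq_card => g; apply/A0P/imsetP => [[v Dv]|[v _ ->]]; last by exists v; rewrite mx_comb.
by exists v; rewrite ?inE //; apply: mx_inj; rewrite mx_comb.
Qed.

Let A0U : A0 \subset U.
Proof.
by apply/subsetP=> g /A0P[v Dv]; rewrite U_patset inE Dv addrC addKr comb_supp.
Qed.

Let combe v : e * comb v = comb v * e.
Proof.
by rewrite mulr_sumr mulr_suml; apply: eq_bigr => k _; rewrite -scalerAr eN scalerAl.
Qed.

Let combB v : comb v * B = B * comb v.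
Proof.
by rewrite mulr_sumr mulr_suml; apply: eq_bigr => k _; rewrite -scalerAr -NB scalerAl.
Qed.

Let A0T : A0 \subset stabT s B.
Proof.
apply/subsetP=> g A0g; apply/(TP _ lB); split; first exact: (subsetP A0U).
have /A0P[v Dv] := A0g; have [eB Be] := lowP _ _ lB.
by rewrite Dv; apply: commuting_stab; rewrite ?combe ?combB.
Qed.

Let TIA0 : Y s :&: A0 = 1%g.
Proof.
apply/trivgP/subsetP=> g /setIP[/YP[g1 g2] /A0P[v Dv]]; apply/set1P/mx_inj.
rewrite mx1 Dv; apply/eqP; rewrite -subr_eq0 addrC addKr; apply/eqP.
have e0 : e * comb v = 0.
  by apply: (addrI e); rewrite addr0 -{3}g1 Dv mulrDr mulr1.
move: g2; rewrite Dv mulrDl mul1r => /(canRL (addKr _)); rewrite addNr.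
by rewrite mulrBr mulr1 -combe e0 subr0.
Qed.

(** The matrices 1 + sum v_k N_k form an elementary abelian group of order q^m
    that fixes B and meets Y trivially; over_bound then applies to its product
    with Y. *)
Lemma family_bound (i : Iirr U) : lies_over s i B ->
  'chi_i 1%g * (q ^ m)%:R <= #|U : Y s|%:R.
Proof.
move=> Oi; pose A := (Y s <*> A0)%G.
have nYA0 : A0 \subset 'N(Y s) := subset_trans A0U (normal_norm (YnormU F p s)).
have sAU : A \subset U by rewrite join_subG YsubU A0U.
have sYA : Y s \subset A := joing_subl _ _.
have cA : #|A| = (#|Y s| * q ^ m)%N.
  have -> : A = (Y s * A0)%g :> {set GL} by apply: norm_joinEr.
  by rewrite TI_cardMg ?card_A0; last exact: TIA0.
have dA : A^`(1)%g \subset Y s.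
  apply: der1_min; first by rewrite join_subG normG.
  by rewrite quotientYidl // quotient_abelian.
have := over_bound lB Oi sYA _ dA; rewrite join_subG YsubT A0T => /(_ isT).
rewrite -(Lagrange_index sAU sYA) natrM => le_chi.
have -> : #|A : Y s| = (q ^ m)%N.
  apply/eqP; rewrite -(eqn_pmul2l (cardG_gt0 (Y s))) Lagrange //.
  by rewrite cA.
by rewrite ler_wpM2r ?ler0n.
Qed.

End Family.
End Orders.

(** * Root subgroups, pattern subgroups and diagonal projections *)

Section Generators.

Variables (F : finFieldType) (p : nat).
Local Notation n := p.+1.
Local Notation Mn := 'M[F]_n.
Local Notation GL := (GLt F p).
Local Notation U := (unitri F n : {group GL}).

Lemma mul_delta_mxE (x : F) (i j : 'I_n) (A : Mn) k l :
  ((1 + x *: delta_mx i j) * A) k l = A k l + (k == i)%:R * x * A j l.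
Proof.
rewrite mulrDl mul1r mxaddE -scalerAl [X in _ + X]mxE; congr (_ + _).
rewrite mulmxEij (bigD1 j) //= big1 ?addr0 => [|m nm].
  by rewrite mxE eqxx andbT mulrCA mulrA.
by rewrite mxE (negbTE nm) andbF mul0r.
Qed.

Lemma eltM_entry (x : F) (i j : 'I_n) (g : GL) k l : (i < j)%N ->
  mx (elt x i j * g)%g k l = mx g k l + (k == i)%:R * x * mx g j l.
Proof. by move=> ij; rewrite mxM mx_elt // mul_delta_mxE. Qed.

Lemma elt_Xroot (x : F) (i j : 'I_n) : (i < j)%N -> (elt x i j : {'GL_n[F]}) \in Xroot F n i.+1 j.
Proof.
move=> lt_ij; apply/XP; exists x; rewrite /= !inord_val mxval; apply: mx_elt lt_ij.
Qed.

Lemma Xroot_entry s t (g : GL) : (0 < s <= t)%N -> (t < n)%N -> g \in Xroot F n s t ->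
  exists x, forall k l : 'I_n, mx g k l = (k == l)%:R + x * ((k.+1 == s) && (l == t :> nat))%:R.
Proof.
move=> st tn /XP[x Dx]; exists x => k l.
rewrite -mxval.
by rewrite Dx mxaddE [X in _ + X]mxE Xval // mxE.
Qed.

(** Multiplying on the left by root elements reduces g to 1: in the last row with a
    nonzero entry above the diagonal, one entry at a time is removed, by induction
    on the number of these entries. Only positions of nonzero entries of g occur. *)
Lemma in_Xgen (P : nat -> nat -> bool) (g : GL) : g \in U ->
  (forall i j : 'I_n, (i < j)%N -> mx g i j != 0 -> P i.+1 j) ->
  (g : {'GL_n[F]}) \in Xgen F n P.
Proof.
pose nz (h : GL) := #|[set rc : 'I_n * 'I_n | (rc.1 < rc.2)%N && (mx h rc.1 rc.2 != 0)]|.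
have [m] := ubnP (nz g); elim: m g => // m IHm g le_nz /UP Ug Pg.
pose bad (r : 'I_n) := [exists c : 'I_n, (r < c)%N && (mx g r c != 0)].
have [/existsP[r0 bad0] | /existsPn stab_nil] := boolP [exists r, bad r]; last first.
  suff ->: g = 1%g by apply: group1.
  apply/mx_inj/matrixP=> r c; rewrite mx1 mxE; have [/Ug// | lt_rc] := leqP c r.
  have /existsPn/(_ c) := stab_nil r; rewrite lt_rc negbK => /eqP->.
  by rewrite -val_eqE ltn_eqF.
case: (@arg_maxnP _ r0 bad (@nat_of_ord _) bad0) => r bad_r max_r.
have [c /andP[lt_rc nz_rc]] := existsP bad_r.
have row_c k : mx g c k = (c == k)%:R.
  have [le_kc | lt_ck] := leqP k c; first exact: Ug.
  apply/eqP; rewrite -val_eqE /= ltn_eqF //; apply: contraTT lt_rc => nz_ck.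
  by rewrite -leqNgt; apply: max_r; apply/existsP; exists k; rewrite lt_ck.
pose x := elt (- mx g r c) r c.
have Xx : (x : {'GL_n[F]}) \in Xgen F n P.
  have Prc : P r.+1 c by apply: Pg.
  by apply: subsetP (elt_Xroot _ lt_rc); apply: X_sub_Xgen.
have Ex k l : mx (x * g)%g k l = mx g k l - ((k == r) && (l == c))%:R * mx g r c.
  rewrite eltM_entry // row_c (eq_sym c) -mulnb natrM.
  by rewrite mulrN mulNr mulrAC.
rewrite -(@groupMl _ (Xgen F n P) x g Xx); apply: IHm.
- rewrite ltnS in le_nz; apply: leq_trans le_nz; apply: proper_card.
  apply/properP; split.
    apply/subsetP=> -[k l]; rewrite !inE /= Ex => /andP[->].
    case: andP => [[/eqP-> /eqP->]|]; first by rewrite mul1r subrr eqxx.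
    by rewrite mul0r subr0.
  exists (r, c); rewrite !inE /= ?lt_rc //=.
  by rewrite Ex !eqxx mul1r subrr eqxx.
- apply/UP=> i j le_ji; rewrite Ex Ug //.
  case: andP => [[/eqP Di /eqP Dj]|]; last by rewrite mul0r subr0.
  by rewrite Di Dj leqNgt lt_rc in le_ji.
- move=> i j lt_ij; rewrite Ex; case: andP => [[/eqP-> /eqP->]|_].
    by rewrite mul1r subrr eqxx.
  by rewrite mul0r subr0 => nz_ij; apply: Pg.
Qed.

Definition diag_proj (P : pred nat) : Mn := \matrix_(i, j) ((i == j) && P i)%:R.
Local Notation D := diag_proj.

Lemma mulDl P A i j : (D P * A) i j = (P i)%:R * A i j.
Proof.
rewrite mulmxEij (bigD1 i) //= big1 ?addr0 ?mxE ?eqxx // => k.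
by rewrite mxE eq_sym => /negbTE->; rewrite mul0r.
Qed.

Lemma mulDr P A i j : (A * D P) i j = A i j * (P j)%:R.
Proof.
rewrite mulmxEij (bigD1 j) //= big1 ?addr0 ?mxE ?eqxx // => k.
by rewrite mxE => /negbTE->; rewrite mulr0.
Qed.

Implicit Types (g h u v : GL) (A B : Mn).

(** The matrices of U that are trivial outside the diagonal block cut out by the
    idempotent f. *)
Definition princset (f : Mn) : {set GL} :=
  [set g in U | (mx g * (1 - f) == 1 - f) && ((1 - f) * mx g == 1 - f)].

Lemma princP f g : reflect [/\ g \in U, mx g * (1 - f) = 1 - f & (1 - f) * mx g = 1 - f]
  (g \in princset f).
Proof.
by apply: (iffP setIdP) => [[Ug /andP[/eqP-> /eqP->]]|[Ug -> ->]]; rewrite ?eqxx.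
Qed.

Lemma princ_group_set f : group_set (princset f).
Proof.
apply/group_setP; split=> [|g h /princP[Ug g1 g2] /princP[Uh h1 h2]].
  by apply/princP; rewrite group1 mx1 mulr1 mul1r.
by apply/princP; rewrite groupM // mxM mulrA g2 h2 -mulrA h1 g1.
Qed.
Canonical princgroup f := Group (princ_group_set f).

Lemma princD_entries P g : g \in U ->
  (g \in princset (D P)) = [forall i : 'I_n, forall j : 'I_n,
     (~~ (P i && P j)) ==> (mx g i j == (i == j)%:R)].
Proof.
move=> Ug; apply/princP/forallP => [[_ g1 g2] i | H].
  apply/forallP=> j; apply/implyP; rewrite negb_and => /orP[nP | nP].
    have /matrixP/(_ i j) := g2; rewrite mulrBl mul1r !mxsubE mulDl (negbTE nP).
    by rewrite mul0r !subr0 => ->; rewrite !mxE (negbTE nP) andbF subr0.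
  have /matrixP/(_ i j) := g1; rewrite mulrBr mulr1 !mxsubE mulDr (negbTE nP).
  rewrite mulr0 !subr0 => ->; rewrite !mxE.
  by case: (i =P j) => [->|_]; rewrite ?(negbTE nP) ?subr0.
have {}H (i j : 'I_n) : ~~ (P i && P j) -> mx g i j = (i == j)%:R.
  by move=> nP; have /forallP/(_ j)/implyP/(_ nP)/eqP := H i.
split=> //; apply/matrixP=> i j.
  rewrite mulrBr mulr1 !mxsubE mulDr ![in RHS]mxE; case: (boolP (P j)) => Pj.
    by rewrite mulr1 subrr; case: (i =P j) => [->|_]; rewrite ?Pj ?subrr ?subr0.
  rewrite mulr0 subr0 H ?negb_and ?Pj ?orbT //.
  by case: (i =P j) => [->|_]; rewrite ?(negbTE Pj) ?subr0.
rewrite mulrBl mul1r !mxsubE mulDl ![in RHS]mxE; case: (boolP (P i)) => Pi.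
  by rewrite mul1r subrr andbT subrr.
by rewrite mul0r subr0 andbF subr0 H // negb_and Pi.
Qed.

Lemma princ_supp f g : f * f = f -> g \in princset f -> f * (mx g - 1) * f = mx g - 1.
Proof.
move=> ff /princP[_ g1 g2]; have h1 : (mx g - 1) * f = mx g - 1.
  apply/eqP; rewrite eq_sym -subr_eq0 -{1}[mx g - 1]mulr1 -mulrBr mulrBl g1.
  by rewrite mul1r subrr.
rewrite -mulrA h1; apply/eqP; rewrite eq_sym -subr_eq0 -{1}[mx g - 1]mul1r -mulrBl.
by rewrite mulrBr g2 mulr1 subrr.
Qed.

Lemma Usub_princ a b : (0 < a)%N ->
  (Usub F n a b : {set GL}) = princset (D (fun i => (a <= i.+1) && (i <= b)))%N.
Proof.
move=> a_gt0; apply/eqP; rewrite eqEsubset; apply/andP; split.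
  apply: (@Xgen_sub F n _ (princgroup _)) => s t st tn /andP[le_as le_tb].
  apply/subsetP=> g Xg; have Ug : g \in U by apply: subsetP (X_sub_unitri _ st tn) _ Xg.
  have [x Dx] := Xroot_entry st tn Xg.
  rewrite /= princD_entries //; apply/forallP=> i; apply/forallP=> j; apply/implyP=> nP.
  rewrite Dx; case: andP => [[/eqP Di /eqP Dj]|_]; last by rewrite mulr0 addr0.
  by case/negP: nP; rewrite Di Dj le_as le_tb /=; lia.
apply/subsetP=> g Wg; have /princP[Ug _ _] := Wg.
move: Wg; rewrite princD_entries // => /forallP W; apply: in_Xgen => // i j lt_ij nz.
have /forallP/(_ j)/implyP := W i.
case: (boolP (_ && _)) => [Pij _|nP /(_ isT)]; first by case/andP: Pij; lia.
by rewrite -val_eqE ltn_eqF //= (negbTE nz).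
Qed.

End Generators.

(** * Inertia groups of monomial corners *)

Section CornerRing.

Variables (R : pzRingType) (t f e b b' : R).
Hypotheses (tfe : t + f + e = 1).
Hypotheses (tt : t * t = t) (ff : f * f = f) (ee : e * e = e).
Hypotheses (tf : t * f = 0) (ft : f * t = 0) (te : t * e = 0) (et : e * t = 0).
Hypotheses (ef : e * f = 0) (fe : f * e = 0).
Hypotheses (eb : e * b = b) (bt : b * t = b) (b'b : b' * b = t) (bb' : b * b' = e).
Hypotheses (tb' : t * b' = b') (b'e : b' * e = b').

Let D1 x : x = t * x + f * x + e * x. Proof. by rewrite -!mulrDl tfe mul1r. Qed.
Let D2 x : x = x * t + x * f + x * e. Proof. by rewrite -!mulrDr tfe mulr1. Qed.
Let fb : f * b = 0. Proof. by rewrite -eb mulrA fe mul0r. Qed.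
Let tb : t * b = 0. Proof. by rewrite -eb mulrA te mul0r. Qed.
Let bf : b * f = 0. Proof. by rewrite -bt -mulrA tf mulr0. Qed.
Let bb : b * b = 0. Proof. by rewrite -{2}eb -bt -!mulrA (mulrA t) te mul0r mulr0. Qed.
Let b't : b' * t = 0. Proof. by rewrite -b'e -mulrA et mulr0. Qed.

(** With t, f, e the projections to the first k, the middle and the last k
    coordinates, and b the isomorphism from the first to the last ones: g commutes
    with e and b, hence with b' and t, up to its f-t block. *)
Lemma ring_commf g : e * g = g * e -> g * b = b * g -> f * g * t = 0 -> g * f = f * g.
Proof.
move=> eg gb fgt; have tgf : t * g * f = 0.
  by rewrite -b'b -(mulrA b') -gb -!mulrA bf !mulr0.
have gf : g * f = f * g * f.
  by rewrite [LHS]D1 !mulrA tgf add0r eg -(mulrA g) ef mulr0 addr0.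
have fg : f * g = f * g * f.
  by rewrite [LHS]D2 fgt add0r -(mulrA f g e) -eg mulrA fe mul0r addr0.
by rewrite gf -fg.
Qed.

(** An endomorphism commuting with b and vanishing on the middle is determined by
    its action on the first coordinates, transported to the last ones by b. *)
Lemma ring_cdouble h : e * h = h * e -> h * b = b * h -> f * h = 0 -> h * f = 0 ->
  h = t * h * t + b * (t * h * t) * b'.
Proof.
move=> eh hb fh hf.
have th : t * h = t * h * t.
  rewrite [LHS]D2 -(mulrA t h f) hf mulr0 -(mulrA t h e) -eh (mulrA t) te mul0r !addr0 //.
rewrite -th {1}[h]D1 fh addr0; congr (_ + _).
by rewrite mulrA bt -hb -mulrA bb' eh.
Qed.

Lemma ring_cdoubleM x y : t * x * t = x -> t * y * t = y ->
  (x + b * x * b') * (y + b * y * b') = x * y + b * (x * y) * b'.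
Proof.
move=> xt yt; have xb : x * b = 0 by rewrite -xt -mulrA tb mulr0.
have b'y : b' * y = 0 by rewrite -yt !mulrA b't !mul0r.
have xt' : x * t = x by rewrite -xt -!mulrA tt.
rewrite mulrDl !mulrDr !mulrA xb !mul0r addr0; congr (_ + _).
rewrite -!(mulrA (b * x)) b'y mulr0 add0r !mulrA -(mulrA (b * x) b') b'b.
by rewrite -(mulrA b x t) xt'.
Qed.

Lemma ring_cdouble_comm x : t * x * t = x ->
  [/\ e * (x + b * x * b') = (x + b * x * b') * e,
      (x + b * x * b') * b = b * (x + b * x * b'),
      f * (x + b * x * b') = 0 & t * (x + b * x * b') * t = x].
Proof.
move=> xt.
have xb : x * b = 0 by rewrite -xt -mulrA tb mulr0.
have xe : x * e = 0 by rewrite -xt -mulrA te mulr0.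
have ex : e * x = 0 by rewrite -xt !mulrA et !mul0r.
have fx : f * x = 0 by rewrite -xt !mulrA ft !mul0r.
have xt' : x * t = x by rewrite -xt -!mulrA tt.
split.
- by rewrite mulrDr mulrDl ex xe !mulrA eb -!mulrA b'e.
- rewrite mulrDr mulrDl xb add0r !mulrA bb !mul0r addr0.
  by rewrite -(mulrA (b * x)) b'b -mulrA xt'.
- by rewrite mulrDr fx !mulrA fb !mul0r !addr0.
by rewrite mulrDr mulrDl xt !mulrA tb !mul0r addr0.
Qed.

End CornerRing.

Section DiagRing.

Variables (R : pzRingType) (e u : R).
Hypotheses (ee : e * e = e) (eue : e * u * e = e * u).

(** The block diagonal part of u, with respect to e and 1 - e. *)
Lemma ring_diag : 1 + (e * (u - 1) + (u - 1) * (1 - e)) = e * u + u * (1 - e).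
Proof.
rewrite mulrBr mulr1 (mulrBl (1 - e) u) mul1r addrACA -opprD.
by rewrite (addrCA e 1) subrr addr0 (addrCA 1) subrr addr0.
Qed.

Lemma ring_diag_e : e * (e * u + u * (1 - e)) = (e * u + u * (1 - e)) * e.
Proof.
rewrite (mulrDr e) (mulrDl _ _ e) !mulrA ee eue -[u * (1 - e) * e]mulrA mulrBl mul1r ee subrr mulr0.
by rewrite mulrBr mulr1 eue subrr.
Qed.

Lemma ring_diag_b b : e * b = b -> b * e = 0 -> b * u * (1 - e) = e * u * b ->
  (e * u + u * (1 - e)) * b = b * (e * u + u * (1 - e)).
Proof.
move=> eb be bu; rewrite (mulrDr b) (mulrDl _ _ b) !mulrA be mul0r add0r bu.
by rewrite -[u * (1 - e) * b]mulrA mulrBl mul1r eb subrr mulr0 addr0.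
Qed.

Lemma ring_diag_y c c' : e * u + u * (1 - e) = c -> c * c' = 1 -> c' * c = 1 ->
  e * (u * c') = e /\ u * c' * (1 - e) = 1 - e.
Proof.
move=> Dc ord_from_end c'c; have ec : e * c = e * u.
  by rewrite -Dc mulrDr !mulrA ee mulrBr mulr1 eue subrr addr0.
have c1 : c * (1 - e) = u * (1 - e).
  have h : (1 - e) * (1 - e) = 1 - e.
    by rewrite mulrBl mul1r mulrBr mulr1 ee subrr subr0.
  by rewrite -Dc mulrDl -(mulrA u) h (mulrBr (e * u)) mulr1 eue subrr add0r.
split; first by rewrite mulrA -ec -mulrA ord_from_end mulr1.
have ec' : e * c = c * e by rewrite -Dc; apply: ring_diag_e.
have ec'' : c' * e = e * c'.
  transitivity (c' * (e * c) * c'); first by rewrite -!mulrA ord_from_end mulr1.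
  by rewrite ec' mulrA c'c mul1r.
have cc1 : c' * (1 - e) = (1 - e) * c' by rewrite mulrBr mulrBl mulr1 mul1r ec''.
by rewrite -mulrA cc1 mulrA -c1 -mulrA -cc1 mulrA ord_from_end mul1r.
Qed.

End DiagRing.

Section Corner.

Variables (F : finFieldType) (p : nat).
Local Notation n := p.+1.
Local Notation Mn := 'M[F]_n.
Local Notation GL := (GLt F p).
Local Notation U := (unitri F n : {group GL}).
Local Notation D := (diag_proj F p).
Implicit Types (g h u : GL).

Lemma DD P Q : D P * D Q = D (predI P Q).
Proof.
apply/matrixP=> i j; rewrite mulDl !mxE.
by case: eqP => [->|_]; rewrite /= ?mulr0 // -natrM mulnb.
Qed.

Lemma eqD (P Q : pred nat) : (forall i, i < n -> P i = Q i)%N -> D P = D Q.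
Proof. by move=> PQ; apply/matrixP=> i j; rewrite !mxE PQ. Qed.

Lemma D_0 (P : pred nat) : (forall i, i < n -> ~~ P i)%N -> D P = 0.
Proof. by move=> nP; apply/matrixP=> i j; rewrite !mxE (negbTE (nP i _)) ?andbF. Qed.

Lemma E_D s : tail_proj F p s = D (leq s).
Proof. by apply/matrixP=> i j; rewrite !mxE. Qed.

(** A functional B supported in the lower left corner of the matrices: row r of the
    upper right block is paired with the single column cstart + cperm r, with the
    nonzero coefficient cscal r. These are the normal forms of the functionals that
    occur for large degrees. *)
Record corner_datum := CornerDatum {
  csize : nat; cperm : nat -> nat; cscal : nat -> F;
  csize_small : (csize + csize <= n)%N;
  cperm_lt : forall i, (i < csize)%N -> (cperm i < csize)%N;
  cperm_inj : forall i j, (i < csize)%N -> (j < csize)%N -> cperm i = cperm j -> i = j;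
  cperm_surj : forall c, (c < csize)%N -> exists2 i, (i < csize)%N & cperm i = c;
  cscal_nz : forall i, (i < csize)%N -> cscal i != 0 }.

Variable d : corner_datum.
Local Notation k := (csize d).
Local Notation pi := (cperm d).
Local Notation b := (cscal d).
(** For a corner of size k the block Y is taken with the last k columns, so that
    B is invertible from the first k coordinates to the last k ones. *)
Definition cstart := (n - k)%N.
Local Notation s := cstart.
Local Notation e := (tail_proj F p s).

Lemma k_le_s : (k <= s)%N. Proof. by rewrite /cstart; have := csize_small d; lia. Qed.
Lemma s_k : (s + k = n)%N. Proof. by rewrite /cstart; have := csize_small d; lia. Qed.

Definition cmid := D (fun i => (k <= i) && (i < s))%N.
Definition ctop := D (fun i => i < k)%N.
Local Notation f := cmid.
Local Notation t := ctop.

Definition cB : Mn := \matrix_(c, r) (if (r < k)%N && (c == s + pi r :> nat)%N then b r else 0).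
Definition cBinv : Mn := \matrix_(r, c) (if (r < k)%N && (c == s + pi r :> nat)%N then (b r)^-1 else 0).
Local Notation B := cB.
Local Notation B' := cBinv.

Lemma c_tfe : t + f + e = 1.
Proof.
apply/matrixP=> i j; rewrite !mxaddE !mxE; have := k_le_s.
case: eqP => [_|]; rewrite ?addr0 //=.
by case: (ltnP i k); case: (ltnP i s) => ? ? ?; rewrite /= ?addr0 ?add0r //; lia.
Qed.

Lemma c_tt : t * t = t. Proof. by rewrite DD; apply: eqD => i /=; rewrite andbb. Qed.
Lemma c_ff : f * f = f. Proof. by rewrite DD; apply: eqD => i /=; rewrite andbb. Qed.
Lemma c_ee : e * e = e. Proof. exact: Eidem. Qed.
Lemma c_tf : t * f = 0. Proof. by rewrite DD; apply: D_0 => i /=; have := k_le_s; lia. Qed.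
Lemma c_ft : f * t = 0. Proof. by rewrite DD; apply: D_0 => i /=; have := k_le_s; lia. Qed.
Lemma c_te : t * e = 0. Proof. by rewrite E_D DD; apply: D_0 => i /=; have := k_le_s; lia. Qed.
Lemma c_et : e * t = 0. Proof. by rewrite E_D DD; apply: D_0 => i /=; have := k_le_s; lia. Qed.
Lemma c_fe : f * e = 0. Proof. by rewrite E_D DD; apply: D_0 => i /=; have := k_le_s; lia. Qed.
Lemma c_ef : e * f = 0. Proof. by rewrite E_D DD; apply: D_0 => i /=; have := k_le_s; lia. Qed.

Lemma c_eb : e * B = B.
Proof.
apply/matrixP=> i j; rewrite mulEl !mxE; case: (leqP s i) => si; rewrite ?mul1r // mul0r.
by case: ifP => //; lia.
Qed.
Lemma c_bt : B * t = B.
Proof.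
apply/matrixP=> i j; rewrite mulDr !mxE; case: (ltnP j k) => jk; rewrite ?mulr1 // mulr0 //.
Qed.
Lemma c_tb' : t * B' = B'.
Proof.
apply/matrixP=> i j; rewrite mulDl !mxE; case: (ltnP i k) => jk; rewrite ?mul1r // mul0r //.
Qed.
Lemma c_b'e : B' * e = B'.
Proof.
apply/matrixP=> i j; rewrite mulEr !mxE; case: (leqP s j) => si; rewrite ?mulr1 // mulr0.
by case: ifP => //; lia.
Qed.

Lemma c_b'b : B' * B = t.
Proof.
apply/matrixP=> i j; rewrite mulmxEij [RHS]mxE; case: (ltnP i k) => ik; last first.
  by rewrite andbF big1 // => l _; rewrite !mxE ltnNge ik mul0r.
have lt_c : (s + pi i < n)%N by have := s_k; have := cperm_lt ik; lia.
rewrite (bigD1 (Ordinal lt_c)) //= big1 ?addr0 => [|l nl]; last first.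
  rewrite mxE ik /=; case: eqP => El; last by rewrite mul0r.
  by case/eqP: nl; apply: val_inj.
rewrite !mxE ik /= eqxx andbT eqn_add2l; have [<-|ne_ij] := eqVneq i j.
  by rewrite ik eqxx /= mulVf // cscal_nz.
case: ifP => [/andP[jk /eqP E]|]; last by rewrite mulr0.
by case/eqP: ne_ij; apply: val_inj; apply: cperm_inj E.
Qed.

Lemma c_bb' : B * B' = e.
Proof.
apply/matrixP=> i j; rewrite mulmxEij [RHS]mxE; case: (leqP s i) => si; last first.
  rewrite andbF big1 // => l _; rewrite !mxE; case: ifP; last by rewrite mul0r.
  by lia.
have [|r rk Er] := @cperm_surj d (i - s); first by have := ltn_ord i; have := s_k; lia.
have lt_r : (r < n)%N by have := csize_small d; lia.
have Ei : nat_of_ord i = (s + pi r)%N by rewrite Er; lia.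
rewrite (bigD1 (Ordinal lt_r)) //= big1 ?addr0 => [|l nl]; last first.
  rewrite mxE; case: ifP => [/andP[lk /eqP El]|]; last by rewrite mul0r.
  case/eqP: nl; apply: val_inj => /=; apply: (cperm_inj lk rk); lia.
rewrite !mxE rk /= -Ei eqxx andbT [nat_of_ord j == i]eq_sym val_eqE.
by case: eqP => _; rewrite ?mulr0 // mulfV // cscal_nz.
Qed.

Lemma c_be : B * e = 0. Proof. by rewrite -c_bt -mulrA c_te mulr0. Qed.

Lemma c_low : low s B.
Proof. by apply/lowP; rewrite c_eb c_be. Qed.

(** The middle factor K of the inertia group, which is the subgroup U_alpha from
    which characters are inflated. *)
Definition cK : {group GL} := Usub F n k.+1 (n - k - 1).
Lemma cK_set : cK = princset f :> {set GL}.
Proof.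
have -> : f = D (fun i => (k.+1 <= i.+1) && (i <= n - k - 1))%N.
  by apply: eqD => i; rewrite /cstart; have := csize_small d; lia.
exact: Usub_princ.
Qed.

(** The block diagonal stabilisers of B. *)
Definition cCset : {set GL} :=
  [set g in U | (e * mx g == mx g * e) && (mx g * B == B * mx g)].
Lemma cCP g : reflect [/\ g \in U, e * mx g = mx g * e & mx g * B = B * mx g] (g \in cCset).
Proof.
by apply: (iffP setIdP) => [[Ug /andP[/eqP-> /eqP->]]|[Ug -> ->]]; rewrite ?eqxx.
Qed.
Lemma cC_group_set : group_set cCset.
Proof.
apply/group_setP; split=> [|g h /cCP[Ug g1 g2] /cCP[Uh h1 h2]].
  by apply/cCP; rewrite group1 mx1 !mulr1 !mul1r.
apply/cCP; rewrite groupM // mxM mulrA g1 -!mulrA -h1; split=> //.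
by rewrite h2 !mulrA g2.
Qed.
Canonical cCgroup := Group cC_group_set.
Definition cC : {group GL} := cCgroup.

(** The factor S of the inertia group: it moves only the first k and the last k
    coordinates, and B intertwines the two actions. *)
Definition cSset : {set GL} := [set g in cC | f * mx g == f].
Lemma cSP g : reflect (g \in cC /\ f * mx g = f) (g \in cSset).
Proof. by apply: (iffP setIdP) => [[? /eqP]|[? ->]]; rewrite ?eqxx. Qed.
Lemma cS_group_set : group_set cSset.
Proof.
apply/group_setP; split=> [|g h /cSP[Cg g1] /cSP[Ch h1]].
  by apply/cSP; rewrite group1 mx1 mulr1.
by apply/cSP; rewrite groupM // mxM mulrA g1.
Qed.
Canonical cSgroup := Group cS_group_set.
Definition cS : {group GL} := cSgroup.

Local Ltac cring := solve [exact: c_tfe | exact: c_tt | exact: c_ff | exact: c_ee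
  | exact: c_tf | exact: c_ft | exact: c_te | exact: c_et | exact: c_ef | exact: c_fe
  | exact: c_eb | exact: c_bt | exact: c_b'b | exact: c_bb' | exact: c_tb' | exact: c_b'e].

Lemma mid_U_top u : u \in U -> f * mx u * t = 0.
Proof.
move=> /UP Uu; apply/matrixP=> i j; rewrite mulDr mulDl mxE [X in X = 0]mulrAC.
case: (boolP ((k <= i) && (i < s)))%N => ki; last by rewrite !mul0r.
case: (ltnP j k) => jk; last by rewrite mulr0 mul0r.
rewrite Uu; last by lia.
by case: eqP => [Eij|_]; rewrite ?mulr0 //; move: ki jk; rewrite Eij; lia.
Qed.

Lemma cC_f g : g \in cC -> mx g * f = f * mx g.
Proof.
case/cCP=> Ug g1 g2.
by apply: (@ring_commf _ t f e B B') => //; first [cring | exact: mid_U_top].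
Qed.

Lemma suppB (P : rel 'I_n) (A A' : Mn) : supp P A -> supp P A' -> supp P (A - A').
Proof. by move=> /suppP h /suppP h'; apply/suppP=> i j nP; rewrite mxsubE h ?h' ?subr0. Qed.
Lemma suppD (P : rel 'I_n) (A A' : Mn) : supp P A -> supp P A' -> supp P (A + A').
Proof. by move=> /suppP h /suppP h'; apply/suppP=> i j nP; rewrite mxaddE h ?h' ?addr0. Qed.
Lemma supp_DM P Q (A : Mn) : supp P A -> supp P (D Q * A).
Proof. by move=> /suppP h; apply/suppP=> i j nP; rewrite mulDl h ?mulr0. Qed.
Lemma supp_MD P Q (A : Mn) : supp P A -> supp P (A * D Q).
Proof. by move=> /suppP h; apply/suppP=> i j nP; rewrite mulDr h ?mul0r. Qed.
Lemma supp_U u : u \in U -> supp (@ltord p) (mx u - 1).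
Proof. by rewrite U_patset inE. Qed.

Lemma mkGL_U A : supp (@ltord p) A ->
  mkGL (1 + A) \in U /\ mx (mkGL (1 + A)) = 1 + A.
Proof.
by move=> sA; rewrite U_patset mkGL_patset // (@mkGL_upper _ _ (@ltord p)).
Qed.

Lemma cC_sub g : g \in cC -> [/\ supp (@ltord p) (mx g - 1), e * (mx g - 1) = (mx g - 1) * e,
   (mx g - 1) * B = B * (mx g - 1) & (mx g - 1) * f = f * (mx g - 1)].
Proof.
move=> Cg; have /cCP[Ug eg gB] := Cg; have gf := cC_f Cg.
rewrite !mulrBr !mulrBl !mulr1 !mul1r eg gB gf; split=> //; exact: supp_U.
Qed.

Lemma c_fB : f * B = 0.
Proof. by rewrite -c_eb mulrA c_fe mul0r. Qed.
Lemma c_Bf : B * f = 0.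
Proof. by rewrite -c_bt -mulrA c_tf mulr0. Qed.

Lemma cK_sub_C : cK \subset cC.
Proof.
apply/subsetP=> g; rewrite cK_set => Kg; have /princP[Ug _ _] := Kg.
have [h [Dg eh he hB Bh]] : exists h : Mn, [/\ mx g = 1 + h, e * h = 0, h * e = 0,
    h * B = 0 & B * h = 0].
  exists (f * (mx g - 1) * f); split; first by rewrite (princ_supp c_ff Kg) addrC subrK.
  - by rewrite !mulrA c_ef !mul0r.
  - by rewrite -mulrA c_fe mulr0.
  - by rewrite -mulrA c_fB mulr0.
  - by rewrite !mulrA c_Bf !mul0r.
by apply/cCP; rewrite Ug Dg !mulrDr !mulrDl !mulr1 !mul1r eh he hB Bh.
Qed.

Lemma cS_sub_C : cS \subset cC.
Proof. by apply/subsetP=> g /cSP[]. Qed.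

(** With A = g - 1, the part f A acts on the middle coordinates and the rest on the
    others; both commute with e and B, because B kills the middle coordinates on
    both sides. *)
Lemma cC_split g : g \in cC -> exists2 x, x \in cS & exists2 y, y \in cK & g = (x * y)%g.
Proof.
move=> Cg; have Dg : mx g = 1 + (mx g - 1) by rewrite addrC subrK.
move: (cC_sub Cg) Dg; move: (mx g - 1) => A [sh eh hB hf] Dg.
have [Ux Dx] : mkGL (1 + (A - f * A)) \in U /\ mx (mkGL (1 + (A - f * A))) = 1 + (A - f * A).
  by apply: mkGL_U; rewrite suppB // supp_DM.
have [Uy Dy] : mkGL (1 + f * A) \in U /\ mx (mkGL (1 + f * A)) = 1 + f * A.
  by apply: mkGL_U; rewrite supp_DM.
have e1 : e * (f * A) = 0 by rewrite mulrA c_ef mul0r.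
have e2 : f * A * e = 0 by rewrite -mulrA -eh mulrA c_fe mul0r.
have e3 : f * A * B = 0 by rewrite -mulrA hB mulrA c_fB mul0r.
have e4 : B * (f * A) = 0 by rewrite mulrA c_Bf mul0r.
have e5 : f * (f * A) = f * A by rewrite mulrA c_ff.
exists (mkGL (1 + (A - f * A))).
  apply/cSP; split; last by rewrite Dx mulrDr mulr1 mulrBr e5 subrr addr0.
  apply/cCP; split=> //; rewrite Dx mulrDr mulrDl mulr1 mul1r; congr (_ + _).
    by rewrite mulrBr mulrBl e1 e2 eh.
  by rewrite mulrBr mulrBl e3 e4 hB.
exists (mkGL (1 + f * A)).
  rewrite cK_set; apply/princP; split=> //; rewrite Dy.
    by rewrite mulrDl mul1r mulrBr mulr1 -(mulrA f) hf e5 subrr addr0.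
  by rewrite mulrDr mulr1 mulrBl mul1r e5 subrr addr0.
apply: mx_inj; rewrite mxM Dx Dy Dg.
have fAA : f * A * (f * A) = A * (f * A) by rewrite (mulrA A f) hf -!mulrA (mulrA A f) hf !mulrA c_ff.
rewrite mulrDr mulr1 (mulrDl _ _ (f * A)) mul1r mulrBl fAA subrr addr0.
by rewrite -addrA subrK.
Qed.

Lemma cS_K_dprod : cS \x cK = cC.
Proof.
have fS x : x \in cS -> f * (mx x - 1) = 0 /\ (mx x - 1) * f = 0.
  case/cSP=> Cx fx; have [_ _ _ ->] := cC_sub Cx.
  by rewrite mulrBr fx mulr1 subrr.
have TI : cS :&: cK = 1%g.
  apply/trivgP/subsetP=> g /setIP[/fS[g1 _]]; rewrite cK_set => /(princ_supp c_ff).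
  rewrite g1 mul0r => /esym/eqP; rewrite subr_eq0 => /eqP g0.
  by apply/set1P/mx_inj; rewrite mx1.
rewrite dprodE //.
  apply/eqP; rewrite eqEsubset mul_subG ?cS_sub_C ?cK_sub_C //=.
  by apply/subsetP=> g /cC_split[x Sx [y Ky ->]]; apply: mem_mulg.
apply/centsP=> y; rewrite cK_set => Ky x /fS[x1 x2]; apply: mx_inj.
have Dy := princ_supp c_ff Ky.
apply: (addIr (-1)); rewrite !mxM !mul_sub1; first by rewrite addrC.
  by rewrite -Dy !mulrA x2 !mul0r.
by rewrite -Dy -(mulrA _ f (mx x - 1)) x1 mulr0.
Qed.

Local Notation Y := (Yblock F p s).
Local Notation T := (@stabT F p s B).

Lemma one_sub_e : 1 - e = D (fun i => i < s)%N.
Proof.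
rewrite E_D; apply/matrixP=> i j; rewrite mxsubE !mxE.
by case: eqP => _; case: ltnP; rewrite ?subr0 ?subrr.
Qed.

Lemma cC_sub_T : cC \subset T.
Proof.
apply/subsetP=> g /cCP[Ug eg gB]; apply/(TP _ c_low); split=> //.
rewrite -gB mulrBr mulr1 -(mulrA (mx g)) c_be mulr0 subr0.
by rewrite eg -mulrA c_eb.
Qed.

(** The block diagonal part of a stabiliser is again a stabiliser, and the
    quotient is in Y. *)
Lemma cT_split u : u \in T -> exists2 y, y \in Y & exists2 c, c \in cC & u = (y * c)%g.
Proof.
case/(TP _ c_low)=> Uu Bu; have Uu' : u^-1%g \in U by rewrite groupV.
have su := supp_U Uu; pose h := e * (mx u - 1) + (mx u - 1) * (1 - e).
have [Uc Dc] : mkGL (1 + h) \in U /\ mx (mkGL (1 + h)) = 1 + h.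
  by apply: mkGL_U; rewrite /h one_sub_e E_D suppD ?supp_DM ?supp_MD.
set c := mkGL (1 + h) in Uc Dc.
have {}Dc : mx c = e * mx u + mx u * (1 - e).
  by rewrite Dc /h; apply: ring_diag.
have eue := U_Eproj s Uu.
exists (u * c^-1)%g; last first.
  exists c; last by rewrite mulgKV.
  apply/cCP; split=> //; rewrite Dc.
    exact: (ring_diag_e c_ee eue).
  exact: (ring_diag_b c_eb c_be Bu).
have Dc' : mx u * mx c^-1%g = mx (u * c^-1)%g by [].
have [y1 y2] := ring_diag_y c_ee eue (esym Dc) (mxKV c) (mxVK c).
by apply/YP; rewrite mxM.
Qed.

Lemma cT_sdprod : Y ><| cC = T.
Proof.
have sCU : cC \subset U by apply/subsetP=> g /cCP[].
have nYC : cC \subset 'N(Y) := subset_trans sCU (normal_norm (YnormU F p s)).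
rewrite sdprodE //.
  apply/eqP; rewrite eqEsubset mul_subG ?YsubT ?cC_sub_T //=.
  by apply/subsetP=> u /cT_split[y Yy [c Cc ->]]; apply: mem_mulg.
apply/trivgP/subsetP=> g /setIP[Yg /cCP[_ eg _]].
apply/set1P/mx_inj; rewrite mx1; apply/eqP; rewrite -subr_eq0 -(Ysub1e Yg).
have [g0 g1] := Ysub1 Yg.
have ge : (mx g - 1) * e = 0 by rewrite mulrBl mul1r -eg -{2}(mulr1 e) -mulrBr.
by rewrite -mulrA ge mulr0.
Qed.

End Corner.

(** * Characters lying over a monomial corner *)

Section CornerChar.

Variables (F : finFieldType) (p : nat) (d : corner_datum F p).
Local Notation n := p.+1.
Local Notation GL := (GLt F p).
Local Notation U := (unitri F n : {group GL}).
Local Notation k := (csize d).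
Local Notation s := (cstart d).
Local Notation e := (tail_proj F p s).
Local Notation B := (cB d).
Local Notation Y := (Yblock F p s).
Local Notation T := (@stabT F p s B).
Local Notation a := (k.+1).
Local Notation z := (n - k - 1)%N.
Local Notation R := (Rsub F n a z : {group GL}).
Implicit Types (g h u : GL).

(** The root elements that generate g (in_Xgen) are at positions outside the middle
    block, so they belong to the generators of R. *)
Lemma in_Rsub g : g \in U ->
  (forall i j : 'I_n, (i < j)%N -> mx g i j != 0 -> ~~ ((k <= i) && (j < s))%N) ->
  g \in R.
Proof.
move=> Ug Pg.
have : (g : {'GL_n[F]}) \in Xgen F n (fun i j => ~~ ((a <= i) && (j <= z)))%N.
  apply: in_Xgen => // i j lt_ij nz; have := Pg i j lt_ij nz; rewrite /cstart.
  by have := csize_small d; have := ltn_ord j; lia.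
move: (g : {'GL_n[F]}); apply/subsetP; apply: Xgen_sub => i j ij jn nP.
apply: subset_trans (subset_gen _); apply: subset_trans (sub_class_support _ _).
have lt_in : (i < n)%N by case/andP: ij => _; lia.
apply: (bigcup_max (Ordinal lt_in)) => //=.
apply: (bigcup_max (Ordinal jn)) => //=; rewrite ij /=.
apply: contra nP => sXU.
have lt_i1 : (i.-1 < n)%N by lia.
pose i1 := Ordinal lt_i1; pose j1 := Ordinal jn.
have lt_ij : (i1 < j1)%N by rewrite /=; lia.
have Xx : elt (1 : F) i1 j1 \in Usub F n a z.
  apply: (subsetP sXU); have := elt_Xroot (1 : F) lt_ij.
  by rewrite /= (ltn_predK (proj1 (andP ij))).
have := Xx; rewrite Usub_princ // princD_entries; last first.
  by apply: subsetP Xx; apply: Xgen_sub_unitri.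
move/forallP/(_ i1)/forallP/(_ j1)/implyP; rewrite mx_elt // !mxE !eqxx mulr1.
case: (boolP (_ && _)) => [P1 _|_ /(_ isT)]; first by move: P1; rewrite /=; lia.
by rewrite -val_eqE ltn_eqF // add0r oner_eq0.
Qed.

Lemma Y_sub_R : Y \subset R.
Proof.
apply/subsetP=> g Yg; apply: in_Rsub => [|i j lt_ij]; first exact: (subsetP (YsubU F p s)).
move: Yg; rewrite Y_patset => /patsetP H; apply: contra => kj.
by rewrite H ?/blockpos; [rewrite -val_eqE ltn_eqF | lia].
Qed.

Lemma cS_sub_R : cS d \subset R.
Proof.
apply/subsetP=> g /cSP[Cg fg]; have /cCP[Ug _ _] := Cg.
apply: in_Rsub => // i j lt_ij; apply: contra => kj.
have /matrixP/(_ i j) := fg; rewrite mulDl [RHS]mxE.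
have -> : ((k <= i) && (i < s))%N by lia.
by rewrite mul1r => ->; rewrite -val_eqE ltn_eqF.
Qed.

(** Definitional restatement with the element type fixed above. *)
Definition defU : R ><| cK d = U := Rsub_sdprod F n a z.

Lemma inflateE (beta : 'CF(cK d)) : (inflate beta : 'CF(U)) = cfSdprod defU beta.
Proof. by []. Qed.

Lemma inflate_mul (beta : 'CF(cK d)) r w : r \in R -> w \in cK d ->
  (inflate beta : 'CF(U)) (r * w)%g = beta w.
Proof. by move=> Rr Kw; rewrite inflateE cfSdprodE. Qed.

(** T = Y (S x K) with Y and S in the kernel of the inflation, so that on T the
    inflation from K along U and the one along T agree. *)
Lemma Res_inflate (beta : 'CF(cK d)) :
  'Res[T] (inflate beta : 'CF(U)) = cfSdprod (cT_sdprod d) (cfDprodr (cS_K_dprod d) beta).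
Proof.
apply/cfun_inP=> u Tu; rewrite cfResE ?TsubU //.
have [y Yy [c Cc Du]] := cT_split Tu; have [x Sx [w Kw Dc]] := cC_split Cc.
have Ryx : (y * x)%g \in R by apply: groupM; [apply: (subsetP Y_sub_R) | apply: (subsetP cS_sub_R)].
rewrite Du [RHS]cfSdprodE // Dc [RHS]cfDprodEr // mulgA.
exact: inflate_mul.
Qed.

(** An element of T with trivial upper left corner has trivial lower right corner
    as well: B intertwines the two. *)
Lemma T_top u : u \in T -> ctop d * mx u * ctop d = ctop d -> e * mx u = e.
Proof.
case/(TP _ (c_low d))=> Uu Bu tut; have eue := U_Eproj s Uu.
have fe1 : (1 - e) * cmid d = cmid d by rewrite mulrBl mul1r c_ef subr0.
have te1 : (1 - e) * ctop d = ctop d by rewrite mulrBl mul1r c_et subr0.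
have Buf : B * mx u * cmid d = 0.
  by rewrite -fe1 mulrA Bu -mulrA c_Bf mulr0.
have But : B * mx u * ctop d = B.
  by rewrite -{1}(c_bt d) -!mulrA (mulrA (ctop d)) tut c_bt.
have euB : e * mx u * B = B.
  have D1 : 1 - e = ctop d + cmid d by rewrite -(c_tfe d) addrK.
  by rewrite -Bu D1 mulrDr But Buf addr0.
by rewrite -eue -mulrA -{2}(c_bb' d) !mulrA euB c_bb'.
Qed.

(** Such elements satisfy e u = e, so that the twist by u^-1 disappears. *)
Lemma extfun_top u : u \in T -> ctop d * mx u * ctop d = ctop d ->
  extfun s B u = \tr (B * mx u).
Proof.
move=> Tu tut; have eu := T_top Tu tut.
have eu' : e * mx u^-1%g = e by rewrite -{1}eu -mulrA mxKV mulr1.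
by rewrite /extfun -mulrA eu' trC !mulrA c_eb.
Qed.

Lemma cS_top x : x \in cS d -> e * mx x = e -> x = 1%g.
Proof.
case/cSP=> Cx fx ex; have [_ eh hB hf] := cC_sub Cx.
have eh0 : e * (mx x - 1) = 0 by rewrite mulrBr ex mulr1 subrr.
have fh : cmid d * (mx x - 1) = 0 by rewrite mulrBr fx mulr1 subrr.
have th : ctop d * (mx x - 1) = 0.
  by rewrite -c_b'b -mulrA -hB -(c_eb d) (mulrA (mx x - 1)) -eh eh0 mul0r mulr0.
apply: mx_inj; rewrite mx1; apply/eqP; rewrite -subr_eq0; apply/eqP.
have : (ctop d + cmid d + e) * (mx x - 1) = 0 by rewrite !(mulrDl _ _ (_ - _)) th fh eh0 !addr0.
by rewrite c_tfe mul1r.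
Qed.

(** Clifford theory for the functional B. Its inertia group T = Y (S x K) carries a
    linear extension f of lam B, so the irreducible characters over lam B are
    the Ind_T (f sigma beta), for sigma in Irr S and beta in Irr K; since beta is the
    restriction to T of a character inflated from U, it factors out of the
    induction. The last clause keeps track of Ind_T (f sigma) on the elements
    where sigma contributes only its degree, which is what a comparison with
    elementary characters requires. *)
Theorem corner_param : exists Theta : Iirr (cS d) * Iirr (cK d) -> Iirr U,
 [/\ injective Theta,
     forall i, (i \in codom Theta) = lies_over s i B,
     forall x, 'chi_(Theta x) 1%g = #|U : T|%:R * ('chi_x.1 1%g * 'chi_x.2 1%g),
     forall x, 'chi_(Theta x) = 'chi_(Theta (x.1, 0)) * inflate 'chi_x.2
   & forall c, exists psi_ : 'CF(T), [/\ psi_ \is a character, 'chi_(Theta (c, 0)) = 'Ind[U] psi_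
       & forall u, u \in T -> ctop d * mx u * ctop d = ctop d ->
           psi_ u = 'chi_c 1%g * psi (extfun s B u)]].
Proof.
have [f [Lf Df Rf]] := ext_exists (c_low d) (YsubT s B) (subxx T).
have nYU := YnormU F p s; have Tt : T :=: 'I_U['chi_(lam s B)] by [].
pose Cl := Cliff U f (cT_sdprod d).
exists (fun x => Cl (dprod_Iirr (cS_K_dprod d) x)); split.
- by move=> x y /(Cliff_inj nYU Tt Lf Rf)/dprod_Iirr_inj.
- move=> i; rewrite /lies_over -(Cliff_codom nYU Tt (cT_sdprod d) Lf Rf).
  apply/codomP/codomP => [[x ->] | [c ->]]; first by exists (dprod_Iirr (cS_K_dprod d) x).
  by exists (inv_dprod_Iirr (cS_K_dprod d) c); rewrite inv_dprod_IirrK.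
- case=> x y; rewrite (Cliff1 nYU Tt _ Lf Rf) dprod_IirrE /cfDprod cfunE.
  by rewrite cfDprodl1 cfDprodr1.
- case=> x y; rewrite !(CliffE nYU Tt _ Lf Rf) /= -cfIndM ?TsubU // Res_inflate.
  congr ('Ind[U] _); rewrite -mulrA -rmorphM /= dprod_IirrEl dprod_IirrE //.
move=> c; exists (f * cfSdprod (cT_sdprod d) (cfDprodl (cS_K_dprod d) 'chi_c)); split.
- by apply: rpredM; [apply: lin_charW | by rewrite cfSdprod_char cfDprodl_char irr_char].
- by rewrite (CliffE nYU Tt _ Lf Rf) dprod_IirrEl.
move=> u Tu tut; rewrite cfunE Df // mulrC; congr (_ * _).
have eu := T_top Tu tut.
have [y Yy [g Cg Du]] := cT_split Tu; have [x Sx [w Kw Dg]] := cC_split Cg.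
rewrite Du cfSdprodE // Dg cfDprodEl //.
suff -> : x = 1%g by [].
apply: cS_top => //; have /cSP[/cCP[_ ex _] _] := Sx.
have ew : e * mx w = e.
  apply/eqP; rewrite -subr_eq0 -{2}[e]mulr1 -mulrBr; rewrite cK_set in Kw.
  by rewrite -(princ_supp (c_ff d) Kw) !mulrA c_ef !mul0r.
have /YP[ey _] := Yy; move: eu; rewrite Du Dg !mxM !mulrA ey ex.
by rewrite -mulrA ew.
Qed.

End CornerChar.

(** * The two factors of the inertia group *)

Section Embedding.

Variables (F : finFieldType) (m p : nat).
Local Notation n := p.+1.
Local Notation GL := (GLt F p).
Local Notation Um := (unitri F m.+1 : {group GLt F m}).
Variable J : 'M[F]_m.+1 -> 'M[F]_n.
Hypotheses (JD : forall a b, J (a + b) = J a + J b) (JM : forall a b, J (a * b) = J a * J b).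
Hypothesis Jinj : injective J.

Lemma J0 : J 0 = 0.
Proof. by apply: (addIr (J 0)); rewrite -JD !add0r. Qed.

Lemma J_mul (x y : GLt F m) :
  (1 + J (mx x - 1)) * (1 + J (mx y - 1)) = 1 + J (mx (x * y)%g - 1).
Proof.
have -> : mx (x * y)%g - 1 = (mx x - 1) * (mx y - 1) + (mx x - 1) + (mx y - 1).
  rewrite mxM; move: (mx x) (mx y) => a b.
  rewrite mulrBr mulr1 subrK mulrBl mul1r addrA subrK //.
move: (mx x - 1) (mx y - 1) => a b; rewrite !JD JM.
move: (J a) (J b) => {}a {}b; rewrite mulrDl mul1r mulrDr mulr1 -addrA.
by congr (1 + _); rewrite addrC; congr (_ + _); rewrite addrC.
Qed.

Definition Jmap (x : GLt F m) : GL := mkGL (1 + J (mx x - 1)).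

Lemma mx_Jmap x : mx (Jmap x) = 1 + J (mx x - 1).
Proof.
apply: (@mkGL_inv _ _ _ (1 + J (mx x^-1%g - 1))).
by rewrite J_mul mulgV mx1 subrr J0 addr0.
Qed.

Lemma JmapM : {in Um &, {morph Jmap : x y / (x * y)%g}}.
Proof. by move=> x y _ _; apply: mx_inj; rewrite mxM !mx_Jmap J_mul. Qed.
Canonical Jmorph := Morphism JmapM.

(** A ring embedding J without unit gives the group embedding x -> 1 + J (x - 1). *)
Lemma isog_J (H : {group GL}) :
  (forall x, x \in Um -> Jmap x \in H) ->
  (forall h, h \in H -> exists2 x, x \in Um & mx h = 1 + J (mx x - 1)) ->
  Um \isog H.
Proof.
move=> sub sup; apply/isogP; exists Jmorph.
  apply/injmP=> x y _ _ /(congr1 mx); rewrite /= !mx_Jmap => /addrI/Jinj/addIr.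
  exact: mx_inj.
apply/setP=> h; apply/morphimP/idP => [[x _ /sub Hx -> //]| /sup[x Ux Dh]].
by exists x => //; apply: mx_inj; rewrite /= mx_Jmap.
Qed.

End Embedding.

Section Shift.
Variables (F : finFieldType) (m p c : nat).
Local Notation n := p.+1.
Hypothesis cmn : (c + m.+1 <= n)%N.

Definition shiftM : 'M[F]_(m.+1, n) := \matrix_(i, j) ((c + i)%N == j)%:R.

Lemma shiftM_tr : shiftM *m shiftM^T = 1%:M.
Proof.
apply/matrixP=> i j; rewrite mxE.
have lt_ci : (c + i < n)%N by have := ltn_ord i; lia.
rewrite (bigD1 (Ordinal lt_ci)) //= big1 ?addr0 => [|l nl].
  by rewrite !mxE /= eqxx mul1r eqn_add2l eq_sym.
rewrite !mxE; case: eqP => [E|]; last by rewrite mul0r.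
by case/eqP: nl; apply: val_inj.
Qed.

Lemma tr_shiftM : shiftM^T *m shiftM = diag_proj F p (fun i => c <= i < c + m.+1)%N.
Proof.
apply/matrixP=> i j; rewrite !mxE.
case: (boolP (c <= i < c + m.+1)%N) => ci; last first.
  rewrite andbF big1 // => l _; rewrite !mxE; case: eqP => [E|]; last by rewrite mul0r.
  by move: ci; rewrite -E; have := ltn_ord l; lia.
have lt_i : (i - c < m.+1)%N by lia.
rewrite (bigD1 (Ordinal lt_i)) //= big1 ?addr0 => [|l nl].
  rewrite !mxE /= andbT. have -> : (c + (i - c) = i)%N by lia.
  by rewrite eqxx mul1r val_eqE.
rewrite !mxE; case: eqP => [E|]; last by rewrite mul0r.
by case/eqP: nl; apply: val_inj => /=; lia.
Qed.

Lemma supp_embed (A : 'M[F]_m.+1) :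
  supp (@ltord m) A -> supp (@ltord p) (shiftM^T *m A *m shiftM).
Proof.
move=> /suppP sA; apply/suppP=> i j nij; rewrite mxE big1 // => l _; rewrite mxE.
rewrite [(shiftM) l j]mxE; case: eqP => [El|]; last by rewrite mulr0.
rewrite mulr1 big1 // => l' _; rewrite !mxE; case: eqP => [El'|]; last by rewrite mul0r.
by rewrite sA ?mulr0 //; apply: contra nij; rewrite /ltord -El -El' ltn_add2l.
Qed.

Lemma supp_extract (A : 'M[F]_n) :
  supp (@ltord p) A -> supp (@ltord m) (shiftM *m A *m shiftM^T).
Proof.
move=> /suppP sA; apply/suppP=> i j nij; rewrite mxE big1 // => l _; rewrite mxE.
rewrite [(shiftM)^T l j]mxE [shiftM j l]mxE; case: eqP => [El|]; last by rewrite mulr0.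
rewrite mulr1 big1 // => l' _; rewrite !mxE; case: eqP => [El'|]; last by rewrite mul0r.
by rewrite sA ?mulr0 //; apply: contra nij; rewrite /ltord -El -El' ltn_add2l.
Qed.

(** The m.+1 by m.+1 matrices as a diagonal block starting at position c. *)
Definition embed (A : 'M[F]_m.+1) : 'M[F]_n := shiftM^T *m A *m shiftM.

Lemma embedD a b : embed (a + b) = embed a + embed b.
Proof. by rewrite /embed mulmxDr mulmxDl. Qed.

Lemma embedM a b : embed (a * b) = embed a * embed b.
Proof.
by rewrite /embed -!mulmxE !mulmxA -(mulmxA (shiftM^T *m a) shiftM shiftM^T) shiftM_tr mulmx1.
Qed.

Lemma embedK A : shiftM *m embed A *m shiftM^T = A.
Proof.
by rewrite /embed !mulmxA shiftM_tr mul1mx -mulmxA shiftM_tr mulmx1.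
Qed.

Lemma embed_inj : injective embed.
Proof. exact: (can_inj (g := fun M => shiftM *m M *m shiftM^T) embedK). Qed.

Local Notation fshift := (diag_proj F p (fun i => c <= i < c + m.+1)%N).

Lemma embed_extract (A : 'M[F]_n) : embed (shiftM *m A *m shiftM^T) = fshift * A * fshift.
Proof. by rewrite -tr_shiftM /embed -!mulmxE !mulmxA. Qed.

Lemma embed_fix A : fshift * embed A * fshift = embed A.
Proof.
rewrite -tr_shiftM /embed -!mulmxE !mulmxA -(mulmxA shiftM^T shiftM shiftM^T) shiftM_tr mulmx1.
by rewrite -(mulmxA _ shiftM shiftM^T) shiftM_tr mulmx1.
Qed.

End Shift.

Section CornerOrders.

Variables (F : finFieldType) (p : nat) (d : corner_datum F p).
Local Notation n := p.+1.
Local Notation Mn := 'M[F]_n.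
Local Notation GL := (GLt F p).
Local Notation U := (unitri F n : {group GL}).
Local Notation q := #|F|.
Local Notation k := (csize d).
Local Notation pi := (cperm d).
Local Notation s := (cstart d).
Local Notation e := (tail_proj F p s).
Local Notation t := (ctop d).
Local Notation f := (cmid d).
Local Notation B := (cB d).
Local Notation B' := (cBinv d).
Local Notation Y := (Yblock F p s).
Local Notation T := (@stabT F p s B).
Implicit Types (g h u : GL).

Lemma isog_K m : n = (k + k + m.+1)%N -> (unitri F m.+1 : {group GLt F m}) \isog cK d.
Proof.
move=> Dn; have cmn : (k + m.+1 <= n)%N by lia.
have Df : f = diag_proj F p (fun i => k <= i < k + m.+1)%N.
  by apply: eqD => i _; rewrite /cstart; lia.
apply: (isog_J (@embedD F m p k) (embedM cmn) (embed_inj cmn)) => [x Ux | h].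
  rewrite cK_set; have Dx := mx_Jmap (@embedD F m p k) (embedM cmn) x.
  have fJ := embed_fix cmn (mx x - 1); rewrite -Df in fJ.
  have ff := c_ff d.
  apply/princP; rewrite Dx -fJ; split.
  - rewrite U_patset inE Dx addrC addKr; apply: supp_embed; exact: supp_U.
  - by rewrite mulrDl mul1r mulrBr mulr1 -(mulrA _ f f) ff subrr addr0.
  - by rewrite mulrDr mulr1 mulrBl mul1r !mulrA ff subrr addr0.
rewrite cK_set => Kh; have fhf := princ_supp (c_ff d) Kh; have /princP[Uh _ _] := Kh.
pose A := shiftM F m p k *m (mx h - 1) *m (shiftM F m p k)^T.
have sA : supp (@ltord m) A by apply: supp_extract; apply: supp_U.
have [UA DA] := mkGL_U sA; exists (mkGL (1 + A)) => //.
by rewrite DA (addrC 1 A) addrK embed_extract // -Df fhf addrC subrK.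
Qed.

(** S is parametrised by the strictly upper triangular matrices of size k that
    remain upper triangular after the rows and columns are permuted by cperm. *)
Definition Sp : rel 'I_n := fun i j => [&& i < j, j < k & pi i < pi j]%N.

Lemma Sp_upper : upper Sp. Proof. by move=> i j /and3P[]. Qed.

Lemma Sp_top X : supp Sp X -> t * X * t = X.
Proof.
move=> /suppP sX; apply/matrixP=> i j; rewrite mulDr mulDl.
have [Sij|/sX->] := boolP (Sp i j); last by rewrite mulr0 mul0r.
have /and3P[lt_ij jk _] := Sij; rewrite jk (ltn_trans lt_ij jk) mulr1 mul1r //.
Qed.

(** X on the first coordinates together with its transport by B to the last ones. *)
Definition cdouble (X : Mn) : Mn := X + B * X * B'.

Lemma supp_cdouble X : supp Sp X -> supp (@ltord p) (cdouble X).
Proof.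
move=> /suppP sX; rewrite /cdouble suppD //.
  by apply/suppP=> i j nij; rewrite sX //; apply: contra nij => /Sp_upper.
apply/suppP=> i j nij; rewrite mulmxEij big1 // => l _; rewrite mulmxEij.
rewrite [B' l j]mxE; case: ifP => [/andP[lk /eqP Ej]|_]; last by rewrite mulr0.
rewrite big1 ?mul0r // => l' _; rewrite [B i l']mxE.
case: ifP => [/andP[lk' /eqP Ei]|_]; last by rewrite mul0r.
rewrite sX ?mulr0 //; apply: contra nij => /and3P[_ _].
by rewrite /ltord Ei Ej ltn_add2l.
Qed.

Local Ltac cring := solve [exact: c_tfe | exact: c_tt | exact: c_ff | exact: c_ee
  | exact: c_tf | exact: c_ft | exact: c_te | exact: c_et | exact: c_ef | exact: c_fe
  | exact: c_eb | exact: c_bt | exact: c_b'b | exact: c_bb' | exact: c_tb' | exact: c_b'e].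

Lemma cdouble_comm X : t * X * t = X ->
  [/\ e * cdouble X = cdouble X * e, cdouble X * B = B * cdouble X, f * cdouble X = 0 & t * cdouble X * t = X].
Proof. by move=> Xt; apply: (@ring_cdouble_comm _ t f e B B') => //; cring. Qed.

Lemma cdoubleM X X' : t * X * t = X -> t * X' * t = X' -> cdouble X * cdouble X' = cdouble (X * X').
Proof. by move=> Xt Xt'; apply: (@ring_cdoubleM _ t e B B') => //; cring. Qed.

Lemma cdouble_S X : supp Sp X -> mkGL (1 + cdouble X) \in cS d /\ mx (mkGL (1 + cdouble X)) = 1 + cdouble X.
Proof.
move=> sX; have [Ux Dx] := mkGL_U (supp_cdouble sX).
have [e1 e2 e3 _] := cdouble_comm (Sp_top sX).
split=> //; apply/cSP; split; last by rewrite Dx mulrDr e3 mulr1 addr0.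
by apply/cCP; split; rewrite // Dx mulrDr mulrDl mulr1 mul1r ?e1 ?e2.
Qed.

Lemma S_cdouble x : x \in cS d ->
  exists2 X, supp Sp X & mx x = 1 + cdouble X.
Proof.
case/cSP=> Cx fx; have [sh eh hB hf] := cC_sub Cx.
have fh : f * (mx x - 1) = 0 by rewrite mulrBr fx mulr1 subrr.
have hf0 : (mx x - 1) * f = 0 by rewrite hf.
have D1 : mx x - 1 = cdouble (t * (mx x - 1) * t).
  by apply: (@ring_cdouble _ t f e B B') => //; cring.
exists (t * (mx x - 1) * t); last by rewrite -D1 addrC subrK.
apply/suppP=> i j nS; rewrite mulDr mulDl.
case: (ltnP j k) => jk; last by rewrite mulr0.
case: (ltnP i k) => ik; last by rewrite mul0r mul0r.
rewrite mulr1 mul1r; move/suppP: sh => sh.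
case: (boolP (i < j)%N) => ij; last by rewrite sh.
have npi : ~~ (pi i < pi j)%N by apply: contra nS => ppi; rewrite /Sp ij jk.
have lt_c : (s + pi i < n)%N by have := s_k d; have := cperm_lt ik; lia.
have lt_c' : (s + pi j < n)%N by have := s_k d; have := cperm_lt jk; lia.
have /matrixP/(_ (Ordinal lt_c) j) := hB.
rewrite !mulmxEij (bigD1 (Ordinal lt_c')) //= [X in _ + X]big1 => [|l nl]; last first.
  rewrite [B l j]mxE; case: ifP => [/andP[_ /eqP El]|_]; last by rewrite mulr0.
  by case/eqP: nl; apply: val_inj.
rewrite sh; last by rewrite /ltord /= ltn_add2l.
rewrite mul0r addr0 (bigD1 i) //= [X in _ + X]big1 => [|l nl]; last first.
  rewrite mxE /=; case: ifP => [/andP[lk /eqP El]|_]; last by rewrite mul0r.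
  case/eqP: nl; apply: val_inj => /=; apply: (cperm_inj lk ik); lia.
rewrite addr0 mxE ik eqxx /= => /esym/eqP; rewrite mulf_eq0 (negbTE (cscal_nz ik)) /=.
by move/eqP.
Qed.

Lemma card_S : #|cS d| = (q ^ #|[pred ij | Sp ij.1 ij.2]|)%N.
Proof.
rewrite -card_supp -[RHS](@card_in_imset _ _ (fun X => mkGL (1 + cdouble X))).
  apply: eq_card => x; apply/idP/imsetP => [/S_cdouble[X sX Dx] | [X]].
    exists X; first by rewrite inE.
    by apply: mx_inj; rewrite Dx; case: (cdouble_S sX).
  by rewrite inE => sX ->; case: (cdouble_S sX).
move=> X X'; rewrite !inE => sX sX' /(congr1 mx).
have [_ ->] := cdouble_S sX; have [_ ->] := cdouble_S sX'; move/addrI => E.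
have [_ _ _ <-] := cdouble_comm (Sp_top sX); have [_ _ _ <-] := cdouble_comm (Sp_top sX').
by rewrite E.
Qed.

(** The entries of a product X X' at (i, l) run over chains i, j, l in Sp, so all
    these products vanish. *)
Lemma S_abelian : (forall i j l : 'I_n, Sp i j -> Sp j l -> False) -> abelian (cS d).
Proof.
move=> nochain; apply/centsP=> x /S_cdouble[X sX Dx] y /S_cdouble[X' sX' Dy].
have XX (Z Z' : Mn) : supp Sp Z -> supp Sp Z' -> Z * Z' = 0.
  move=> /suppP sZ /suppP sZ'; apply/matrixP=> i l; rewrite mulmxEij mxE big1 // => j _.
  case: (boolP (Sp i j)) => [Sij|/sZ->]; last by rewrite mul0r.
  case: (boolP (Sp j l)) => [Sjl|/sZ'->]; last by rewrite mulr0.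
  by case: (nochain i j l).
have J0' : cdouble 0 = 0 by rewrite /cdouble mulr0 mul0r addr0.
apply: mx_inj; rewrite !mxM Dx Dy mulrDl mul1r mulrDr mulr1 cdoubleM ?Sp_top // XX // J0'.
rewrite mulrDl mul1r mulrDr mulr1 cdoubleM ?Sp_top // XX // J0' !addr0.
by rewrite addrAC.
Qed.

(** The order of T is the product of those of Y, S and K. *)
Lemma index_T m l x : n = (k + k + m.+1)%N -> #|cS d| = (q ^ l)%N ->
    'C(n, 2) = (s * (n - s) + (l + ('C(m.+1, 2) + x)))%N ->
  #|U : T| = (q ^ x)%N.
Proof.
move=> Dn cardS C2.
have cardK : #|cK d| = (q ^ 'C(m.+1, 2))%N by rewrite -(card_isog (isog_K Dn)) card_U.
have cardT : #|T| = (#|Y| * (#|cS d| * #|cK d|))%N.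
  by rewrite (dprod_card (cS_K_dprod d)) (sdprod_card (cT_sdprod d)).
apply/eqP; rewrite -(eqn_pmul2l (cardG_gt0 T)) Lagrange ?TsubU // card_U cardT.
rewrite card_Y ?leq_subr // cardS cardK -!expnD C2; apply/eqP; congr (_ ^ _)%N.
by lia.
Qed.

End CornerOrders.

(** * Corners that force a small degree *)

Section Bounds.

Variables (F : finFieldType) (p : nat).
Local Notation n := p.+1.
Local Notation Mn := 'M[F]_n.
Local Notation GL := (GLt F p).
Local Notation U := (unitri F n : {group GL}).
Local Notation q := #|F|.
Local Notation dl := (@delta_mx F n n).
Hypothesis n_ge7 : (7 <= n)%N.

Lemma mu_ge3 : (3 <= mu n)%N.
Proof. by rewrite /mu; have := odd_double_half n; case: (odd n) => /=; nia. Qed.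

Section FixB.

Variables (s : nat) (B : Mn).
Local Notation e := (tail_proj F p s).
Hypothesis lB : low s B.
Hypothesis sh : s = n./2 \/ s = uphalf n.

Let eB : e * B = B. Proof. by case/lowP: lB. Qed.
Let Be : B * e = 0. Proof. by case/lowP: lB. Qed.

Let B0 (i j : 'I_n) : ~~ (j < s <= i)%N -> B i j = 0.
Proof. by move/suppP: lB; apply. Qed.

Let s_le : (3 <= s)%N /\ (3 <= n - s)%N.
Proof. by case: sh => ->; lia. Qed.

(** The elements N for which 1 + x N is in U, is block diagonal and fixes B. *)
Definition stab_nil N := [/\ supp (@ltord p) N, e * N = N * e & N * B = B * N].

(** Three independent elements that fix B lower the bound q^mu(n) by q^3, which
    excludes the degree q^(mu(n)-2). *)
Lemma bound3 N0 N1 N2 (i : Iirr U) : stab_nil N0 -> stab_nil N1 -> stab_nil N2 ->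
    N0 * N0 = 0 -> N0 * N1 = 0 -> N0 * N2 = 0 ->
    N1 * N0 = 0 -> N1 * N1 = 0 -> N1 * N2 = 0 ->
    N2 * N0 = 0 -> N2 * N1 = 0 -> N2 * N2 = 0 ->
    (forall x y z, x *: N0 + y *: N1 + z *: N2 = 0 -> [/\ x = 0, y = 0 & z = 0]) ->
  lies_over s i B -> 'chi_i 1%g != (q ^ (mu n - 2))%:R.
Proof.
move=> [u0 e0 b0] [u1 e1 b1] [u2 e2 b2] z00 z01 z02 z10 z11 z12 z20 z21 z22 fr Oi.
pose N (k : 'I_3) := if k == 0 :> nat then N0 else if k == 1 :> nat then N1 else N2.
have := @family_bound F p s 3 B N lB _ _ _ _ _ i Oi.
have H1 k : supp (@ltord p) (N k) by rewrite /N; do 2?case: ifP.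
have H2 k : e * N k = N k * e by rewrite /N; do 2?case: ifP.
have H3 k : N k * B = B * N k by rewrite /N; do 2?case: ifP.
have H4 k l : N k * N l = 0 by rewrite /N; do 4?case: ifP.
move=> /(_ H1 H2 H3 H4) le; have {le} : 'chi_i 1%g * (q ^ 3)%:R <= (q ^ mu n)%:R.
  rewrite -(index_Y F sh); apply: le => v.
  rewrite !big_ord_recl big_ord0 addr0 addrA => /fr[/= v0 v1 v2].
  apply/rowP=> j; rewrite mxE; case: j => -[|[|[|j]]] lt_j //.
  - by rewrite -[RHS]v0; congr (v _ _); apply: val_inj.
  - by rewrite -[RHS]v1; congr (v _ _); apply: val_inj.
  - by rewrite -[RHS]v2; congr (v _ _); apply: val_inj.
apply: contraTneq => ->; rewrite -natrM -expnD ler_nat leq_exp2l ?card_F_gt1 //.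
by have := mu_ge3; lia.
Qed.

Lemma dlB_entry (i j a b : 'I_n) : (dl i j * B) a b = (a == i)%:R * B j b.
Proof.
rewrite mulmxEij (bigD1 j) //= big1 ?addr0 => [|m nm]; first by rewrite mxE eqxx andbT.
by rewrite mxE (negbTE nm) andbF mul0r.
Qed.

Lemma Bdl_entry (i j a b : 'I_n) : (B * dl i j) a b = B a i * (b == j)%:R.
Proof.
rewrite mulmxEij (bigD1 i) //= big1 ?addr0 => [|m nm]; first by rewrite mxE eqxx.
by rewrite mxE (negbTE nm) mulr0.
Qed.

Lemma dl_mul (i j k l : 'I_n) : dl i j * dl k l = (j == k)%:R *: dl i l.
Proof.
rewrite -mulmxE; have [->|ne] := eqVneq j k; first by rewrite mul_delta_mx scale1r.
by rewrite mul_delta_mx_0 ?scale0r.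
Qed.

Lemma dlBdl (i j k l : 'I_n) : dl i j * B * dl k l = B j k *: dl i l.
Proof.
apply/matrixP=> a b; rewrite mulmxEij (bigD1 k) //= big1 ?addr0 => [|m nm].
  by rewrite dlB_entry !mxE eqxx /= -mulnb natrM mulrA [_ * B j k]mulrC.
by rewrite [dl _ _ m b]mxE (negbTE nm) mulr0.
Qed.

Lemma e_dl (i j : 'I_n) : e * dl i j = (s <= i)%:R *: dl i j.
Proof.
apply/matrixP=> a b; rewrite mulEl !mxE; case: eqP => [->|_] //=.
by rewrite !mulr0.
Qed.

Lemma dl_e (i j : 'I_n) : dl i j * e = (s <= j)%:R *: dl i j.
Proof.
apply/matrixP=> a b; rewrite mulEr !mxE; case: (b =P j) => [->|_].
  by rewrite mulrC.
by rewrite andbF mul0r mulr0.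
Qed.

Lemma dl_suppl (i j : 'I_n) : (i < j)%N -> supp (@ltord p) (dl i j).
Proof.
move=> ij; apply/suppP=> a b; rewrite mxE; case: andP => // -[/eqP-> /eqP->].
by rewrite /ltord ij.
Qed.

(** B * B = 0 makes this sum commute with B. It is block diagonal, and it lies above
    the diagonal as soon as B vanishes in row j up to column i and in column i from
    row j on. *)
Definition Nmix (i j : 'I_n) : Mn := dl i j * B + B * dl i j.

Lemma B_sq0 : B * B = 0. Proof. by rewrite -{2}eB mulrA Be mul0r. Qed.

Lemma stab_Nmix (i j : 'I_n) : (i < s <= j)%N ->
    (forall b : 'I_n, (b <= i)%N -> B j b = 0) -> (forall a : 'I_n, (j <= a)%N -> B a i = 0) ->
  stab_nil (Nmix i j).
Proof.
move=> /andP[is_ sj] Hr Hc; split.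
- apply/suppP=> a b nab; rewrite mxaddE dlB_entry Bdl_entry.
  have -> : (a == i)%:R * B j b = 0.
    case: eqP => [Da|_]; last by rewrite mul0r.
    by rewrite Hr ?mulr0 // -Da leqNgt.
  case: (b =P j) => [Db|_]; last by rewrite mulr0 addr0.
  by rewrite Hc ?mul0r ?addr0 // -Db leqNgt.
- rewrite mulrDr mulrDl !mulrA e_dl leqNgt is_ scale0r mul0r add0r.
  by rewrite eB -(mulrA _ B e) Be mulr0 add0r -mulrA dl_e sj scale1r.
- by rewrite mulrDr mulrDl -(mulrA _ B B) B_sq0 mulr0 add0r !mulrA B_sq0 mul0r addr0.
Qed.

Lemma Nmix_mul (i j k l : 'I_n) : (i < s <= j)%N -> (k < s <= l)%N -> B j k = 0 ->
  Nmix i j * Nmix k l = 0.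
Proof.
move=> /andP[is_ sj] /andP[ks sl] Bjk; rewrite mulrDl !mulrDr !mulrA.
rewrite dlBdl Bjk scale0r mul0r add0r -(mulrA _ B B) B_sq0 mulr0 mul0r add0r.
rewrite -(mulrA B (dl i j)) dl_mul.
have /negbTE-> : j != k by apply: contraTneq sj => ->; rewrite -ltnNge.
rewrite scale0r mulr0 mul0r add0r -!mulrA (mulrA (dl i j)) dlBdl Bjk scale0r mulr0 //.
Qed.

(** A zero column i of B makes both products of B with dl i j vanish. *)
Lemma stab_top (i j : 'I_n) : (i < j < s)%N -> (forall a, B a i = 0) -> stab_nil (dl i j).
Proof.
move=> /andP[ij js] Hc; split; first exact: dl_suppl.
  by rewrite e_dl dl_e leqNgt (ltn_trans ij) // leqNgt js.
apply/matrixP=> a b; rewrite dlB_entry Bdl_entry Hc mul0r B0 ?mulr0 //.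
by rewrite negb_and -!ltnNge js orbT.
Qed.

(** The mirror image of stab_top, with a zero row of B. *)
Lemma stab_bot (i j : 'I_n) : (s <= i < j)%N -> (forall b, B j b = 0) -> stab_nil (dl i j).
Proof.
move=> /andP[si ij] Hr; split; first exact: dl_suppl.
  by rewrite e_dl dl_e si (leq_trans si) // ltnW.
apply/matrixP=> a b; rewrite dlB_entry Bdl_entry Hr mulr0 B0 ?mul0r //.
by rewrite negb_and -!leqNgt si.
Qed.

Lemma Nmix_top (i j k l : 'I_n) : (i < s <= j)%N -> (k < l < s)%N -> (forall a, B a k = 0) ->
  Nmix i j * dl k l = 0.
Proof.
move=> /andP[is_ sj] /andP[kl ls] Hc; rewrite mulrDl dlBdl Hc scale0r add0r.
rewrite -mulrA dl_mul; have /negbTE-> : j != k; last by rewrite scale0r mulr0.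
by apply: contraTneq sj => ->; rewrite -ltnNge (ltn_trans kl).
Qed.

Lemma top_Nmix (i j k l : 'I_n) : (k < l < s)%N -> l != i -> dl k l * Nmix i j = 0.
Proof.
move=> /andP[kl ls] li; rewrite mulrDr !mulrA dl_mul (negbTE li) scale0r mul0r add0r.
rewrite dlBdl B0 ?scale0r //.
by rewrite negb_and -!ltnNge ls orbT.
Qed.

Lemma Nmix_bot (i j k l : 'I_n) : (s <= k < l)%N -> j != k -> Nmix i j * dl k l = 0.
Proof.
move=> /andP[sk kl] jk; rewrite mulrDl -(mulrA B) dl_mul (negbTE jk) scale0r mulr0 addr0.
by rewrite dlBdl B0 ?scale0r // negb_and -!leqNgt sk.
Qed.

Lemma bot_Nmix (i j k l : 'I_n) : (i < s <= j)%N -> (s <= k < l)%N -> (forall b, B l b = 0) ->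
  dl k l * Nmix i j = 0.
Proof.
move=> /andP[is_ sj] /andP[sk kl] Hr; rewrite mulrDr !mulrA dl_mul dlBdl Hr scale0r addr0.
have /negbTE-> : l != i; last by rewrite scale0r mul0r.
by apply: contraTneq is_ => <-; rewrite -leqNgt (leq_trans sk) // ltnW.
Qed.

Lemma dl_mul0 (i j k l : 'I_n) : j != k -> dl i j * dl k l = 0.
Proof. by move=> jk; rewrite dl_mul (negbTE jk) scale0r. Qed.

Lemma Nmix_entry (i j a b : 'I_n) :
  Nmix i j a b = (a == i)%:R * B j b + B a i * (b == j)%:R.
Proof. by rewrite mxaddE dlB_entry Bdl_entry. Qed.

Lemma comb3_entry (N0 N1 N2 : Mn) x y z : x *: N0 + y *: N1 + z *: N2 = 0 ->
  forall a b, x * N0 a b + y * N1 a b + z * N2 a b = 0.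
Proof. by move=> H a b; move/matrixP/(_ a b): H; rewrite !mxE. Qed.

Lemma mul_eq0_l (x y : F) : y != 0 -> x * y = 0 -> x = 0.
Proof. by move=> nz /eqP; rewrite mulf_eq0 (negbTE nz) orbF => /eqP. Qed.

Variables (r0 r1 r2 r3 c0 c1 c2 c3 : 'I_n).
Hypotheses (Hr0 : r0 = 0%N :> nat) (Hr1 : r1 = 1%N :> nat) (Hr2 : r2 = 2%N :> nat)
  (Hr3 : r3 = 3%N :> nat).
Hypotheses (Hc0 : c0 = p :> nat) (Hc1 : c1 = (p - 1)%N :> nat) (Hc2 : c2 = (p - 2)%N :> nat)
  (Hc3 : c3 = (p - 3)%N :> nat).
Variable i : Iirr U.
Hypothesis Oi : lies_over s i B.

Local Ltac olia := rewrite ?Hr0 ?Hr1 ?Hr2 ?Hr3 ?Hc0 ?Hc1 ?Hc2 ?Hc3; have := s_le; lia.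
Local Ltac neq := by apply/negbTE; rewrite -val_eqE /=; olia.

Let le_r0 (b : 'I_n) : (b <= r0)%N -> b = r0.
Proof. by move=> h; apply: val_inj => /=; olia. Qed.
Let le_r1 (b : 'I_n) : (b <= r1)%N -> b = r0 \/ b = r1.
Proof.
rewrite Hr1 => h; case: (ltngtP b 1%N) h => // h _; [left | right]; apply: val_inj => /=; olia.
Qed.
Let le_r2 (b : 'I_n) : (b <= r2)%N -> [\/ b = r0, b = r1 | b = r2].
Proof.
move=> h; case: (ltngtP b 1%N) => hb; [apply: Or31 | apply: Or33 | apply: Or32];
  apply: val_inj => /=; olia.
Qed.
Let ge_c0 (a : 'I_n) : (c0 <= a)%N -> a = c0.
Proof. by move=> h; apply: val_inj => /=; have := ltn_ord a; olia. Qed.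
Let ge_c1 (a : 'I_n) : (c1 <= a)%N -> a = c0 \/ a = c1.
Proof.
move=> h; case: (ltnP (p - 1) a)%N => h'; [left | right]; apply: val_inj => /=;
  have := ltn_ord a; olia.
Qed.
Let ge_c2 (a : 'I_n) : (c2 <= a)%N -> [\/ a = c0, a = c1 | a = c2].
Proof.
move=> h; case: (ltngtP a (p - 1)%N) => h'; [apply: Or33 | apply: Or31 | apply: Or32];
  apply: val_inj => /=; have := ltn_ord a; olia.
Qed.

Let pp : ((r0 < s)%N = true) * ((r1 < s)%N = true) * ((r2 < s)%N = true)
  * ((s <= c0)%N = true) * ((s <= c1)%N = true) * ((s <= c2)%N = true).
Proof. by do !split; olia. Qed.

Let r_ne_c : ((r0 == c0) = false) * ((r0 == c1) = false) * ((r0 == c2) = false)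
  * ((r1 == c0) = false) * ((r1 == c1) = false) * ((r1 == c2) = false)
  * ((r2 == c0) = false) * ((r2 == c1) = false) * ((r2 == c2) = false)
  * ((r3 == c0) = false) * ((c3 == r0) = false).
Proof. by do !split; neq. Qed.
Let c_ne_r : ((c0 == r0) = false) * ((c1 == r0) = false) * ((c2 == r0) = false)
  * ((c0 == r1) = false) * ((c1 == r1) = false) * ((c2 == r1) = false)
  * ((c0 == r2) = false) * ((c1 == r2) = false) * ((c2 == r2) = false).
Proof. by do !split; neq. Qed.
Let r_ne_r : ((r0 == r1) = false) * ((r1 == r0) = false) * ((r0 == r2) = false)
  * ((r2 == r0) = false) * ((r1 == r2) = false) * ((r2 == r1) = false)
  * ((r3 == r2) = false) * ((r2 == r3) = false) * ((r1 == r3) = false) * ((r3 == r1) = false)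
  * ((r3 == r0) = false) * ((r0 == r3) = false).
Proof. by do !split; neq. Qed.
Let c_ne_c : ((c0 == c1) = false) * ((c1 == c0) = false) * ((c0 == c2) = false)
  * ((c2 == c0) = false) * ((c1 == c2) = false) * ((c2 == c1) = false)
  * ((c3 == c2) = false) * ((c2 == c3) = false) * ((c1 == c3) = false) * ((c3 == c1) = false)
  * ((c3 == c0) = false) * ((c0 == c3) = false).
Proof. by do !split; neq. Qed.

Let ne := (r_ne_c, c_ne_r, r_ne_r, c_ne_c).

Let col_row (a j : 'I_n) : B a j != 0 -> forall k : 'I_n, (k < 3)%N -> (a == k) = false.
Proof.
move=> nz k k3; apply: contraNF nz => /eqP ->; rewrite B0 //.
by rewrite negb_and -!ltnNge; have := s_le; lia.
Qed.
Let row_col (j b : 'I_n) : B j b != 0 -> forall k : 'I_n, (p - 3 < k)%N -> (b == k) = false.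
Proof.
move=> nz k k3; apply: contraNF nz => /eqP ->; rewrite B0 //.
by rewrite negb_and -!leqNgt; have := s_le; lia.
Qed.

Local Ltac simp := rewrite ?Nmix_entry ?mxE ?ne ?eqxx ?andbF ?andbT /=;
  do 3 rewrite ?mul0r ?mulr0 ?mul1r ?mulr1 ?add0r ?addr0.

(** A nonzero entry of the last row c0 of B appears in Nmix r0 c0, Nmix r1 c0 and
    Nmix r2 c0 in three different rows, which makes them independent. If the row is
    zero, B is fixed by the elementary matrices with column c0 in the lower right
    block. *)
Lemma deg_neq_bottom_row : (4 <= n - s)%N -> B c0 r0 = 0 -> B c0 r1 = 0 -> B c0 r2 = 0 ->
  'chi_i 1%g != (q ^ (mu n - 2))%:R.
Proof.
move=> s4 b0 b1 b2; case: (pickP (fun b => B c0 b != 0)) => [b nz | row0].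
  have nb := row_col nz.
  apply: (@bound3 (Nmix r0 c0) (Nmix r1 c0) (Nmix r2 c0)); try by [].
  1-3: apply: stab_Nmix; [by rewrite !pp | | by move=> a /ge_c0->].
  - by move=> a /le_r0->.
  - by move=> a /le_r1[]->.
  - by move=> a /le_r2[]->.
  1-9: by apply: Nmix_mul; first [by rewrite !pp | done].
  move=> x y z /comb3_entry H.
  have nbc : (b == c0) = false by apply: nb; olia.
  by split; apply: (mul_eq0_l nz); [move: (H r0 b) | move: (H r1 b) | move: (H r2 b)];
    simp; rewrite nbc; simp.
have {}row0 b : B c0 b = 0 by apply/eqP; have := row0 b; case: eqP.
apply: (@bound3 (dl c1 c0) (dl c2 c0) (dl c3 c0)); try by [].
1-3: by apply: stab_bot => //; olia.
1-9: by apply: dl_mul0; rewrite ne.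
move=> x y z /comb3_entry H.
by split; [move: (H c1 c0) | move: (H c2 c0) | move: (H c3 c0)]; simp.
Qed.

(** The mirror image, under transposition along the antidiagonal, of
    deg_neq_bottom_row. *)
Lemma deg_neq_left_col : (4 <= s)%N -> B c0 r0 = 0 -> B c1 r0 = 0 -> B c2 r0 = 0 ->
  'chi_i 1%g != (q ^ (mu n - 2))%:R.
Proof.
move=> s4 b0 b1 b2; case: (pickP (fun a => B a r0 != 0)) => [a nz | col0].
  have na := col_row nz.
  apply: (@bound3 (Nmix r0 c0) (Nmix r0 c1) (Nmix r0 c2)); try by [].
  1-3: apply: stab_Nmix; [by rewrite !pp | by move=> b /le_r0-> | ].
  - by move=> b /ge_c0->.
  - by move=> b /ge_c1[]->.
  - by move=> b /ge_c2[]->.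
  1-9: by apply: Nmix_mul; first [by rewrite !pp | done].
  move=> x y z /comb3_entry H.
  have nar : (a == r0) = false by apply: na; olia.
  by split; apply: (mul_eq0_l nz); [move: (H a c0) | move: (H a c1) | move: (H a c2)];
    simp; rewrite nar; simp.
have {}col0 a : B a r0 = 0 by apply/eqP; have := col0 a; case: eqP.
apply: (@bound3 (dl r0 r1) (dl r0 r2) (dl r0 r3)); try by [].
1-3: by apply: stab_top => //; olia.
1-9: by apply: dl_mul0; rewrite ne.
move=> x y z /comb3_entry H.
by split; [move: (H r0 r1) | move: (H r0 r2) | move: (H r0 r3)]; simp.
Qed.

(** Nmix at (r0, c1), (r0, c0) and (r1, c0): the zero square gives the products zero,
    the two nonzero entries next to it the independence. *)
Lemma deg_neq_square : B c0 r0 = 0 -> B c1 r0 = 0 -> B c0 r1 = 0 -> B c1 r1 = 0 ->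
  B c2 r0 != 0 -> B c0 r2 != 0 -> 'chi_i 1%g != (q ^ (mu n - 2))%:R.
Proof.
move=> b0 b1 b2 b3 nz nz'.
apply: (@bound3 (Nmix r0 c1) (Nmix r0 c0) (Nmix r1 c0)); try by [].
- by apply: stab_Nmix; [by rewrite !pp | move=> b /le_r0-> | move=> a /ge_c1[]->].
- by apply: stab_Nmix; [by rewrite !pp | move=> b /le_r0-> | move=> a /ge_c0->].
- by apply: stab_Nmix; [by rewrite !pp | move=> b /le_r1[]-> | move=> a /ge_c0->].
1-9: by apply: Nmix_mul; first [by rewrite !pp | done].
move=> x y z /comb3_entry H.
have x0 : x = 0 by apply: (mul_eq0_l nz); move: (H c2 c1); simp.
have z0 : z = 0 by apply: (mul_eq0_l nz'); move: (H r1 r2); simp.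
by split=> //; apply: (mul_eq0_l nz); move: (H c2 c0); rewrite x0 z0; simp.
Qed.

(** The three lowest entries of column r1 of B vanish. A nonzero entry higher up
    makes Nmix at (r0, c0), (r1, c0) and (r1, c2) independent; if there is none,
    elementary matrices with row r1 in the upper left block fix B. *)
Lemma deg_neq_gap_col : (4 <= s)%N -> B c0 r0 = 0 -> B c0 r1 = 0 -> B c1 r1 = 0 ->
  B c2 r0 = 0 -> B c2 r1 = 0 -> B c1 r0 != 0 -> B c0 r2 != 0 ->
  'chi_i 1%g != (q ^ (mu n - 2))%:R.
Proof.
move=> s4 b0 b1 b2 b3 b4 nz1 nz2.
case: (pickP (fun a => B a r1 != 0)) => [a nz | col0].
  have na := col_row nz.
  apply: (@bound3 (Nmix r0 c0) (Nmix r1 c0) (Nmix r1 c2)); try by [].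
  - by apply: stab_Nmix; [by rewrite !pp | move=> b /le_r0-> | move=> a' /ge_c0->].
  - by apply: stab_Nmix; [by rewrite !pp | move=> b /le_r1[]-> | move=> a' /ge_c0->].
  - by apply: stab_Nmix; [by rewrite !pp | move=> b /le_r1[]-> | move=> a' /ge_c2[]->].
  1-9: by apply: Nmix_mul; first [by rewrite !pp | done].
  move=> x y z /comb3_entry H.
  have nar0 : (a == r0) = false by apply: na; olia.
  have nar1 : (a == r1) = false by apply: na; olia.
  have z0 : z = 0 by apply: (mul_eq0_l nz); move: (H a c2); simp; rewrite nar0 nar1; simp.
  by split=> //; apply: (mul_eq0_l nz2); [move: (H r0 r2) | move: (H r1 r2)];
    rewrite z0; simp.
have {}col0 a : B a r1 = 0 by apply/eqP; have := col0 a; case: eqP.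
apply: (@bound3 (Nmix r0 c0) (dl r1 r2) (dl r1 r3)); try by [].
- by apply: stab_Nmix; [by rewrite !pp | move=> b /le_r0-> | move=> a' /ge_c0->].
- by apply: stab_top => //; olia.
- by apply: stab_top => //; olia.
- by apply: Nmix_mul; first [by rewrite !pp | done].
- by apply: Nmix_top; first [by rewrite !pp | done | olia].
- by apply: Nmix_top; first [by rewrite !pp | done | olia].
- by apply: top_Nmix; rewrite ?ne //; olia.
- by apply: dl_mul0; rewrite ne.
- by apply: dl_mul0; rewrite ne.
- by apply: top_Nmix; rewrite ?ne //; olia.
- by apply: dl_mul0; rewrite ne.
- by apply: dl_mul0; rewrite ne.
move=> x y z /comb3_entry H.
have x0 : x = 0 by apply: (mul_eq0_l nz1); move: (H c1 c0); simp.
by split=> //; [move: (H r1 r2) | move: (H r1 r3)]; rewrite x0; simp.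
Qed.

(** The mirror image of deg_neq_gap_col. *)
Lemma deg_neq_gap_row : (4 <= n - s)%N -> B c0 r0 = 0 -> B c1 r0 = 0 -> B c1 r1 = 0 ->
  B c0 r2 = 0 -> B c1 r2 = 0 -> B c2 r0 != 0 -> B c0 r1 != 0 ->
  'chi_i 1%g != (q ^ (mu n - 2))%:R.
Proof.
move=> s4 b0 b1 b2 b3 b4 nz1 nz2.
case: (pickP (fun b => B c1 b != 0)) => [b nz | row0].
  have nb := row_col nz.
  apply: (@bound3 (Nmix r0 c0) (Nmix r0 c1) (Nmix r2 c1)); try by [].
  - by apply: stab_Nmix; [by rewrite !pp | move=> b' /le_r0-> | move=> a' /ge_c0->].
  - by apply: stab_Nmix; [by rewrite !pp | move=> b' /le_r0-> | move=> a' /ge_c1[]->].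
  - by apply: stab_Nmix; [by rewrite !pp | move=> b' /le_r2[]-> | move=> a' /ge_c1[]->].
  1-9: by apply: Nmix_mul; first [by rewrite !pp | done].
  move=> x y z /comb3_entry H.
  have nbc0 : (b == c0) = false by apply: nb; olia.
  have nbc1 : (b == c1) = false by apply: nb; olia.
  have z0 : z = 0 by apply: (mul_eq0_l nz); move: (H r2 b); simp; rewrite nbc0 nbc1; simp.
  by split=> //; apply: (mul_eq0_l nz1); [move: (H c2 c0) | move: (H c2 c1)];
    rewrite z0; simp.
have {}row0 b : B c1 b = 0 by apply/eqP; have := row0 b; case: eqP.
apply: (@bound3 (Nmix r0 c0) (dl c2 c1) (dl c3 c1)); try by [].
- by apply: stab_Nmix; [by rewrite !pp | move=> b' /le_r0-> | move=> a' /ge_c0->].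
- by apply: stab_bot => //; olia.
- by apply: stab_bot => //; olia.
- by apply: Nmix_mul; first [by rewrite !pp | done].
- by apply: Nmix_bot; rewrite ?ne //; olia.
- by apply: Nmix_bot; rewrite ?ne //; olia.
- by apply: bot_Nmix; first [by rewrite !pp | done | olia].
- by apply: dl_mul0; rewrite ne.
- by apply: dl_mul0; rewrite ne.
- by apply: bot_Nmix; first [by rewrite !pp | done | olia].
- by apply: dl_mul0; rewrite ne.
- by apply: dl_mul0; rewrite ne.
move=> x y z /comb3_entry H.
have x0 : x = 0 by apply: (mul_eq0_l nz2); move: (H r0 r1); simp.
by split=> //; [move: (H c2 c1) | move: (H c3 c1)]; rewrite x0; simp.
Qed.

End FixB.
End Bounds.

(** * Normal forms of the corner *)

Section Normalise.

Variables (F : finFieldType) (p : nat).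
Local Notation n := p.+1.
Local Notation Mn := 'M[F]_n.
Local Notation GL := (GLt F p).
Local Notation U := (unitri F n : {group GL}).
Local Notation dl := (@delta_mx F n n).
Variable i : Iirr U.

(** Adding to a row of B a multiple of a lower row is conjugation by an element of
    U; so is adding to a column a multiple of a column to its left. *)
Lemma row_op s (B : Mn) x (c c' : 'I_n) : low s B -> (s <= c < c')%N ->
  lies_over s i B -> low s ((1 + x *: dl c c') * B) /\ lies_over s i ((1 + x *: dl c c') * B).
Proof.
move=> lB /andP[sc cc'] Oi; have [eB Be] := lowP _ _ lB.
have lB1 : low s ((1 + x *: dl c c') * B).
  apply/lowP; split; last by rewrite -mulrA Be mulr0.
  by rewrite mulrDl mul1r mulrDr eB -scalerAl -scalerAr mulrA e_dl sc scale1r.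
split=> //; pose y := elt x c c'; have Dy := mx_elt x cc'.
have Uy : y^-1%g \in U by rewrite groupV elt_in_U.
apply: (over_conj Uy lB lB1 _ Oi); rewrite -Dy -!mulrA (mulrA (mx y^-1%g)) mxVK mul1r eB.
have y1 : mx y * (1 - tail_proj F p s) = 1 - tail_proj F p s.
  rewrite Dy mulrDl mul1r -scalerAl mulrBr mulr1 dl_e (leq_trans sc (ltnW cc')) scale1r.
  by rewrite subrr scaler0 addr0.
by rewrite -{1}y1 (mulrA (mx y^-1%g)) mxVK mul1r mulrBr mulr1 Be subr0.
Qed.

Lemma col_op s (B : Mn) x (r r' : 'I_n) : low s B -> (r < r' < s)%N ->
  lies_over s i B -> low s (B * (1 + x *: dl r r')) /\ lies_over s i (B * (1 + x *: dl r r')).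
Proof.
move=> lB /andP[rr' r's] Oi; have [eB Be] := lowP _ _ lB.
have ye : dl r r' * tail_proj F p s = 0 by rewrite dl_e leqNgt r's scale0r.
have ey : tail_proj F p s * dl r r' = 0 by rewrite e_dl leqNgt (ltn_trans rr') // scale0r.
have lB1 : low s (B * (1 + x *: dl r r')).
  apply/lowP; split; first by rewrite mulrA eB.
  by rewrite -mulrA mulrDl mul1r -scalerAl ye scaler0 addr0.
split=> //; pose y := elt x r r'; have Dy := mx_elt x rr'.
have Uy : y \in U by rewrite elt_in_U.
apply: (over_conj Uy lB lB1 _ Oi); rewrite Dy.
have -> : tail_proj F p s * (1 + x *: dl r r') = tail_proj F p s.
  by rewrite mulrDr mulr1 -scalerAr ey scaler0 addr0.
have [eB1 B1e] := lowP _ _ lB1.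
by rewrite eB1 mulrBr mulr1 B1e subr0.
Qed.

(** By hypothesis row r of B^-1 B1, on the first coordinates, has 1 on the diagonal
    and 0 to the left of it, so that B1 = B x with x in U. *)
Lemma monomial_form (d : corner_datum F p) (B1 : Mn) : low (cstart d) B1 ->
  (forall r c j : 'I_n, (r < csize d)%N -> (c == cstart d + cperm d r :> nat)%N -> (j <= r)%N ->
      B1 c j = (j == r)%:R * cscal d r) ->
  lies_over (cstart d) i B1 -> lies_over (cstart d) i (cB d).
Proof.
move=> lB1 H Oi; have [eB1 B1e] := lowP _ _ lB1.
have sA : supp (@ltord p) (cBinv d * B1 - ctop d).
  apply/suppP=> r j; rewrite /ltord -leqNgt => le_jr; rewrite mxsubE mulmxEij mxE.
  case: (ltnP r (csize d)) => rk; last first.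
    by rewrite andbF subr0 big1 // => l _; rewrite mxE ltnNge rk mul0r.
  have lt_c : (cstart d + cperm d r < n)%N by have := s_k d; have := cperm_lt rk; lia.
  rewrite (bigD1 (Ordinal lt_c)) //= big1 => [|l nl]; last first.
    rewrite mxE; case: ifP => [/andP[_ /eqP El]|_]; last by rewrite mul0r.
    by case/eqP: nl; apply: val_inj.
  rewrite addr0 mxE rk eqxx /= (H r) ?eqxx // mulrCA mulVf ?cscal_nz // mulr1.
  by rewrite andbT eq_sym subrr.
have [Ux Dx] := mkGL_U sA; set x := mkGL _ in Ux Dx.
have tB' : tail_proj F p (cstart d) * cBinv d = 0 by rewrite -(c_tb' d) mulrA c_et mul0r.
have ex : tail_proj F p (cstart d) * mx x = tail_proj F p (cstart d).
  by rewrite Dx mulrDr mulr1 mulrBr mulrA tB' mul0r c_et subrr addr0.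
have Bx : cB d * mx x = B1.
  by rewrite Dx mulrDr mulr1 mulrBr mulrA c_bb' eB1 c_bt addrC subrK.
have Ux' : x^-1%g \in U by rewrite groupV.
apply: (over_conj Ux' lB1 (c_low d) _ Oi).
have ex' : tail_proj F p (cstart d) * mx x^-1%g = tail_proj F p (cstart d).
  by rewrite -{1}ex -mulrA mxKV mulr1.
by rewrite ex' c_eb -Bx -!mulrA (mulrA (mx x)) mxKV mul1r mulrBr mulr1 c_be subr0.
Qed.

End Normalise.

Section Types.

Variables (F : finFieldType) (p : nat).
Local Notation n := p.+1.

(** Replacing 0 by 1 makes the corner data total functions of their scalars, so
    that they can be indexed by a finite type. *)
Definition nzF (x : F) : F := if x == 0 then 1 else x.
Lemma nzF_neq0 x : nzF x != 0. Proof. by rewrite /nzF; case: (altP (x =P 0)); rewrite ?oner_neq0. Qed.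
Lemma nzFE x : x != 0 -> nzF x = x. Proof. by rewrite /nzF => /negbTE->. Qed.

Definition nth_perm (w : seq nat) (j : nat) : nat := nth 0%N w j.
Definition nth_scal (w : seq F) (j : nat) : F := nzF (nth 0 w j).

Lemma perm_datum_exists (w : seq nat) (x : seq F) : (size w + size w <= n)%N ->
  perm_eq w (iota 0 (size w)) ->
  {d : corner_datum F p | [/\ csize d = size w, cperm d = nth_perm w & cscal d = nth_scal x]}.
Proof.
move=> small pw.
have uw : uniq w by rewrite (perm_uniq pw) iota_uniq.
have lt i : (i < size w)%N -> (nth_perm w i < size w)%N.
  by move=> iw; have := mem_nth 0%N iw; rewrite (perm_mem pw) mem_iota.
have inj i j : (i < size w)%N -> (j < size w)%N -> nth_perm w i = nth_perm w j -> i = j.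
  by move=> iw jw /eqP; rewrite nth_uniq // => /eqP.
have surj c : (c < size w)%N -> exists2 i, (i < size w)%N & nth_perm w i = c.
  move=> cw; have : c \in w by rewrite (perm_mem pw) mem_iota.
  by move=> wc; exists (index c w); rewrite ?index_mem // /nth_perm nth_index.
have nz i : (i < size w)%N -> nth_scal x i != 0 by move=> _; apply: nzF_neq0.
by exists (CornerDatum small lt inj surj nz).
Qed.

End Types.

Section Classify.

Variables (F : finFieldType) (p : nat).
Local Notation n := p.+1.
Local Notation Mn := 'M[F]_n.
Local Notation GL := (GLt F p).
Local Notation U := (unitri F n : {group GL}).
Local Notation dl := (@delta_mx F n n).

Fact corner_index : {f : nat -> 'I_n | forall l, (l <= p)%N -> f l = l :> nat}.
Proof. by exists inord => l lp; rewrite inordK. Qed.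

(** Opaque indices: comparing them is left to arithmetic on their values instead of
    to conversion. *)
Definition ord_at l : 'I_n := sval corner_index l.
Definition ord_from_end m : 'I_n := sval corner_index (p - m)%N.

Lemma ord_atE l : (l <= p)%N -> ord_at l = l :> nat. Proof. exact: (svalP corner_index). Qed.
Lemma ord_from_endE m : ord_from_end m = (p - m)%N :> nat.
Proof. by apply: (svalP corner_index); apply: leq_subr. Qed.

Lemma monomial_corner (i : Iirr U) (d : corner_datum F p) (B1 : Mn) : low (cstart d) B1 ->
  (forall j l, (j < csize d)%N -> (l <= j)%N ->
      B1 (ord_from_end (csize d - 1 - cperm d j)) (ord_at l) = if l == j then cscal d j else 0) ->
  lies_over (cstart d) i B1 -> lies_over (cstart d) i (cB d).
Proof.
move=> lB1 H; apply: monomial_form => // r c j rk /eqP Dc jr.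
have := H r j rk jr; have sk := s_k d; have pk := cperm_lt rk; have kn := csize_small d.
have -> : ord_from_end (csize d - 1 - cperm d r) = c by apply: val_inj; rewrite /= ord_from_endE Dc; lia.
have -> : ord_at j = j by apply: val_inj; rewrite /= ord_atE // -ltnS.
by move=> ->; rewrite val_eqE; case: eqP; rewrite ?mul1r ?mul0r.
Qed.

Lemma move_block s s' (i : Iirr U) (B : Mn) : lies_over s i B ->
  exists B', [/\ low s' B', lies_over s' i B' &
    forall l m, (l < s)%N -> (l < s')%N -> (s <= p - m)%N -> (s' <= p - m)%N ->
      B (ord_from_end m) (ord_at l) = B' (ord_from_end m) (ord_at l)].
Proof.
move=> Oi; have [B' [lB' Oi' E]] := over_other_block s' Oi; exists B'; split=> // l m ls ls' sm sm'.
have lp : (l <= p)%N by lia.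
by apply: E; rewrite ord_from_endE ord_atE //; lia.
Qed.

Lemma col_mul_entry (B : Mn) x (r r' a b : 'I_n) :
  (B * (1 + x *: dl r r')) a b = B a b + x * B a r * (b == r')%:R.
Proof.
rewrite mulrDr mulr1 mxaddE -scalerAr [X in _ + X]mxE; congr (_ + _).
by rewrite Bdl_entry mulrA.
Qed.

Definition perm_datum w x small pw : corner_datum F p := sval (@perm_datum_exists F p w x small pw).

Lemma perm_datumE w x small pw : [/\ csize (@perm_datum w x small pw) = size w,
  cperm (@perm_datum w x small pw) = nth_perm w & cscal (@perm_datum w x small pw) = nth_scal x].
Proof. exact: (svalP (perm_datum_exists _ _ _)). Qed.

Lemma csize_datum w x small pw : csize (@perm_datum w x small pw) = size w.
Proof. by case: (perm_datumE x small pw). Qed.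

Lemma cstart_datum w x small pw : cstart (@perm_datum w x small pw) = (n - size w)%N.
Proof. by rewrite /cstart; have [-> _ _] := perm_datumE x small pw. Qed.

Lemma over_perm_datum (i : Iirr U) w x small pw s (B1 : Mn) :
    lies_over s i B1 -> (size w <= s)%N -> (s <= n - size w)%N ->
  (forall j l, (j < size w)%N -> (l <= j)%N ->
      B1 (ord_from_end (size w - 1 - nth_perm w j)) (ord_at l) = if l == j then nth_scal x j else 0) ->
  lies_over (cstart (@perm_datum w x small pw)) i (cB (@perm_datum w x small pw)).
Proof.
move=> Oi ws sw H; set d := perm_datum _ _ _; have [kE piE bE] := perm_datumE x small pw.
have csE := cstart_datum x small pw.
have [B2 [lB2 Oi2 E]] := move_block (cstart d) Oi.
apply: (monomial_corner lB2 _ Oi2) => j l; rewrite kE piE bE => jk lj.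
rewrite -E ?H //; rewrite ?/d ?csE; try lia.
Qed.

End Classify.

(** * Classification of the characters of third largest degree *)

Section Five.

Variables (F : finFieldType) (p : nat).
Local Notation n := p.+1.
Local Notation Mn := 'M[F]_n.
Local Notation GL := (GLt F p).
Local Notation U := (unitri F n : {group GL}).
Local Notation dl := (@delta_mx F n n).
Local Notation q := #|F|.
Local Notation r := (@ord_at p).
Local Notation c := (@ord_from_end p).
Hypothesis Hn : (7 <= n)%N.

Lemma small1 : (size [:: 0%N] + size [:: 0%N] <= n)%N. Proof. by rewrite (leq_trans _ Hn). Qed.
Lemma small2 : (size [:: 0; 1]%N + size [:: 0; 1]%N <= n)%N. Proof. by rewrite (leq_trans _ Hn). Qed.
Lemma small3 a b c : (size [:: a; b; c : nat] + size [:: a; b; c] <= n)%N.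
Proof. by rewrite (leq_trans _ Hn). Qed.

(** The corners of the five types. The list is the permutation: its entry j is the
    column, counted from cstart, that is paired with row j. *)
Definition datum_i (a : F) := @perm_datum F p [:: 0%N] [:: a] small1 isT.
Definition datum_ii (a b : F) := @perm_datum F p [:: 0; 1]%N [:: a; b] small2 isT.
Definition datum_iii (a b c : F) := @perm_datum F p [:: 1; 0; 2]%N [:: a; b; c] (small3 _ _ _) isT.
Definition datum_iv (a b c : F) := @perm_datum F p [:: 0; 2; 1]%N [:: a; b; c] (small3 _ _ _) isT.
Definition datum_v (a b c : F) := @perm_datum F p [:: 0; 1; 2]%N [:: a; b; c] (small3 _ _ _) isT.

Definition over_datum (d : corner_datum F p) (i : Iirr U) := lies_over (cstart d) i (cB d).

Lemma r_neq m m' : (m < 4)%N -> (m' < 4)%N -> (r m == r m') = (m == m').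
Proof. by move=> h h'; rewrite -val_eqE /= !ord_atE; lia. Qed.
Lemma c_neq m m' : (m < 4)%N -> (m' < 4)%N -> (c m == c m') = (m == m').
Proof. by move=> h h'; rewrite -val_eqE /= !ord_from_endE; lia. Qed.

Lemma rcol (B : Mn) x a b m l : (a < 3)%N -> (b < 3)%N -> (l < 3)%N ->
  (B * (1 + x *: dl (r a) (r b))) (c m) (r l)
    = B (c m) (r l) + x * B (c m) (r a) * (l == b)%:R.
Proof. by move=> a3 b3 l3; rewrite col_mul_entry r_neq // ltnW. Qed.

Lemma crow (B : Mn) x a b m l : (a < 3)%N -> (b < 3)%N -> (m < 3)%N ->
  ((1 + x *: dl (c a) (c b)) * B) (c m) (r l)
    = B (c m) (r l) + (m == a)%:R * x * B (c b) (r l).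
Proof. by move=> a3 b3 l3; rewrite mul_delta_mxE c_neq // ltnW. Qed.

Variable i : Iirr U.

Let h1 := n./2.
Let h2 := uphalf n.
Let h1le : (3 <= h1)%N /\ (4 <= n - h1)%N. Proof. by rewrite /h1; lia. Qed.
Let h2le : (4 <= h2)%N /\ (3 <= n - h2)%N. Proof. by rewrite /h2; lia. Qed.

Hypothesis deg : 'chi_i 1%g = (q ^ (mu n - 2))%:R.

(** The corner entries are examined from the bottom left. A nonzero entry (c0, r0)
    is type (i). If it vanishes, the entries (c1, r0) and (c0, r1) decide: both
    nonzero is type (ii), one nonzero is type (iii) or (iv) after clearing one row
    and one column, none is type (v). In each of the last three cases a further
    zero leads to one of the bounds above. The bounds require four rows or four
    columns on one side of the block, so s is taken as the lower or the upper half
    of n according to the case. *)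
Theorem classification :
  [\/ exists2 a, a != 0 & over_datum (datum_i a) i,
      exists a b, [/\ a != 0, b != 0 & over_datum (datum_ii a b) i],
      exists x y z, [/\ [/\ x != 0, y != 0 & z != 0] & over_datum (datum_iii x y z) i]
    | exists x y z, [/\ [/\ x != 0, y != 0 & z != 0] & over_datum (datum_iv x y z) i]]
  \/ exists x y z, [/\ [/\ x != 0, y != 0 & z != 0] & over_datum (datum_v x y z) i].
Proof.
have R0 : r 0 = 0%N :> nat by rewrite ord_atE.
have R1 : r 1 = 1%N :> nat by rewrite ord_atE //; lia.
have R2 : r 2 = 2%N :> nat by rewrite ord_atE //; lia.
have R3 : r 3 = 3%N :> nat by rewrite ord_atE //; lia.
have C0 : c 0 = p :> nat by rewrite ord_from_endE subn0.
have C1 := ord_from_endE p 1; have C2 := ord_from_endE p 2; have C3 := ord_from_endE p 3.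
have sh1 : h1 = n./2 \/ h1 = uphalf n by left.
have sh2 : h2 = n./2 \/ h2 = uphalf n by right.
have [h1l h1r] := h1le; have [h2l h2r] := h2le.
have [B lB Oi] := over_exists h2 i.
have [B' [lB' Oi' EB]] := move_block h1 Oi.
have h12 : (h1 <= h2)%N by rewrite /h1 /h2; lia.
have EBB l m : (l < 3)%N -> (m < 3)%N -> B' (c m) (r l) = B (c m) (r l).
  by move=> l3 m3; rewrite EB //; lia.
have W1 k : (k <= 3)%N -> (k <= h1)%N /\ (h1 <= n - k)%N by lia.
have W2 k : (k <= 3)%N -> (k <= h2)%N /\ (h2 <= n - k)%N by lia.
have [ro1 co1] : (r 1 < r 2 < h1)%N /\ (h1 <= c 1 < c 0)%N by lia.
have [ro2 co2] : (r 0 < r 1 < h2)%N /\ (h2 <= c 2 < c 1)%N by lia.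
have rcol := rcol; have crow := crow.
clear h1le h2le; clearbody h1 h2.
have ndeg (P : Prop) : (P -> 'chi_i 1%g != (q ^ (mu n - 2))%:R) -> P -> False.
  by move=> H /H; rewrite deg eqxx.
have [z00|nz00] := eqVneq (B (c 0) (r 0)) 0; last first.
  left; apply: Or41; exists (B (c 0) (r 0)); first exact: nz00.
  apply: (over_perm_datum _ _ Oi); [by case: (W2 1%N)|by case: (W2 1%N)|].
  by case=> [|j] [|l] //= _ _; rewrite /nth_scal /= nzFE.
have [z10|nz10] := eqVneq (B (c 1) (r 0)) 0; have [z01|nz01] := eqVneq (B (c 0) (r 1)) 0.
- have [z20|nz20] := eqVneq (B (c 2) (r 0)) 0.
    case: (ndeg True) => // _.
    exact: (deg_neq_left_col Hn lB sh2 R0 R1 R2 R3 C0 C1 C2 C3 Oi).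
  have [z02|nz02] := eqVneq (B (c 0) (r 2)) 0.
    case: (ndeg True) => // _.
    by apply: (deg_neq_bottom_row Hn lB' sh1 R0 R1 R2 R3 C0 C1 C2 C3 Oi'); rewrite ?EBB.
  have [z11|nz11] := eqVneq (B (c 1) (r 1)) 0.
    case: (ndeg True) => // _.
    exact: (deg_neq_square Hn lB sh2 R0 R1 R2 R3 C0 C1 C2 C3 Oi).
  right; exists (B (c 2) (r 0)), (B (c 1) (r 1)), (B (c 0) (r 2)).
  split; first by split; [exact: nz20|exact: nz11|exact: nz02].
  apply: (over_perm_datum _ _ Oi); [by case: (W2 3%N)|by case: (W2 3%N)|].
  by case=> [|[|[|j]]] [|[|[|l]]] //= _ _; rewrite /nth_scal /= ?nzFE //; assumption.
- have [z20|nz20] := eqVneq (B (c 2) (r 0)) 0.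
    case: (ndeg True) => // _.
    exact: (deg_neq_left_col Hn lB sh2 R0 R1 R2 R3 C0 C1 C2 C3 Oi).
  have [x1 Dx1] : exists x, x = - (B' (c 0) (r 2) / B' (c 0) (r 1)) by eexists.
  have [lB1 Oi1] : low h1 (B' * (1 + x1 *: dl (r 1) (r 2))) /\
      lies_over h1 i (B' * (1 + x1 *: dl (r 1) (r 2))).
    exact: col_op.
  set B1 := B' * _ in lB1 Oi1.
  have E1 m l : (l < 3)%N -> (m < 3)%N -> B1 (c m) (r l)
      = B (c m) (r l) + x1 * B (c m) (r 1) * (l == 2%N)%:R.
    by move=> l3 m3; rewrite rcol // !(EBB _ m).
  have [x2 Dx2] : exists x, x = - (B1 (c 1) (r 1) / B1 (c 0) (r 1)) by eexists.
  have [lB2 Oi2] : low h1 ((1 + x2 *: dl (c 1) (c 0)) * B1) /\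
      lies_over h1 i ((1 + x2 *: dl (c 1) (c 0)) * B1).
    exact: row_op.
  set B2 := _ * B1 in lB2 Oi2.
  have E2 m l : (l < 3)%N -> (m < 3)%N -> B2 (c m) (r l)
      = B1 (c m) (r l) + (m == 1%N)%:R * x2 * B1 (c 0) (r l).
    by move=> l3 m3; rewrite crow.
  have B01 : B1 (c 0) (r 1) = B (c 0) (r 1) by rewrite E1 //= mulr0 addr0.
  have e00 : B2 (c 0) (r 0) = 0 by rewrite E2 // !E1 //= z00 !(mulr0, mul0r, addr0).
  have e10 : B2 (c 1) (r 0) = 0 by rewrite E2 // !E1 //= z00 z10 !(mulr0, mul0r, addr0).
  have e20 : B2 (c 2) (r 0) = B (c 2) (r 0) by rewrite E2 // !E1 //= !(mulr0, mul0r, addr0).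
  have e01 : B2 (c 0) (r 1) = B (c 0) (r 1) by rewrite E2 // !E1 //= !(mulr0, mul0r, addr0).
  have e11 : B2 (c 1) (r 1) = 0.
    by rewrite E2 //= mul1r Dx2 mulNr divfK ?B01 // subrr.
  have e02 : B2 (c 0) (r 2) = 0.
    rewrite E2 //= !mul0r addr0 E1 //= mulr1 Dx1 !EBB // mulNr divfK // subrr //.
  have [z|nz] := eqVneq (B2 (c 1) (r 2)) 0.
    case: (ndeg True) => // _.
    by apply: (deg_neq_gap_row Hn lB2 sh1 R0 R1 R2 R3 C0 C1 C2 C3 Oi2); rewrite ?e20 ?e01.
  left; apply: Or44; exists (B2 (c 2) (r 0)), (B2 (c 0) (r 1)), (B2 (c 1) (r 2)).
  split; first by rewrite e20 e01; split; [exact: nz20|exact: nz01|exact: nz].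
  apply: (over_perm_datum _ _ Oi2); [by case: (W1 3%N)|by case: (W1 3%N)|].
  by case=> [|[|[|j]]] [|[|[|l]]] //= _ _; rewrite /nth_scal /= ?nzFE ?e20 ?e01 //; assumption.
- have [z02|nz02] := eqVneq (B (c 0) (r 2)) 0.
    case: (ndeg True) => // _.
    by apply: (deg_neq_bottom_row Hn lB' sh1 R0 R1 R2 R3 C0 C1 C2 C3 Oi'); rewrite ?EBB.
  have [x1 Dx1] : exists x, x = - (B (c 1) (r 1) / B (c 1) (r 0)) by eexists.
  have [lB1 Oi1] : low h2 (B * (1 + x1 *: dl (r 0) (r 1))) /\
      lies_over h2 i (B * (1 + x1 *: dl (r 0) (r 1))).
    exact: col_op.
  set B1 := B * _ in lB1 Oi1.
  have E1 m l : (l < 3)%N -> (m < 3)%N -> B1 (c m) (r l)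
      = B (c m) (r l) + x1 * B (c m) (r 0) * (l == 1%N)%:R.
    by move=> l3 m3; rewrite rcol.
  have [x2 Dx2] : exists x, x = - (B1 (c 2) (r 0) / B1 (c 1) (r 0)) by eexists.
  have [lB2 Oi2] : low h2 ((1 + x2 *: dl (c 2) (c 1)) * B1) /\
      lies_over h2 i ((1 + x2 *: dl (c 2) (c 1)) * B1).
    exact: row_op.
  set B2 := _ * B1 in lB2 Oi2.
  have E2 m l : (l < 3)%N -> (m < 3)%N -> B2 (c m) (r l)
      = B1 (c m) (r l) + (m == 2%N)%:R * x2 * B1 (c 1) (r l).
    by move=> l3 m3; rewrite crow.
  have B10 : B1 (c 1) (r 0) = B (c 1) (r 0) by rewrite E1 //= mulr0 addr0.
  have e00 : B2 (c 0) (r 0) = 0 by rewrite E2 // !E1 //= z00 !(mulr0, mul0r, addr0).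
  have e10 : B2 (c 1) (r 0) = B (c 1) (r 0) by rewrite E2 // !E1 //= !(mulr0, mul0r, addr0).
  have e20 : B2 (c 2) (r 0) = 0.
    by rewrite E2 //= mul1r Dx2 mulNr divfK ?B10 // subrr.
  have e01 : B2 (c 0) (r 1) = 0 by rewrite E2 // !E1 //= z00 z01 !(mulr0, mul0r, addr0).
  have e11 : B2 (c 1) (r 1) = 0.
    by rewrite E2 //= !mul0r addr0 E1 //= mulr1 Dx1 mulNr divfK // subrr.
  have e02 : B2 (c 0) (r 2) = B (c 0) (r 2) by rewrite E2 // !E1 //= !(mulr0, mul0r, addr0).
  have [z|nz] := eqVneq (B2 (c 2) (r 1)) 0.
    case: (ndeg True) => // _.
    by apply: (deg_neq_gap_col Hn lB2 sh2 R0 R1 R2 R3 C0 C1 C2 C3 Oi2); rewrite ?e10 ?e02.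
  left; apply: Or43; exists (B2 (c 1) (r 0)), (B2 (c 2) (r 1)), (B2 (c 0) (r 2)).
  split; first by rewrite e10 e02; split; [exact: nz10|exact: nz|exact: nz02].
  apply: (over_perm_datum _ _ Oi2); [by case: (W2 3%N)|by case: (W2 3%N)|].
  by case=> [|[|[|j]]] [|[|[|l]]] //= _ _; rewrite /nth_scal /= ?nzFE ?e10 ?e02 //; assumption.
left; apply: Or42; exists (B (c 1) (r 0)), (B (c 0) (r 1)).
split; [exact: nz10|exact: nz01|].
apply: (over_perm_datum _ _ Oi); [by case: (W2 2%N)|by case: (W2 2%N)|].
by case=> [|[|j]] [|[|l]] //= _ _; rewrite /nth_scal /= ?nzFE //; assumption.
Qed.

End Five.

(** * The normal form is an invariant *)

Section Expand.

Variables (F : finFieldType) (p : nat).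
Local Notation n := p.+1.
Local Notation Mn := 'M[F]_n.
Local Notation GL := (GLt F p).
Local Notation U := (unitri F n : {group GL}).
Local Notation r := (@ord_at p).
Local Notation c := (@ord_from_end p).

(** Indices counted from the end turn the sum over the entries right of the
    diagonal into an initial segment. *)
Lemma row_expand u (A : Mn) m l : u \in U -> (m <= p)%N ->
  (mx u * A) (c m) l = \sum_(m' < m.+1) mx u (c m) (c m') * A (c m') l.
Proof.
move=> /UP Uu mp; rewrite mulmxEij (reindex_inj rev_ord_inj) /=.
rewrite (eq_bigr (fun m' : 'I_n => mx u (c m) (c m') * A (c m') l)) => [|m' _]; last first.
  by congr (_ _ _ * A _ _); apply: val_inj; rewrite /= ord_from_endE subSS.
rewrite (@big_ord_widen_cond _ _ _ m.+1 n xpredT (fun m' => mx u (c m) (c m') * A (c m') l)) //.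
rewrite [LHS](bigID (fun m' : 'I_n => m' < m.+1)%N) /= [X in _ + X]big1 ?addr0 // => m' h.
have hm : (m' <= p)%N by rewrite -ltnS.
rewrite Uu; first by case: eqP => [/(congr1 (@nat_of_ord n))|]; rewrite ?mul0r // !ord_from_endE; lia.
by rewrite !ord_from_endE; lia.
Qed.

Lemma col_expand u (A : Mn) k l : u \in U -> (l <= p)%N ->
  (A * mx u) k (r l) = \sum_(l' < l.+1) A k (r l') * mx u (r l') (r l).
Proof.
move=> /UP Uu lp; rewrite mulmxEij.
rewrite (eq_bigr (fun l' : 'I_n => A k (r l') * mx u (r l') (r l))) => [|l' _]; last first.
  have -> : r l' = l' by apply: val_inj; rewrite /= ord_atE // -ltnS.
  by [].
rewrite (@big_ord_widen_cond _ _ _ l.+1 n xpredT (fun l' => A k (r l') * mx u (r l') (r l))) //.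
rewrite [LHS](bigID (fun l' : 'I_n => l' < l.+1)%N) /= [X in _ + X]big1 ?addr0 // => l' h.
have hm : (l' <= p)%N by rewrite -ltnS.
rewrite Uu; last by rewrite !ord_atE //; lia.
by case: eqP => [/(congr1 (@nat_of_ord n))|]; rewrite ?mulr0 // !ord_atE //; lia.
Qed.

Lemma conjM_corner u (B : Mn) m l : u \in U -> (m <= p)%N -> (l <= p)%N ->
  conjM u B (c m) (r l) = \sum_(m' < m.+1) \sum_(l' < l.+1)
    mx u^-1%g (c m) (c m') * B (c m') (r l') * mx u (r l') (r l).
Proof.
move=> Uu mp lp; rewrite /conjM -mulrA row_expand ?groupV //.
by apply: eq_bigr => m' _; rewrite col_expand // mulr_sumr; apply: eq_bigr => l' _; rewrite mulrA.
Qed.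

Lemma U_diag u k : u \in U -> mx u k k = 1.
Proof. by move=> /UP ->; rewrite ?eqxx. Qed.

(** The effect on a 3 by 3 corner, with rows counted from the bottom, of the
    operation B -> u^-1 B u. *)
Definition corner_rel (b b' : nat -> nat -> F) := exists v u : nat -> nat -> F,
  (forall m, v m m = 1) /\ (forall m, u m m = 1) /\
  (forall m l, (m < 3)%N -> (l < 3)%N ->
    b' m l = \sum_(m' < m.+1) \sum_(l' < l.+1) v m m' * b m' l' * u l' l).

Definition corner (B : Mn) m l := B (c m) (r l).

Lemma over_corner_rel s (i : Iirr U) B B' : (3 <= s)%N -> (s <= n - 3)%N ->
  lies_over s i B -> lies_over s i B' -> corner_rel (corner B) (corner B').
Proof.
move=> s3 sn Oi Oi'; have [u Uu E] := over_uniq Oi Oi'.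
exists (fun m m' => mx u^-1%g (c m) (c m')), (fun l' l => mx u (r l') (r l)).
split=> [m|]; first by rewrite U_diag ?groupV.
split=> [m|m l m3 l3]; first by rewrite U_diag.
have [mp lp] : (m <= p)%N /\ (l <= p)%N by lia.
by rewrite -conjM_corner // E // ord_from_endE ord_atE //; lia.
Qed.

(** The corner changes by adding multiples of entries further down or to the left;
    the listed entries are those for which all these contributions vanish. In the
    cases where exactly one of (0, 1) and (1, 0) is zero, the zero entry at (1, 1) on
    both sides annihilates the only coefficient that could alter the remaining
    entry. *)
Lemma corner_rel_invariants b b' : corner_rel b b' ->
  [/\ b' 0%N 0%N = b 0%N 0%N, b 0%N 0%N = 0 -> b' 1%N 0%N = b 1%N 0%N /\ b' 0%N 1%N = b 0%N 1%N &
  b 0%N 0%N = 0 ->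
  [/\ b 0%N 1%N = 0 -> b 1%N 1%N = 0 -> b 2%N 0%N = 0 -> b' 1%N 1%N = 0 -> b 1%N 0%N != 0 ->
       b' 2%N 1%N = b 2%N 1%N /\ b' 0%N 2%N = b 0%N 2%N,
     b 1%N 0%N = 0 -> b 1%N 1%N = 0 -> b 0%N 2%N = 0 -> b' 1%N 1%N = 0 -> b 0%N 1%N != 0 ->
       b' 1%N 2%N = b 1%N 2%N /\ b' 2%N 0%N = b 2%N 0%N &
     b 1%N 0%N = 0 -> b 0%N 1%N = 0 -> [/\ b' 2%N 0%N = b 2%N 0%N, b' 1%N 1%N = b 1%N 1%N & b' 0%N 2%N = b 0%N 2%N]]].
Proof.
case=> v [u [v1 [u1 E]]].
have bigs := (big_ord_recr, big_ord0); have ones := (v1, u1, add0r, mul1r, mulr1).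
split; first by rewrite E // !bigs /= !ones.
  by move=> z; rewrite !E // !bigs /= !ones z !(mul0r, mulr0, add0r).
move=> z00; split=> z1 z2.
- move=> z3 + nz; rewrite !E // !bigs /= !ones z00 z1 z2 z3 !(mul0r, mulr0, add0r, addr0).
  by move/eqP; rewrite mulf_eq0 (negbTE nz) /= => /eqP ->; rewrite !mulr0 add0r.
- move=> z3 + nz; rewrite !E // !bigs /= !ones z00 z1 z2 z3 !(mul0r, mulr0, add0r, addr0).
  by move/eqP; rewrite mulf_eq0 (negbTE nz) orbF => /eqP ->; rewrite !mul0r add0r.
by rewrite !E // !bigs /= !ones z00 z1 z2 !(mul0r, mulr0, add0r, addr0).
Qed.

End Expand.

Section Index.

Variables (F : finFieldType) (p : nat).
Local Notation n := p.+1.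
Local Notation GL := (GLt F p).
Local Notation U := (unitri F n : {group GL}).
Hypothesis Hn : (7 <= n)%N.

(** A type together with its two or three scalars; one summand for each type. *)
Definition label := (F + F * F + F * F * F + F * F * F + F * F * F)%type.

Definition nz3 (v : F * F * F) := [&& v.1.1 != 0, v.1.2 != 0 & v.2 != 0].

Definition label_ok (x : label) : bool :=
  match x with
  | inl (inl (inl (inl a))) => a != 0
  | inl (inl (inl (inr v))) => (v.1 != 0) && (v.2 != 0)
  | inl (inl (inr v)) | inl (inr v) | inr v => nz3 v
  end.

Definition datum_of (x : label) : corner_datum F p :=
  match x with
  | inl (inl (inl (inl a))) => datum_i Hn a
  | inl (inl (inl (inr v))) => datum_ii Hn v.1 v.2
  | inl (inl (inr v)) => datum_iii Hn v.1.1 v.1.2 v.2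
  | inl (inr v) => datum_iv Hn v.1.1 v.1.2 v.2
  | inr v => datum_v Hn v.1.1 v.1.2 v.2
  end.

Lemma corner_cB w x small pw m l : (m < 3)%N -> (l < 3)%N ->
  corner (cB (@perm_datum F p w x small pw)) m l =
    if (l < size w)%N && (m + nth_perm w l == size w - 1)%N then nth_scal x l else 0.
Proof.
move=> m3 l3; have [kE piE bE] := perm_datumE x small pw; have sE := cstart_datum x small pw.
rewrite /corner mxE sE kE piE bE ord_atE; last by lia.
have [lw|//] := boolP (l < size w)%N; rewrite /= ord_from_endE.
suff -> : (p - m == n - size w + nth_perm w l)%N = (m + nth_perm w l == size w - 1)%N by [].
have := @cperm_lt _ _ (@perm_datum F p w x small pw) l; rewrite kE piE => /(_ lw).
by have := small; move: lw m3 Hn; clear; lia.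
Qed.

Lemma over_datum_corner d (i : Iirr U) : (csize d <= 3)%N -> over_datum d i ->
  exists2 B, lies_over (n - 3) i B &
    forall m l, (m < csize d)%N -> (l < 3)%N -> corner B m l = corner (cB d) m l.
Proof.
move=> dk Oi; have [B [_ Oi' E]] := move_block (n - 3) Oi; exists B => // m l mk l3.
by rewrite /corner E //; rewrite ?/cstart; lia.
Qed.

Lemma label_normal_form (i : Iirr U) x : label_ok x -> over_datum (datum_of x) i ->
  exists2 B, lies_over (n - 3) i B &
  let b := corner B in
  match x with
  | inl (inl (inl (inl a))) => b 0%N 0%N = a
  | inl (inl (inl (inr v))) => [/\ b 0%N 0%N = 0, b 1%N 0%N = v.1 & b 0%N 1%N = v.2]
  | inl (inl (inr v)) => [/\ b 0%N 0%N = 0, b 0%N 1%N = 0, b 1%N 1%N = 0 & b 2%N 0%N = 0]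
      /\ [/\ b 1%N 0%N = v.1.1, b 2%N 1%N = v.1.2 & b 0%N 2%N = v.2]
  | inl (inr v) => [/\ b 0%N 0%N = 0, b 1%N 0%N = 0, b 1%N 1%N = 0 & b 0%N 2%N = 0]
      /\ [/\ b 2%N 0%N = v.1.1, b 0%N 1%N = v.1.2 & b 1%N 2%N = v.2]
  | inr v => [/\ b 0%N 0%N = 0, b 1%N 0%N = 0 & b 0%N 1%N = 0]
      /\ [/\ b 2%N 0%N = v.1.1, b 1%N 1%N = v.1.2 & b 0%N 2%N = v.2]
  end.
Proof.
move=> okxx Oi; have [|B OB E] := @over_datum_corner (datum_of x) i _ Oi.
  by case: {okxx Oi} x => [[[[a|v]|v]|v]|v] /=; rewrite ?/datum_i ?/datum_ii ?/datum_iii ?/datum_iv ?/datum_v csize_datum.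
exists B => //=.
case: x okxx {Oi} E => [[[[a|v]|v]|v]|v] /=; rewrite ?/datum_i ?/datum_ii ?/datum_iii ?/datum_iv ?/datum_v csize_datum => nz E.
all: rewrite !E // !corner_cB //= /nth_scal /= ?nzFE //.
all: try by case/and3P: nz.
by case/andP: nz. by case/andP: nz.
Qed.

(** All the data of a label can be read off the invariant entries of a corner. *)
Lemma label_uniq (i : Iirr U) x y :
  label_ok x -> label_ok y -> over_datum (datum_of x) i -> over_datum (datum_of y) i -> x = y.
Proof.
move=> okxx okyy Ox Oy; have [B OB nB] := label_normal_form okxx Ox.
have [B' OB' nB'] := label_normal_form okyy Oy.
have [s3 sn] : (3 <= n - 3)%N /\ (n - 3 <= n - 3)%N by lia.
have := corner_rel_invariants (over_corner_rel s3 sn OB OB').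
move: (corner B) (corner B') nB nB' => b b' /=.
case: x okxx {Ox} => [[[[a|[a1 a2]]|[[a1 a2] a3]]|[[a1 a2] a3]]|[[a1 a2] a3]] /=;
case: y okyy {Oy} => [[[[a'|[a1' a2']]|[[a1' a2'] a3']]|[[a1' a2'] a3']]|[[a1' a2'] a3']] /=.
all: rewrite /nz3 /= => nz nz' H H' [E0 E1 E2].
all: repeat match goal with h : is_true (_ && _) |- _ => case/andP: h => ? ? end.
all: repeat match goal with h : is_true (_ != 0) |- _ => move/eqP: h => h end.
all: repeat match goal with h : _ /\ _ |- _ => case: h => ? ? end.
all: repeat match goal with h : [/\ _, _ & _] |- _ => case: h => ? ? ? end.
all: repeat match goal with h : [/\ _, _, _ & _] |- _ => case: h => ? ? ? ? end.
all: try case: (E1 ltac:(assumption)) => ? ?.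
all: try solve [exfalso; congruence].
all: try case: (E2 ltac:(assumption)) => h3 h4 h5.
- by congruence.
- by congruence.
- have nz : b 1%N 0%N != 0 by apply/eqP; congruence.
  by case: (h3 _ _ _ _ nz) => // ? ?; congruence.
- have nz : b 0%N 1%N != 0 by apply/eqP; congruence.
  by case: (h4 _ _ _ _ nz) => // ? ?; congruence.
by case: h5 => // ? ? ?; congruence.
Qed.

End Index.

Lemma card_unique_label (I X : finType) (D : {set I}) (ok : pred X) (P : X -> pred I) :
    (forall i, i \in D -> exists2 x, ok x & P x i) ->
    (forall i x y, ok x -> ok y -> P x i -> P y i -> x = y) ->
  #|D| = (\sum_(x | ok x) #|[set i in D | P x i]|)%N.
Proof.
move=> ex uni; rewrite -sum1_card.
under [RHS]eq_bigr => x _.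
  rewrite -sum1_card (eq_bigl (fun i => (i \in D) && P x i)); last by move=> i; rewrite inE.
  over.
rewrite (exchange_big_dep (mem D)) /= => [|x i _ /andP[] //].
apply: eq_bigr => i Di; have [x label_ok Pxi] := ex i Di.
rewrite (big_pred1 x) // => y; rewrite Di /=.
by apply/idP/eqP => [/andP[oky Pyi]|->]; [apply: (uni i) | rewrite label_ok].
Qed.

Section CountCorner.

Variables (F : finFieldType) (p : nat) (d : corner_datum F p).
Local Notation n := p.+1.
Local Notation GL := (GLt F p).
Local Notation U := (unitri F n : {group GL}).
Local Notation q := #|F|.
Local Notation k := (csize d).
Local Notation s := (cstart d).
Local Notation T := (@stabT F p s (cB d)).

Lemma num_irrE m e : num_irr F m.+1 e =
  #|[set i : Iirr (unitri F m.+1 : {group GLt F m}) | 'chi_i 1%g == (q ^ e)%:R]|.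
Proof. by []. Qed.

(** For a degree that forces sigma in A and the degree q^e of beta, the
    parametrisation by Irr S x Irr K becomes a product count. *)
Lemma count_corner (A : {set Iirr (cS d)}) m e D x : n = (k + k + m.+1)%N -> #|U : T| = (q ^ x)%N ->
  (forall (c : Iirr (cS d)) (b : Iirr (cK d)),
     (#|U : T|%:R * ('chi_c 1%g * 'chi_b 1%g) == (q ^ D)%:R)
       = (c \in A) && ('chi_b 1%g == (q ^ e)%:R)) ->
  #|[set i in [set i : Iirr U | 'chi_i 1%g == (q ^ D)%:R] | over_datum d i]| = (#|A| * num_irr F m.+1 e)%N.
Proof.
move=> Dn Ix H; have [Theta [inj cod Th1 _ _]] := corner_param d.
rewrite num_irrE (card_irr_isog _ (isog_K Dn)) -cardsX -(card_imset _ inj).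
apply: eq_card => i; rewrite !inE; apply/andP/imsetP => [[di]|[x' + ->]].
  rewrite /over_datum -cod => /codomP[x' Dx']; exists x' => //.
  by move: di; rewrite Dx' Th1 H inE => /andP[? ?]; rewrite !inE; apply/andP.
rewrite !inE Th1 => Hx; rewrite H Hx; split=> //.
by rewrite /over_datum -cod; apply: codom_f.
Qed.

Lemma natq_neq0 a : (q ^ a)%:R != 0 :> algC.
Proof. by rewrite pnatr_eq0 -lt0n expn_gt0 (ltn_trans _ (card_F_gt1 F)). Qed.

(** The numerical data of a corner whose group S is abelian: K is U_(m+1), S has
    order q^l and T has index q^x. *)
Definition abelian_corner m l x :=
  [/\ n = (k + k + m.+1)%N, #|cS d| = (q ^ l)%N, abelian (cS d) & #|U : T| = (q ^ x)%N].

Lemma abelian_cornerP m l x : n = (k + k + m.+1)%N -> #|cS d| = (q ^ l)%N ->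
    (forall i j r : 'I_n, Sp d i j -> Sp d j r -> False) ->
    'C(n, 2) = (s * (n - s) + (l + ('C(m.+1, 2) + x)))%N ->
  abelian_corner m l x.
Proof.
by move=> Dn cardS nochain C2; split=> //; [apply: S_abelian|apply: index_T Dn cardS C2].
Qed.

Lemma abelian_corner_deg m l x e (c : Iirr (cS d)) (b : Iirr (cK d)) :
    abelian_corner m l x ->
  (#|U : T|%:R * ('chi_c 1%g * 'chi_b 1%g) == (q ^ (x + e))%:R) = ('chi_b 1%g == (q ^ e)%:R).
Proof.
case=> _ _ abS ->; rewrite expnD natrM.
have -> : 'chi_c 1%g = 1 by apply: lin_char1; apply/char_abelianP.
by rewrite mul1r (inj_eq (mulfI (natq_neq0 x))).
Qed.

Lemma count_abelian_corner m e x l : abelian_corner m l x ->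
  #|[set i in [set i : Iirr U | 'chi_i 1%g == (q ^ (x + e))%:R] | over_datum d i]|
    = (q ^ l * num_irr F m.+1 e)%N.
Proof.
move=> ac; have [Dn cardS abS Ix] := ac.
rewrite (@count_corner setT m e _ x) //.
  by rewrite cardsT card_ord -cardS NirrE; congr (_ * _)%N; apply/eqP; rewrite -card_classes_abelian.
by move=> c b; rewrite inE (abelian_corner_deg e c b ac).
Qed.

End CountCorner.

(** * Counting the characters of each type *)

Section CountTypes.

Variables (F : finFieldType) (p : nat).
Local Notation n := p.+1.
Local Notation GL := (GLt F p).
Local Notation U := (unitri F n : {group GL}).
Local Notation q := #|F|.
Local Notation r := (@ord_at p).
Hypothesis Hn : (7 <= n)%N.
Local Notation Deg := [set i : Iirr U | 'chi_i 1%g == (q ^ (mu n - 2))%:R].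

Lemma mu_step m : mu m.+2 = (mu m + m)%N.
Proof.
have := odd_double_half m; rewrite /mu /= negbK -muln2.
by case: (odd m) => /=; case: (m./2) => [|h] /=; nia.
Qed.

Lemma cperm_datum w x small pw : cperm (@perm_datum F p w x small pw) = nth_perm w.
Proof. by case: (perm_datumE x small pw). Qed.

Lemma Sp_datum w x small pw (i j : 'I_n) : Sp (@perm_datum F p w x small pw) i j
  = [&& i < j, j < size w & nth_perm w i < nth_perm w j]%N.
Proof. by rewrite /Sp csize_datum cperm_datum. Qed.

Lemma card_Sp w x small pw (l : seq ('I_n * 'I_n)) : uniq l ->
  (forall ij, Sp (@perm_datum F p w x small pw) ij.1 ij.2 = (ij \in l)) ->
  #|cS (@perm_datum F p w x small pw)| = (q ^ size l)%N.
Proof.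
move=> ul Hl; rewrite card_S; congr (_ ^ _)%N; rewrite -(card_uniqP ul).
by apply: eq_card => ij; rewrite !inE Hl.
Qed.

Let Ep : exists m, p = m.+4.+2. Proof. by exists (p - 6)%N; lia. Qed.

Lemma deg_exp_i : (mu n - 2 = (p - 1) + (mu (n - 2) - 2))%N.
Proof.
have -> : (n - 2 = (p - 2).+1)%N by lia.
have [-> h] : (mu n = mu (p - 2).+1 + (p - 1) /\ 3 <= mu (p - 2).+1)%N.
  by case: Ep => m ->; rewrite !subSS subn0; move: (mu_step m.+4.+1) (mu_step m.+3) (mu_step m.+1) => -> ->; lia.
by lia.
Qed.

Lemma deg_exp_ii : (mu n - 2 = (p + p - 5) + (mu (n - 4) - 1))%N.
Proof.
have -> : (n - 4 = (p - 4).+1)%N by lia.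
have [-> h] : (mu n = mu (p - 4).+1 + (p + p - 4) /\ 1 <= mu (p - 4).+1)%N.
  case: Ep => m Em; have -> : (p - 4 = m.+2)%N by lia.
  by rewrite {1}Em; move: (mu_step m.+4.+1) (mu_step m.+3) (mu_step m.+1) => -> -> ->; lia.
by move: h Hn; clear; lia.
Qed.

Lemma mu_step6 : (mu n = mu (n - 6) + (3 * p - 9))%N.
Proof.
have -> : (n - 6 = (p - 6).+1)%N by lia.
case: Ep => m Em; have -> : (p - 6 = m)%N by lia.
by rewrite {1}Em; move: (mu_step m.+4.+1) (mu_step m.+3) (mu_step m.+1) => -> -> ->; lia.
Qed.

Lemma deg_exp_iii : (mu n - 2 = (3 * p - 11) + mu (n - 6))%N.
Proof. by have := mu_step6; lia. Qed.

Lemma shape_i a : @abelian_corner F p (datum_i Hn a) (p - 2) 0 (p - 1).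
Proof.
apply: abelian_cornerP.
- by rewrite csize_datum /=; lia.
- by apply: (@card_Sp _ _ _ _ [::]) => // -[i j]; rewrite Sp_datum in_nil /=; lia.
- by move=> i j l; rewrite Sp_datum /=; lia.
rewrite cstart_datum /=; have := twice_bin2 n; have := twice_bin2 (p - 2).+1.
by case: Ep => m ->; rewrite !subSS !subn0; nia.
Qed.

Lemma shape_ii a b : @abelian_corner F p (datum_ii Hn a b) (p - 4) 1 (p + p - 5).
Proof.
apply: abelian_cornerP.
- by rewrite csize_datum /=; lia.
- apply: (@card_Sp _ _ _ _ [:: (r 0, r 1)]) => // -[i j]; rewrite Sp_datum inE xpair_eqE -!val_eqE /= !ord_atE; try lia.
  by case: i j => [[|[|i]] ?] [[|[|j]] ?]; rewrite /nth_perm /= ?nth_nil; lia.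
- by move=> i j l; rewrite !Sp_datum /=; lia.
rewrite cstart_datum /=; have := twice_bin2 n; have := twice_bin2 (p - 4).+1.
have -> : (n - (n - 2) = 2)%N by lia.
have -> : (p + p - 5 = (p - 2) + (p - 3))%N by lia.
by case: Ep => m ->; rewrite !subSS !subn0; nia.
Qed.

Lemma bin2_split l x : (x + l + 9 = 3 * p)%N ->
 ('C(n, 2) = ((n - 3) * (n - (n - 3)) + (l + ('C((p - 6).+1, 2) + x))))%N.
Proof.
have := twice_bin2 n; have := twice_bin2 (p - 6).+1.
have -> : (n - (n - 3) = 3)%N by lia.
by case: Ep => m ->; rewrite !subSS !subn0; nia.
Qed.

Lemma shape_iii a b c : @abelian_corner F p (datum_iii Hn a b c) (p - 6) 2 (3 * p - 11).
Proof.
apply: abelian_cornerP.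
- by rewrite csize_datum /=; lia.
- apply: (@card_Sp _ _ _ _ [:: (r 0, r 2); (r 1, r 2)]) => [|[i j]].
    by rewrite /= inE xpair_eqE -!val_eqE /= !ord_atE; lia.
  rewrite Sp_datum !inE !xpair_eqE -!val_eqE /= !ord_atE; try lia.
  by case: i j => [[|[|[|i]]] ?] [[|[|[|j]]] ?]; rewrite /nth_perm /= ?nth_nil; lia.
- by move=> i j l; rewrite !Sp_datum /=; case: i j l => [[|[|[|i]]] ?] [[|[|[|j]]] ?] [[|[|[|l]]] ?] /=; rewrite /nth_perm /= ?nth_nil; lia.
by rewrite cstart_datum; apply: bin2_split; lia.
Qed.

Lemma shape_iv a b c : @abelian_corner F p (datum_iv Hn a b c) (p - 6) 2 (3 * p - 11).
Proof.
apply: abelian_cornerP.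
- by rewrite csize_datum /=; lia.
- apply: (@card_Sp _ _ _ _ [:: (r 0, r 1); (r 0, r 2)]) => [|[i j]].
    by rewrite /= inE xpair_eqE -!val_eqE /= !ord_atE; lia.
  rewrite Sp_datum !inE !xpair_eqE -!val_eqE /= !ord_atE; try lia.
  by case: i j => [[|[|[|i]]] ?] [[|[|[|j]]] ?]; rewrite /nth_perm /= ?nth_nil; lia.
- by move=> i j l; rewrite !Sp_datum /=; case: i j l => [[|[|[|i]]] ?] [[|[|[|j]]] ?] [[|[|[|l]]] ?] /=; rewrite /nth_perm /= ?nth_nil; lia.
by rewrite cstart_datum; apply: bin2_split; lia.
Qed.

Lemma count_i a : #|[set i in Deg | over_datum (datum_i Hn a) i]| = num_irr F (n - 2) (mu (n - 2) - 2).
Proof.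
rewrite {1}deg_exp_i (count_abelian_corner _ (shape_i a)) mul1n.
by have -> : (n - 2 = (p - 2).+1)%N by lia.
Qed.

Lemma count_ii a b : #|[set i in Deg | over_datum (datum_ii Hn a b) i]|
  = (q * num_irr F (n - 4) (mu (n - 4) - 1))%N.
Proof.
rewrite {1}deg_exp_ii (count_abelian_corner _ (shape_ii a b)) expn1.
by have -> : (n - 4 = (p - 4).+1)%N by lia.
Qed.

Lemma count_iii a b c : #|[set i in Deg | over_datum (datum_iii Hn a b c) i]|
  = (q ^ 2 * num_irr F (n - 6) (mu (n - 6)))%N.
Proof.
rewrite {1}deg_exp_iii (count_abelian_corner _ (shape_iii a b c)).
by have -> : (n - 6 = (p - 6).+1)%N by lia.
Qed.

Lemma count_iv a b c : #|[set i in Deg | over_datum (datum_iv Hn a b c) i]|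
  = (q ^ 2 * num_irr F (n - 6) (mu (n - 6)))%N.
Proof.
rewrite {1}deg_exp_iii (count_abelian_corner _ (shape_iv a b c)).
by have -> : (n - 6 = (p - 6).+1)%N by lia.
Qed.

End CountTypes.

(** * The fifth type and the group U_3 *)

Section TopUnitriangular.

Variables (F : finFieldType) (p m : nat) (d : corner_datum F p).
Local Notation n := p.+1.
Hypotheses (ckE : csize d = m.+1) (pi_id : forall i, (i < csize d)%N -> cperm d i = i).

Let cmn : (0 + m.+1 <= n)%N. Proof. by have := csize_small d; rewrite ckE; lia. Qed.

Let ctE : ctop d = diag_proj F p (fun i => 0 <= i < 0 + m.+1)%N.
Proof. by apply: eqD => i _; rewrite ckE. Qed.

Let J (A : 'M[F]_m.+1) : 'M[F]_n := cdouble d (embed p 0 A).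

Let J1_top (A : 'M[F]_m.+1) : ctop d * embed p 0 A * ctop d = embed p 0 A.
Proof. by rewrite ctE; apply: embed_fix. Qed.

Let JD a b : J (a + b) = J a + J b.
Proof. by rewrite /J (@embedD F m p 0) /cdouble mulrDr mulrDl addrACA. Qed.

Let JM a b : J (a * b) = J a * J b.
Proof. by rewrite /J cdoubleM ?J1_top // (embedM cmn). Qed.

Let J_inj : injective J.
Proof.
move=> a b; have [_ _ _ E] := cdouble_comm (J1_top a); have [_ _ _ E'] := cdouble_comm (J1_top b).
by rewrite /J => Eab; apply: (embed_inj cmn); rewrite -E -E' Eab.
Qed.

Let Sp_lt (X : 'M[F]_n) : ctop d * X * ctop d = X -> supp (@ltord p) X -> supp (Sp d) X.
Proof.
move=> Xt /suppP sX; apply/suppP=> i j; rewrite /Sp => nS.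
have [jk|kj] := ltnP j (csize d); last by rewrite -Xt mulDr ltnNge kj mulr0.
have [ij|ji] := ltnP i j; last by rewrite sX // /ltord -leqNgt.
by case/negP: nS; rewrite ij jk !pi_id //; apply: ltn_trans jk.
Qed.

(** For the identity permutation Sp is the whole strict upper triangle, and S is the
    full unitriangular group on the first k coordinates. *)
Lemma isog_S : (unitri F m.+1 : {group GLt F m}) \isog cS d.
Proof.
apply: (isog_J JD JM J_inj) => [x Ux | h].
  have sX : supp (Sp d) (embed p 0 (mx x - 1)).
    by apply: Sp_lt => //; apply: supp_embed; apply: supp_U.
  by have [Sx _] := cdouble_S sX.
case/S_cdouble=> X sX Dh.
have sX' : supp (@ltord p) X by apply/suppP=> i j nij; apply: (suppP _ _ sX); apply: contra nij => /and3P[].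
pose A := shiftM F m p 0 *m X *m (shiftM F m p 0)^T.
have sA : supp (@ltord m) A by apply: supp_extract.
have [UA DA] := mkGL_U sA; exists (mkGL (1 + A)) => //.
by rewrite DA (addrC 1 A) addrK /J embed_extract // -ctE Sp_top.
Qed.

End TopUnitriangular.

Lemma cscal_datum (F : finFieldType) p w x small pw : cscal (@perm_datum F p w x small pw) = nth_scal x.
Proof. by case: (perm_datumE x small pw). Qed.

Section Heisenberg.

Variable F : finFieldType.
Local Notation U := (unitri F 3 : {group GLt F 2}).
Local Notation q := #|F|.
Local Notation dl := (@delta_mx F 3 3).

Let small : (size [:: 0%N] + size [:: 0%N] <= 3)%N. Proof. by []. Qed.
Let d (a : F) : corner_datum F 2 := @perm_datum F 2 [:: 0%N] [:: a] small isT.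

Lemma num_irr_1 : num_irr F 1 0 = 1%N.
Proof.
rewrite num_irrE.
have cU := card_U F 0; rewrite bin_small // expn0 in cU.
have abU : abelian (unitri F 1 : {group GLt F 0}) by rewrite (card1_trivg cU) abelian1.
rewrite -[RHS]cU; transitivity #|[set: Iirr (unitri F 1 : {group GLt F 0})]|.
  by apply: eq_card => i; rewrite !inE expn0 lin_char1 ?eqxx //; apply/char_abelianP.
by rewrite cardsT card_ord NirrE; apply/eqP; rewrite -card_classes_abelian.
Qed.

Lemma count_3 a : a != 0 ->
  #|[set i in [set i : Iirr U | 'chi_i 1%g == (q ^ 1)%:R] | over_datum (d a) i]| = 1%N.
Proof.
move=> nz; rewrite (@count_abelian_corner F 2 _ 0 0 1 0) ?mul1n ?num_irr_1 //.
apply: abelian_cornerP.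
- by rewrite csize_datum.
- by apply: (@card_Sp _ _ _ _ _ _ [::]) => // -[i j]; rewrite Sp_datum in_nil /=; lia.
- by move=> i j l; rewrite Sp_datum /=; lia.
by rewrite cstart_datum.
Qed.

Let r := @ord_at 2.
Let c := @ord_from_end 2.

(** A character that lies over a functional with zero corner entry is linear,
    by family_bound with the single matrix at (r0, r1). *)
Lemma U3_classify (i : Iirr U) : i \in [set i : Iirr U | 'chi_i 1%g == (q ^ 1)%:R] ->
  exists2 a, a != 0 & over_datum (d a) i.
Proof.
rewrite inE => /eqP deg; have [B lB Oi] := over_exists 2 i.
have r0 : r 0 = 0%N :> nat by rewrite ord_atE.
have c0 : c 0 = 2%N :> nat by rewrite ord_from_endE.
have r1 : r 1 = 1%N :> nat by rewrite ord_atE.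
have [z|nz] := eqVneq (B (c 0) (r 0)) 0; last first.
  exists (B (c 0) (r 0)); first exact: nz.
  apply: (over_perm_datum _ _ Oi); [by []|by []|].
  by case=> [|j] [|l] //= _ _; rewrite /nth_scal /= nzFE.
have [eB Be] := lowP _ _ lB.
have Bl : dl (r 0) (r 1) * B = 0.
  rewrite -eB mulrA dl_e r1 scale0r mul0r //.
have lB' : B * dl (r 0) (r 1) = 0.
  apply/matrixP=> k l; rewrite Bdl_entry mxE.
  have [csize|csize] := ltnP k 2.
    by rewrite -eB mulEl leqNgt csize mul0r mul0r.
  have -> : k = c 0 by apply: val_inj; rewrite /= c0; case: k csize => [[|[|[|k]]] ?].
  by rewrite z mul0r.
have e1 : tail_proj F 2 2 * dl (r 0) (r 1) = 0 by rewrite e_dl r0 scale0r.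
have e2 : dl (r 0) (r 1) * tail_proj F 2 2 = 0 by rewrite dl_e r1 scale0r.
have : 'chi_i 1%g * (q ^ 1)%:R <= #|U : Yblock F 2 2|%:R.
  apply: (@family_bound F 2 2 1 B (fun=> dl (r 0) (r 1)) lB) => // [k|k|k|k l|v].
  - apply/suppP=> a b nab; rewrite mxE; case: (a =P r 0) => [Ea|] //=; case: (b =P r 1) => [Eb|] //=.
    by case/negP: nab; rewrite /ltord Ea Eb r0 r1.
  - by rewrite e1 e2.
  - by rewrite Bl lB'.
  - by rewrite dl_mul0 // -val_eqE /= r0 r1.
  rewrite big_ord1 => /matrixP/(_ (r 0) (r 1)); rewrite !mxE !eqxx mulr1 => v0.
  by apply/rowP=> k; rewrite ord1 v0 mxE.
  rewrite (index_Y F (or_intror (erefl _)) : #|U : Yblock F 2 2| = _) deg -natrM ler_nat -expnD.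
by rewrite leq_exp2l ?card_F_gt1.
Qed.

Lemma U3_uniq (i : Iirr U) a a' : a != 0 -> a' != 0 ->
  over_datum (d a) i -> over_datum (d a') i -> a = a'.
Proof.
move=> nz nz' O O'; have cE x : cstart (d x) = 2 by rewrite cstart_datum.
have [u Uu E] := over_uniq O O'.
have r0 : r 0 = 0%N :> nat by rewrite ord_atE.
have c0 : c 0 = 2%N :> nat by rewrite ord_from_endE.
have BE x : x != 0 -> cB (d x) (c 0) (r 0) = x.
  by move=> nzx; rewrite mxE cE csize_datum cperm_datum cscal_datum c0 r0 /= /nth_scal /= nzFE.
have := E (c 0) (r 0); rewrite !cE c0 r0 => /(_ isT isT).
rewrite conjM_corner // !big_ord_recr !big_ord0 /= !U_diag ?groupV // !add0r mul1r mulr1.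
by rewrite !BE.
Qed.

Lemma card_neq0 : (\sum_(a : F | a != 0%R) 1 = q - 1)%N.
Proof.
rewrite sum1_card; have := cardC (pred1 (0 : F)); rewrite card1 => <-.
by rewrite addKn; apply: eq_card => x; rewrite !inE.
Qed.

(** The characters of degree q of the Heisenberg group are determined by their
    nontrivial central characters. *)
Lemma num_irr_3 : num_irr F 3 1 = (q - 1)%N.
Proof.
rewrite num_irrE (card_unique_label U3_classify); last exact: U3_uniq.
rewrite (eq_bigr (fun=> 1%N)) => [|a nz]; last exact: count_3.
exact: card_neq0.
Qed.

End Heisenberg.

Section CountFive.

Variables (F : finFieldType) (p : nat).
Local Notation n := p.+1.
Local Notation GL := (GLt F p).
Local Notation U := (unitri F n : {group GL}).
Local Notation q := #|F|.
Hypothesis Hn : (7 <= n)%N.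
Local Notation Deg := [set i : Iirr U | 'chi_i 1%g == (q ^ (mu n - 2))%:R].

Lemma irr_bound_isog m (H : {group GL}) (i : Iirr H) :
  (unitri F m.+1 : {group GLt F m}) \isog H -> 'chi_i 1%g <= (q ^ mu m.+1)%:R.
Proof.
by case/isog_irr=> g [h _ hK] g1; rewrite -(hK i) g1; apply: irr_bound.
Qed.

Lemma mul_extremal (a b x y : algC) : 0 < a -> 0 < b -> a <= x -> b <= y ->
  (a * b == x * y) = (a == x) && (b == y).
Proof.
move=> a0 b0 ax By; apply/eqP/andP => [E|[/eqP-> /eqP->]] //.
have x0 := Order.POrderTheory.lt_le_trans a0 ax; have y0 := Order.POrderTheory.lt_le_trans b0 By.
have ab : a * b <= a * y by rewrite ler_pM2l.
have ay : a * y <= x * y by rewrite ler_pM2r.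
have E1 : a * y = x * y by apply/eqP; rewrite Order.POrderTheory.eq_le ay -E ab.
have E2 : a = x by apply: (mulIf (lt0r_neq0 y0)).
split; first by rewrite E2.
by apply/eqP/(mulfI (lt0r_neq0 a0)); rewrite E E2.
Qed.

Section Five.
Variables (a b c : F).
Local Notation d := (datum_v Hn a b c).

Lemma isog_S_v : (unitri F 3 : {group GLt F 2}) \isog cS d.
Proof.
have k3 : csize d = 3 by rewrite csize_datum.
by apply: (isog_S k3) => i; rewrite csize_datum cperm_datum; case: i => [|[|[|i]]].
Qed.

Lemma size_v : n = (csize d + csize d + (n - 6))%N.
Proof. by rewrite csize_datum /=; lia. Qed.

Lemma index_T_v : #|U : stabT (cstart d) (cB d)| = (q ^ (3 * p - 12))%N.
Proof.
have Dn : n = (csize d + csize d + (p - 6).+1)%N by have := size_v; lia.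
apply: (@index_T _ _ _ _ 3 _ Dn); first by rewrite -(card_isog isog_S_v) card_U.
by rewrite cstart_datum; apply: bin2_split => //; lia.
Qed.

(** The degrees of sigma in Irr U_3 and of beta in Irr K are bounded by q and
    q^mu(n-6), and the required degree is the product of these bounds. *)
Lemma deg_v (x : Iirr (cS d)) (y : Iirr (cK d)) :
  (#|U : stabT (cstart d) (cB d)|%:R * ('chi_x 1%g * 'chi_y 1%g) == (q ^ (mu n - 2))%:R)
    = ('chi_x 1%g == (q ^ 1)%:R) && ('chi_y 1%g == (q ^ mu (n - 6))%:R).
Proof.
have En : (n - 6 = (p - 6).+1)%N by lia.
have Dn : n = (csize d + csize d + (p - 6).+1)%N by have := size_v; lia.
rewrite index_T_v; have -> : (mu n - 2 = (3 * p - 12) + (1 + mu (n - 6)))%N by have := mu_step6 Hn; lia.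
rewrite expnD natrM (inj_eq (mulfI (natq_neq0 F _))) expnD natrM En.
rewrite mul_extremal ?irr1_gt0 //; first exact: (irr_bound_isog _ isog_S_v).
exact: irr_bound_isog (isog_K Dn).
Qed.

Lemma count_v : #|[set i in Deg | over_datum d i]|
  = ((q - 1) * num_irr F (n - 6) (mu (n - 6)))%N.
Proof.
have Dn : n = (csize d + csize d + (p - 6).+1)%N by have := size_v; lia.
rewrite (@count_corner F p _ [set i | 'chi_i 1%g == (q ^ 1)%:R] _ (mu (n - 6)) _ _ Dn index_T_v).
  rewrite -(card_irr_isog _ isog_S_v) -num_irrE num_irr_3.
  by have -> : (n - 6 = (p - 6).+1)%N by lia.
by move=> x y; rewrite inE deg_v.
Qed.

End Five.

End CountFive.

(** * The total count *)

Section Total.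

Variables (F : finFieldType) (p : nat).
Local Notation n := p.+1.
Local Notation GL := (GLt F p).
Local Notation U := (unitri F n : {group GL}).
Local Notation q := #|F|.
Hypothesis Hn : (7 <= n)%N.
Local Notation Deg := [set i : Iirr U | 'chi_i 1%g == (q ^ (mu n - 2))%:R].

Lemma label_exists (i : Iirr U) : i \in Deg ->
  exists2 x : label F, label_ok x & over_datum (datum_of Hn x) i.
Proof.
rewrite inE => /eqP /(classification Hn).
case=> [[[a nz O]|[a [b [nz1 nz2 O]]]|[a [b [c [[nz1 nz2 nz3'] O]]]]|[a [b [c [[nz1 nz2 nz3'] O]]]]]|
        [a [b [c [[nz1 nz2 nz3'] O]]]]].
- by exists (inl (inl (inl (inl a)))).
- by exists (inl (inl (inl (inr (a, b))))); rewrite //= nz1.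
- by exists (inl (inl (inr (a, b, c)))); rewrite // /= /nz3 /= nz1 nz2.
- by exists (inl (inr (a, b, c))); rewrite // /= /nz3 /= nz1 nz2.
by exists (inr (a, b, c)); rewrite // /= /nz3 /= nz1 nz2.
Qed.

Lemma sum_const_nat (I : finType) (P : pred I) (G : I -> nat) m :
  (forall x, P x -> G x = m) -> (\sum_(x | P x) G x = (\sum_(x | P x) 1) * m)%N.
Proof. by move=> H; rewrite big_distrl; apply: eq_bigr => x /H ->; rewrite /= mul1n. Qed.

Lemma card_nz2 : (\sum_(v : F * F | (v.1 != 0%R) && (v.2 != 0%R)) 1 = (q - 1) ^ 2)%N.
Proof.
rewrite -(pair_big_dep (fun a : F => a != 0) (fun _ b => b != 0) (fun _ _ => 1%N)) /=.
rewrite (sum_const_nat (m := (q - 1)%N)) => [|a _]; last exact: card_neq0.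
by rewrite card_neq0 mulnn.
Qed.

Lemma card_nz3 : (\sum_(v : F * F * F | nz3 v) 1 = (q - 1) ^ 3)%N.
Proof.
rewrite (eq_bigl (fun v : F * F * F => ((v.1.1 != 0) && (v.1.2 != 0)) && (v.2 != 0))); last first.
  by move=> v; rewrite /nz3 andbA.
rewrite -(pair_big_dep (fun v : F * F => (v.1 != 0) && (v.2 != 0)) (fun _ b => b != 0) (fun _ _ => 1%N)) /=.
rewrite (sum_const_nat (m := (q - 1)%N)) => [|a _]; last exact: card_neq0.
by rewrite card_nz2 -expnSr.
Qed.

(** One summand for each type: the number of admissible scalars times the number
    of characters over a corner of that type. The sum of the last three is
    (2 q^2 + q - 1)(q - 1)^3 N_(n-6,mu(n-6)). *)
Theorem num_irr_third : num_irr F n (mu n - 2) =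
  ((q - 1) * num_irr F (n - 2) (mu (n - 2) - 2)
   + (q - 1) ^ 2 * (q * num_irr F (n - 4) (mu (n - 4) - 1))
   + (q - 1) ^ 3 * (q ^ 2 * num_irr F (n - 6) (mu (n - 6)))
   + (q - 1) ^ 3 * (q ^ 2 * num_irr F (n - 6) (mu (n - 6)))
   + (q - 1) ^ 3 * ((q - 1) * num_irr F (n - 6) (mu (n - 6))))%N.
Proof.
rewrite num_irrE (card_unique_label (@label_exists) (fun i => @label_uniq F p Hn i)).
rewrite !big_sumType /=; congr (_ + _ + _ + _ + _)%N.
- by rewrite -[X in (X * _)%N]card_neq0; apply: sum_const_nat => a _; apply: count_i.
- by rewrite -card_nz2; apply: sum_const_nat => v _; apply: count_ii.
- by rewrite -card_nz3; apply: sum_const_nat => v _; apply: count_iii.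
- by rewrite -card_nz3; apply: sum_const_nat => v _; apply: count_iv.
rewrite -card_nz3; apply: sum_const_nat => v _; apply: count_v.
Qed.

End Total.

(** * Elementary characters *)

Section Arm.

Variables (F : finFieldType) (p : nat) (i j : 'I_p.+1).
Local Notation n := p.+1.
Local Notation GL := (GLt F p).
Local Notation U := (unitri F n : {group GL}).
Hypothesis lt_ij : (i < j)%N.

(** V_alpha for the root of position (i, j). *)
Definition armV : {group GL} := Valpha F n i.+1 j.
Local Notation V := armV.

Let Wset : {set GL} := [set g in U | [forall c : 'I_n, (i < c < j)%N ==> (mx g i c == 0)]].

Let WP g : reflect (g \in U /\ forall c : 'I_n, (i < c < j)%N -> mx g i c = 0) (g \in Wset).
Proof.
apply: (iffP setIdP) => -[Ug H]; split=> //.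
  by move=> c ic; apply/eqP; apply: (implyP (forallP H c)).
by apply/forallP=> c; apply/implyP=> /H ->.
Qed.

Let mulW (g h : GL) (c : 'I_n) : g \in Wset -> h \in U -> (i < c <= j)%N ->
  mx (g * h)%g i c = mx h i c + (c == j)%:R * mx g i j.
Proof.
case/WP=> /UP Ug Wg /UP Uh /andP[ic cj]; rewrite mxM mulmxEij (bigD1 i) //= Ug // eqxx mul1r.
congr (_ + _); have [->|ncj] := eqVneq c j.
  rewrite mul1r (bigD1 j) /=; last by rewrite -val_eqE gtn_eqF.
  rewrite Uh // eqxx mulr1 big1 ?addr0 // => k /andP[ki kj].
  case: (ltngtP k i) => [ki'|ik|/val_inj E]; last by rewrite E eqxx in ki.
    by rewrite Ug 1?ltnW // eq_sym (negbTE ki) mul0r.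
  case: (ltngtP k j) => [kj'|jk|/val_inj E]; last by rewrite E eqxx in kj.
    by rewrite Wg ?ik // mul0r.
  by rewrite Uh 1?ltnW // (negbTE kj) mulr0.
rewrite mul0r big1 // => k ki; have cj' : (c < j)%N by rewrite ltn_neqAle ncj.
case: (ltngtP k i) => [ki'|ik|/val_inj E]; last by rewrite E eqxx in ki.
  by rewrite Ug 1?ltnW // eq_sym (negbTE ki) mul0r.
have [kj|jk] := ltnP k j; first by rewrite Wg ?ik // mul0r.
by rewrite Uh; [rewrite -val_eqE gtn_eqF ?mulr0 //|]; [apply: leq_trans jk|apply: ltnW; apply: leq_trans jk].
Qed.

Let W_group_set : group_set Wset.
Proof.
apply/group_setP; split=> [|g h Wg Wh].
  apply/WP; split=> // c /andP[ic _]; rewrite mx1 mxE.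
  by rewrite -val_eqE ltn_eqF.
have [Ug _] := WP _ Wg; have [Uh h0] := WP _ Wh.
apply/WP; split=> [|c /andP[ic cj]]; first exact: groupM.
rewrite mulW ?ic 1?ltnW // h0 ?ic // add0r -val_eqE ltn_eqF // mul0r //.
Qed.
Let W := Group W_group_set.

(** Row i of a product combines row i of the first factor with the rows i and those
    from j on of the second one, which do not reach the arm. *)
Lemma armV_entry g : g \in V -> g \in U /\ forall c : 'I_n, (i < c < j)%N -> mx g i c = 0.
Proof.
move=> Vg; apply/WP; suff sVW : V \subset W by apply: (subsetP sVW).
apply: Xgen_sub => s t st tn nP; apply/subsetP=> g' Xg; apply/WP; split.
  by apply: (subsetP (X_sub_unitri F st tn)).
move=> c /andP[ic cj]; have [x ->] := Xroot_entry st tn Xg.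
rewrite -val_eqE ltn_eqF //= add0r; case: andP => [[/eqP Ei /eqP Ec]|_]; last by rewrite mulr0.
by case/negP: nP; rewrite /in_arm -Ei -Ec eqxx /= ic cj.
Qed.

(** In row i there is nothing strictly between the diagonal and column j, so the
    entry (i, j) of a product is the sum of those of the factors. *)
Lemma armV_mul : {in V &, forall g h, mx (g * h)%g i j = mx g i j + mx h i j}.
Proof.
move=> g h Vg Vh; rewrite mulW ?lt_ij ?leqnn //; first by rewrite eqxx mul1r addrC.
  by apply/WP; apply: armV_entry.
by case: (armV_entry Vh).
Qed.

Lemma Xroot_sub_armV : Xroot F n i.+1 j \subset V.
Proof.
apply: X_sub_Xgen; [by rewrite /=|exact: ltn_ord|].
by rewrite /in_arm eqxx /= ltnn andbF.
Qed.

Lemma elementary_lin_ex (a : F) : a != 0 ->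
  exists lambda : 'CF(V), [/\ elementary_lin (lambda : 'CF(Valpha F n i.+1 j)),
     lambda \is a linear_char & {in V, forall g, lambda g = psi (a * mx g i j)}].
Proof.
move=> nz; have [|lambda lin E] := @additive_lin_char F _ V (fun g => a * mx g i j).
  by move=> g h Vg Vh; rewrite armV_mul // mulrDr.
exists lambda; split=> //; split=> //.
  have /existsP[x nx] : [exists x, psi (x * a) != 1].
    apply: contraT => /existsPn H; case/eqP: nz; apply: psi_faithful => x.
    by apply/eqP; rewrite -[_ == _]negbK H.
  have Xx := elt_Xroot x lt_ij; exists (elt x i j) => //.
  rewrite E; last exact: (subsetP Xroot_sub_armV).
  rewrite mx_elt // mxaddE !mxE !eqxx mulr1 -val_eqE ltn_eqF //= add0r mulrC //.
move=> s t st tn sXV ne x Xx; rewrite E; last exact: (subsetP sXV).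
have [y ->] := Xroot_entry st tn Xx.
rewrite -val_eqE ltn_eqF //= add0r.
case: andP => [[/eqP Es /eqP Et]|_]; last by rewrite !mulr0 psi0.
by case/eqP: ne; rewrite Es Et.
Qed.

Lemma elementary_Ind (lambda : 'CF(V)) : elementary_lin (lambda : 'CF(Valpha F n i.+1 j)) ->
  @elementary F n i.+1 j ('Ind[U] lambda).
Proof. by exists lambda. Qed.

End Arm.

Section CornerElementary.

Variables (F : finFieldType) (p : nat) (d : corner_datum F p).
Local Notation n := p.+1.
Local Notation Mn := 'M[F]_n.
Local Notation GL := (GLt F p).
Local Notation U := (unitri F n : {group GL}).
Local Notation k := (csize d).
Local Notation s := (cstart d).
Local Notation B := (cB d).
Local Notation T := (@stabT F p s B).
Local Notation r := (@ord_at p).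

Definition ccol j := @ord_from_end p (k - 1 - cperm d j).
Local Notation c := ccol.

Lemma crowE j : (j < k)%N -> r j = j :> nat.
Proof. by move=> jk; rewrite ord_atE //; have := csize_small d; lia. Qed.

Lemma ccolE j : (j < k)%N -> c j = (s + cperm d j)%N :> nat.
Proof.
by move=> jk; rewrite ord_from_endE /cstart; have := csize_small d; have := cperm_lt jk; lia.
Qed.

Lemma tr_cB (A : Mn) : \tr (B * A) = \sum_(j < k) cscal d j * A (r j) (c j).
Proof.
have kn : (k <= n)%N by have := csize_small d; lia.
rewrite (@big_ord_widen_cond _ _ _ k n xpredT (fun j => cscal d j * A (r j) (c j))) //=.
rewrite trC /mxtrace [LHS](bigID (fun j : 'I_n => j < k)%N) /= [X in _ + X]big1 => [|j jk]; last first.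
  by rewrite mulmxEij big1 // => l _; rewrite mxE (negbTE jk) mulr0.
rewrite addr0; apply: eq_bigr => j jk.
have -> : r j = j by apply: val_inj; rewrite /= crowE.
rewrite mulmxEij (bigD1 (c j)) //= big1 => [|l nl].
  by rewrite mxE jk ccolE // eqxx addr0 mulrC.
rewrite mxE jk /=; case: eqP => [E|]; last by rewrite mulr0.
by case/eqP: nl; apply: val_inj; rewrite /= ccolE.
Qed.

Lemma lt_row_col j : (j < k)%N -> (r j < c j)%N.
Proof. by move=> jk; rewrite crowE // ccolE //; have := k_le_s d; lia. Qed.

(** The group V_alpha of the root at the corner entry of row j. *)
Definition rowV j : {group GL} := armV F (r j) (c j).

(** The arms of the corner roots cover the upper left k by k corner. *)
Lemma rowV_top u : (forall j, (j < k)%N -> u \in rowV j) -> ctop d * mx u * ctop d = ctop d.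
Proof.
move=> Vu; apply/matrixP=> i j; rewrite mulDr mulDl mxE.
have [ik|ki] := ltnP i k; last by rewrite mul0r mul0r andbF.
have Er : r i = i by apply: val_inj; rewrite /= crowE.
have [Uu u0] := armV_entry (lt_row_col ik) (Vu _ ik); move/UP: Uu => Uu.
rewrite mul1r andbT; have [jk|kj] := ltnP j k; last first.
  by rewrite mulr0; case: eqP => // E; move: ik kj; rewrite E; lia.
rewrite mulr1; have [ij|ji] := ltnP i j; last exact: Uu.
have := u0 j; rewrite Er ij ccolE // => ->.
  by rewrite -val_eqE ltn_eqF.
by have := k_le_s d; move: jk; clear; lia.
Qed.

Lemma row_elementary j : (j < k)%N ->
  exists lambda : 'CF(rowV j), [/\ lambda \is a linear_char,
    @elementary F n j.+1 (s + cperm d j) ('Ind[U] lambda)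
   & forall u, u \in rowV j -> lambda u = psi (cscal d j * mx u (r j) (c j))].
Proof.
move=> jk; have [lambda [el lin E]] := elementary_lin_ex (lt_row_col jk) (cscal_nz jk).
exists lambda; split=> //; have := elementary_Ind el.
by rewrite crowE // ccolE.
Qed.

(** What corner_param says about the factor of a character over the corner B that
    does not come from K. *)
Definition corner_induced (l : Iirr U) := exists (psi_ : 'CF(T)) (a : algC),
  [/\ psi_ \is a character, 'chi_l = 'Ind[U] psi_, a != 0 &
   forall u, u \in T -> ctop d * mx u * ctop d = ctop d -> psi_ u = a * psi (extfun s B u)].

Lemma over_datum_factor (i : Iirr U) : over_datum d i ->
  exists (c : Iirr (cS d)) (b : Iirr (cK d)) (l : Iirr U),
  [/\ 'chi_i = 'chi_l * inflate 'chi_b,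
     'chi_i 1%g = #|U : T|%:R * ('chi_c 1%g * 'chi_b 1%g),
     'chi_l 1%g = #|U : T|%:R * 'chi_c 1%g
   & corner_induced l].
Proof.
have [Theta [_ cod Th1 ThM ThI]] := corner_param d.
rewrite /over_datum -cod => /codomP[[c b] ->]; exists c, b, (Theta (c, 0)).
split; [exact: (ThM (c, b))|exact: (Th1 (c, b))|by rewrite Th1 /= irr0 cfun11 mulr1|].
have [psi_ [psi_char E H]] := ThI c; exists psi_, ('chi_c 1%g).
by split=> //; apply: irr1_neq0.
Qed.

Lemma rowV_sub j : (j < k)%N -> rowV j \subset U.
Proof. by move=> jk; apply/subsetP=> u /(armV_entry (lt_row_col jk))[]. Qed.

(** On the elements of T that lie in all the V_alpha of the corner, the linear
    extension of lam B is psi(tr(B u)), a product of one factor for each row: it is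
    the product of the linear characters that induce the elementary ones. *)
Lemma corner_constt1 l : k = 1%N -> corner_induced l ->
  exists2 lambda : 'CF(rowV 0), [/\ lambda \is a linear_char,
     @elementary F n 1 (s + cperm d 0) ('Ind[U] lambda) &
      forall u, u \in rowV 0 -> lambda u = psi (cscal d 0 * mx u (r 0) (c 0))]
  & l \in irr_constt ('Ind[U] lambda).
Proof.
move=> k1 [psi_ [a [psi_char E a0 H]]].
have lt0 : (0 < k)%N by rewrite k1.
have [lam [lin el E0]] := row_elementary lt0.
exists lam => //.
have := constt_prod3_Ind (TsubU s B) (rowV_sub lt0) (subxx U) (subxx U) psi_char lin
  (cfun1_lin_char U) (cfun1_lin_char U) E a0.
rewrite !cfInd_id !mulr1; apply=> u Tu V0 Uu _.
have top : ctop d * mx u * ctop d = ctop d by apply: rowV_top => -[|j] //; rewrite k1.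
rewrite H // extfun_top // tr_cB !cfun1E Uu !mulr1; congr (_ * _).
by rewrite k1 big_ord1 E0.
Qed.

Lemma corner_constt2 l : k = 2 -> corner_induced l -> exists t0 t1 : 'CF(U),
  [/\ @elementary F n 1 (s + cperm d 0) t0, @elementary F n 2 (s + cperm d 1) t1
    & l \in irr_constt (t0 * t1)].
Proof.
move=> k2 [psi_ [a [psi_char E a0 H]]].
have [lt0 lt1] : (0 < k)%N /\ (1 < k)%N by rewrite k2.
have [lam0 [lin0 el0 E0]] := row_elementary lt0.
have [lam1 [lin1 el1 E1]] := row_elementary lt1.
exists ('Ind[U] lam0), ('Ind[U] lam1); split=> //.
have := constt_prod3_Ind (TsubU s B) (rowV_sub lt0) (rowV_sub lt1) (subxx U) psi_char lin0 lin1
  (cfun1_lin_char U) E a0.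
rewrite cfInd_id mulr1; apply=> u Tu V0 V1 Uu.
have top : ctop d * mx u * ctop d = ctop d by apply: rowV_top => -[|[|j]] //; rewrite k2.
rewrite H // extfun_top // tr_cB !cfun1E Uu !mulr1; congr (_ * _).
by rewrite k2 !big_ord_recr big_ord0 /= add0r psiD E0 ?E1.
Qed.

Lemma corner_constt3 l : k = 3 -> corner_induced l -> exists t0 t1 t2 : 'CF(U),
  [/\ [/\ @elementary F n 1 (s + cperm d 0) t0, @elementary F n 2 (s + cperm d 1) t1
    & @elementary F n 3 (s + cperm d 2) t2] & l \in irr_constt (t0 * t1 * t2)].
Proof.
move=> k3 [psi_ [a [psi_char E a0 H]]].
have [lt0 lt1] : (0 < k)%N /\ (1 < k)%N by rewrite k3.
have lt2 : (2 < k)%N by rewrite k3.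
have [lam0 [lin0 el0 E0]] := row_elementary lt0.
have [lam1 [lin1 el1 E1]] := row_elementary lt1.
have [lam2 [lin2 el2 E2]] := row_elementary lt2.
exists ('Ind[U] lam0), ('Ind[U] lam1), ('Ind[U] lam2); split=> //.
apply: (constt_prod3_Ind (TsubU s B) (rowV_sub lt0) (rowV_sub lt1) (rowV_sub lt2) psi_char
  lin0 lin1 lin2 E a0) => u Tu V0 V1 V2.
have top : ctop d * mx u * ctop d = ctop d by apply: rowV_top => -[|[|[|j]]] //; rewrite k3.
rewrite H // extfun_top // tr_cB; congr (_ * _).
by rewrite k3 !big_ord_recr big_ord0 /= add0r !psiD E0 ?E1 ?E2.
Qed.

(** For k = 1 the inertia group is contained in V_alpha, so the elementary character
    has at most the degree of its constituent chi_l and equals it. Since the corner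
    entry is central in U, psi is visible on the centre. *)
Lemma corner_elementary l : k = 1%N -> corner_induced l -> #|U : T|%:R <= 'chi_l 1%g ->
  @elementary F n 1 (n - 1) 'chi_l /\ almost_faithful 'chi_l.
Proof.
move=> k1 il deg; have [lam [lin el E0] Cl] := corner_constt1 k1 il.
have lt0 : (0 < k)%N by rewrite k1.
have p0 : cperm d 0 = 0%N by have := cperm_lt lt0; rewrite k1; case: (cperm d 0).
have sE : s = p by rewrite /cstart k1 subn1.
have r0 : r 0 = 0%N :> nat by rewrite crowE.
have c0 : c 0 = p :> nat by rewrite ccolE // p0 addn0.
have TV : T \subset rowV 0.
  apply/subsetP=> u /(TP _ (c_low d))[Uu /matrixP E].
  have /UP Uu' := Uu.
  apply: in_Xgen => // i j ij nz; apply/negP=> /and3P[/eqP[Ei] ij' jc].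
  case/eqP: nz; have {E} := E (c 0) j; rewrite r0 in Ei; case: Ei => Ei.
  have -> : i = r 0 by apply: val_inj; rewrite /= r0.
  rewrite one_sub_e mulDr -mulrA mulEl c0 sE leqnn mul1r.
  have jp : (j < p)%N by move: jc; rewrite c0.
  have j0 : (0 < j)%N by rewrite -Ei.
  rewrite jp mulr1 mulmxEij (bigD1 (r 0)) //= big1 => [|m nm]; last first.
    rewrite mxE k1; case: ifP => [/andP[m0 _]|]; last by rewrite mul0r.
    by case/eqP: nm; apply: val_inj; rewrite /= r0; case: (nat_of_ord m) m0.
  rewrite addr0 mulmxEij big1 => [|m _]; last by rewrite mxE k1 ltnNge j0 mulr0.
  rewrite mxE r0 k1 c0 p0 sE addn0 eqxx /= => /eqP.
  by rewrite mulf_eq0 (negbTE (cscal_nz lt0)) => /eqP.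
have E : 'chi_l = 'Ind[U] lam.
  have th_char : 'Ind[U] lam \is a character by rewrite cfInd_char ?lin_charW.
  have [xi xi_char Dxi] := constt_charP _ th_char Cl.
  have : xi 1%g <= 0.
    have := congr1 (fun f : 'CF(U) => f 1%g) Dxi; rewrite cfunE cfInd1 ?rowV_sub // lin_char1 // mulr1.
    move=> D1; rewrite -(lerD2l ('chi_l 1%g)) -D1 addr0; apply: Order.POrderTheory.le_trans deg.
    rewrite ler_nat; have := Lagrange_index (rowV_sub lt0) TV => <-.
    by apply: leq_pmulr; apply: indexg_gt0.
  move=> xi0; have : xi = 0.
    by apply/eqP; rewrite -(char1_eq0 xi_char) Order.POrderTheory.eq_le xi0 char1_ge0.
  by move=> z; rewrite Dxi z addr0.
split; first by rewrite E; move: el; rewrite sE p0 addn0 subn1.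
have /existsP[x nx] : [exists x, psi (x * cscal d 0) != 1].
  apply: contraT => /existsPn H; case/eqP: (cscal_nz lt0); apply: psi_faithful => x.
  by apply/eqP; rewrite -[_ == _]negbK H.
have lt_rc := lt_row_col lt0.
have Vz : elt x (r 0) (c 0) \in rowV 0 by apply: (subsetP (Xroot_sub_armV F lt_rc)); apply: elt_Xroot.
have Zz : elt x (r 0) (c 0) \in 'Z(U).
  apply/centerP; split=> [|u /UP Uu]; first exact: elt_in_U.
  apply: mx_inj; rewrite !mxM mx_elt // mulrDl mulrDr mul1r mulr1; congr (_ + _).
  rewrite -scalerAl -scalerAr; congr (_ *: _); apply/matrixP=> i j.
  rewrite dlB_entry Bdl_entry; have [cj jr] : (j <= c 0)%N /\ (r 0 <= i)%N.
    by rewrite c0 r0 -ltnS.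
  by rewrite (Uu (c 0) j cj) (Uu i (r 0) jr) (eq_sym (c 0)).
have Uz : elt x (r 0) (c 0) \in U by apply: elt_in_U.
apply/eqP=> /cfunP/(_ (elt x (r 0) (c 0))).
rewrite cfResE ?center_sub // !cfunE cfun1E Zz mulr1 E.
have lz : lam (elt x (r 0) (c 0)) != 1.
  by rewrite E0 // mx_elt // mxaddE !mxE !eqxx mulr1 -val_eqE ltn_eqF //= add0r mulrC.
rewrite cfIndE ?rowV_sub // (eq_bigr (fun=> lam (elt x (r 0) (c 0)))) => [|u Uu]; last first.
  by rewrite (conjgE _ u) -(centerC Uu Zz) mulKg.
rewrite sumr_const -[lam _ *+ _]mulr_natl mulrA cfInd1 ?rowV_sub // lin_char1 // mulr1.
rewrite -(Lagrange (rowV_sub lt0)) natrM mulKf ?neq0CG //.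
move=> Eq; case/eqP: lz; apply: (mulfI (neq0CiG U (rowV 0))).
by rewrite mulr1.
Qed.

End CornerElementary.

(** * The characters of third largest degree *)

Section ThirdDegree.

Variables (F : finFieldType) (p : nat).
Local Notation n := p.+1.
Local Notation GL := (GLt F p).
Local Notation U := (unitri F n : {group GL}).
Local Notation q := #|F|.
Hypothesis Hn : (7 <= n)%N.
Variable i : Iirr U.
Hypothesis deg : 'chi_i 1%g = (q ^ (mu n - 2))%:R.

Lemma inflate_reindex (d : corner_datum F p) a b (y : Iirr (cK d)) :
  (csize d).+1 = a -> (n - csize d - 1)%N = b -> exists k : Iirr (Usub F n a b),
    'chi_k 1%g = 'chi_y 1%g /\ inflate 'chi_k = inflate 'chi_y :> 'CF(U).
Proof. by move=> <- <-; exists y. Qed.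

Lemma abelian_factor (d : corner_datum F p) m l x e : abelian_corner d m l x ->
    (mu n - 2 = x + e)%N -> over_datum d i ->
  exists (y : Iirr (cK d)) (j : Iirr U), [/\ 'chi_i = 'chi_j * inflate 'chi_y,
    'chi_y 1%g = (q ^ e)%:R, corner_induced d j
    & #|U : stabT (cstart d) (cB d)|%:R <= 'chi_j 1%g].
Proof.
move=> ac De /over_datum_factor[z [y [j [E D1 J1' ind]]]]; exists y, j; split=> //.
  apply/eqP; rewrite -(abelian_corner_deg e z y ac) -D1 deg De //.
have [_ _ abS _] := ac; rewrite J1' lin_char1 ?mulr1 //.
by apply/char_abelianP.
Qed.

(** Stated for an indexed irreducible character and for matrices of size p.+1, so
    that U carries the element type used above. The order of the elementary
    characters follows the rows of the corner, up to commutativity. *)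
Lemma third_degree_shape :
     (exists (i' j : nat) (theta : 'CF(unitri F n)) (k : Iirr (Usub F n 2 (n - 2))),
        [/\ [&& 1 <= i', i' <= j & j <= n - 1]%N, elementary i' j theta /\ almost_faithful theta,
            'chi_k 1%g = (q ^ (mu (n - 2) - 2))%:R
          & 'chi_i = theta * inflate 'chi_k])
     \/
     (exists (theta1 theta2 : 'CF(unitri F n)) (l : Iirr (unitri F n))
             (k : Iirr (Usub F n 3 (n - 3))),
        [/\ elementary 1 (n - 2) theta1 /\ elementary 2 (n - 1) theta2,
            l \in irr_constt (theta1 * theta2),
            'chi_k 1%g = (q ^ (mu (n - 4) - 1))%:R
          & 'chi_i = 'chi_l * inflate 'chi_k])
     \/
     (exists (theta1 theta2 theta3 : 'CF(unitri F n)) (l : Iirr (unitri F n))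
             (k : Iirr (Usub F n 4 (n - 4))),
        [/\ [/\ elementary 2 (n - 3) theta1, elementary 1 (n - 2) theta2
               & elementary 3 (n - 1) theta3],
            l \in irr_constt (theta1 * theta2 * theta3),
            'chi_k 1%g = (q ^ mu (n - 6))%:R
          & 'chi_i = 'chi_l * inflate 'chi_k])
     \/
     (exists (theta1 theta2 theta3 : 'CF(unitri F n)) (l : Iirr (unitri F n))
             (k : Iirr (Usub F n 4 (n - 4))),
        [/\ [/\ elementary 1 (n - 3) theta1, elementary 3 (n - 2) theta2
               & elementary 2 (n - 1) theta3],
            l \in irr_constt (theta1 * theta2 * theta3),
            'chi_k 1%g = (q ^ mu (n - 6))%:R
          & 'chi_i = 'chi_l * inflate 'chi_k])
     \/
     (exists (theta1 theta2 theta3 : 'CF(unitri F n)) (l : Iirr (unitri F n))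
             (k : Iirr (Usub F n 4 (n - 4))),
        [/\ [/\ elementary 1 (n - 3) theta1, elementary 2 (n - 2) theta2
               & elementary 3 (n - 1) theta3],
            l \in irr_constt (theta1 * theta2 * theta3)
              /\ 'chi_l 1%g = (q ^ (3 * n - 14))%:R,
            'chi_k 1%g = (q ^ mu (n - 6))%:R
          & 'chi_i = 'chi_l * inflate 'chi_k]).
Proof.
have [n1 n2 n3] : [/\ n - 1 - 1 = n - 2, n - 2 - 1 = n - 3 & n - 3 - 1 = n - 4]%N.
  by rewrite -!subnDA.
have s20 : (n - 2 + 1 = n - 1)%N by lia.
have s31 : (n - 3 + 1 = n - 2)%N by lia.
have s32 : (n - 3 + 2 = n - 1)%N by lia.
have [H|[x [y [z [_ O]]]]] := classification Hn deg; last first.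
  do 4!right; have [c [b [l [E D1 L1 ind]]]] := over_datum_factor O.
  have k3 : csize (datum_v Hn x y z) = 3 by rewrite csize_datum.
  have /andP[/eqP cE /eqP bE] : ('chi_c 1%g == (q ^ 1)%:R) && ('chi_b 1%g == (q ^ mu (n - 6))%:R).
    by rewrite -deg_v -D1 deg.
  have [t0 [t1 [t2 [[el0 el1 el2] lin]]]] := corner_constt3 k3 ind.
  have [||k [k1 kE]] := @inflate_reindex (datum_v Hn x y z) 4 (n - 4) b; rewrite ?k3 //.
  exists t0, t1, t2, l, k; rewrite k1 kE; split=> //.
    by move: el0 el1 el2; rewrite cstart_datum cperm_datum /= addn0 s31 s32.
  split=> //; rewrite L1 index_T_v cE -natrM -expnD; congr (q ^ _)%:R; lia.
case: H => [[a _ O]|[a [b [_ _ O]]]|[x [y [z [_ O]]]]|[x [y [z [_ O]]]]].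
- left; have [y [j [E D1 ind le]]] := abelian_factor (shape_i Hn a) (deg_exp_i Hn) O.
  have k1 : csize (datum_i Hn a) = 1%N by rewrite csize_datum.
  have [||k [kE kI]] := @inflate_reindex (datum_i Hn a) 2 (n - 2) y; rewrite ?k1 //.
  have [el af] := corner_elementary k1 ind le.
  by exists 1%N, (n - 1)%N, 'chi_j, k; rewrite kE kI; split=> //; lia.
- right; left; have [y [j [E D1 ind _]]] := abelian_factor (shape_ii Hn a b) (deg_exp_ii Hn) O.
  have k2 : csize (datum_ii Hn a b) = 2 by rewrite csize_datum.
  have [||k [kE kI]] := @inflate_reindex (datum_ii Hn a b) 3 (n - 3) y; rewrite ?k2 //.
  have [t0 [t1 [el0 el1 lin]]] := corner_constt2 k2 ind.
  exists t0, t1, j, k; rewrite kE kI; split=> //.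
  by move: el0 el1; rewrite cstart_datum cperm_datum /= addn0 s20.
- do 2!right; left; have [b [j [E D1 ind _]]] := abelian_factor (shape_iii Hn x y z) (deg_exp_iii Hn) O.
  have k3 : csize (datum_iii Hn x y z) = 3 by rewrite csize_datum.
  have [||k [kE kI]] := @inflate_reindex (datum_iii Hn x y z) 4 (n - 4) b; rewrite ?k3 //.
  have [t0 [t1 [t2 [[el0 el1 el2] lin]]]] := corner_constt3 k3 ind.
  exists t1, t0, t2, j, k; rewrite kE kI (mulrC t1); split=> //.
  by move: el0 el1 el2; rewrite cstart_datum cperm_datum /= addn0 s31 s32.
do 3!right; left; have [b [j [E D1 ind _]]] := abelian_factor (shape_iv Hn x y z) (deg_exp_iii Hn) O.
have k3 : csize (datum_iv Hn x y z) = 3 by rewrite csize_datum.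
have [||k [kE kI]] := @inflate_reindex (datum_iv Hn x y z) 4 (n - 4) b; rewrite ?k3 //.
have [t0 [t1 [t2 [[el0 el1 el2] lin]]]] := corner_constt3 k3 ind.
exists t0, t2, t1, j, k; rewrite kE kI mulrAC; split=> //.
by move: el0 el1 el2; rewrite cstart_datum cperm_datum /= addn0 s31 s32.
Qed.

End ThirdDegree.

Unset Implicit Arguments.
Set Strict Implicit.

Theorem theorem4p3p3 (q : nat) (F : finFieldType) (n : nat)
    (hq : #|F| = q) (hn : (7 <= n)%N) :
  (forall chi : 'CF(unitri F n),
     chi \in irr (unitri F n) -> chi 1%g = (q ^ (mu n - 2))%:R ->
     (* (i) *)
     (exists (i j : nat) (theta : 'CF(unitri F n)) (k : Iirr (Usub F n 2 (n - 2))),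
        [/\ [&& 1 <= i, i <= j & j <= n - 1]%N, elementary i j theta /\ almost_faithful theta,
            'chi_k 1%g = (q ^ (mu (n - 2) - 2))%:R
          & chi = theta * inflate 'chi_k])
     \/ (* (ii) *)
     (exists (theta1 theta2 : 'CF(unitri F n)) (l : Iirr (unitri F n))
             (k : Iirr (Usub F n 3 (n - 3))),
        [/\ elementary 1 (n - 2) theta1 /\ elementary 2 (n - 1) theta2,
            l \in irr_constt (theta1 * theta2),
            'chi_k 1%g = (q ^ (mu (n - 4) - 1))%:R
          & chi = 'chi_l * inflate 'chi_k])
     \/ (* (iii) *)
     (exists (theta1 theta2 theta3 : 'CF(unitri F n)) (l : Iirr (unitri F n))
             (k : Iirr (Usub F n 4 (n - 4))),
        [/\ [/\ elementary 2 (n - 3) theta1, elementary 1 (n - 2) theta2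
               & elementary 3 (n - 1) theta3],
            l \in irr_constt (theta1 * theta2 * theta3),
            'chi_k 1%g = (q ^ mu (n - 6))%:R
          & chi = 'chi_l * inflate 'chi_k])
     \/ (* (iv) *)
     (exists (theta1 theta2 theta3 : 'CF(unitri F n)) (l : Iirr (unitri F n))
             (k : Iirr (Usub F n 4 (n - 4))),
        [/\ [/\ elementary 1 (n - 3) theta1, elementary 3 (n - 2) theta2
               & elementary 2 (n - 1) theta3],
            l \in irr_constt (theta1 * theta2 * theta3),
            'chi_k 1%g = (q ^ mu (n - 6))%:R
          & chi = 'chi_l * inflate 'chi_k])
     \/ (* (v) *)
     (exists (theta1 theta2 theta3 : 'CF(unitri F n)) (l : Iirr (unitri F n))
             (k : Iirr (Usub F n 4 (n - 4))),
        [/\ [/\ elementary 1 (n - 3) theta1, elementary 2 (n - 2) theta2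
               & elementary 3 (n - 1) theta3],
            l \in irr_constt (theta1 * theta2 * theta3)
              /\ 'chi_l 1%g = (q ^ (3 * n - 14))%:R,
            'chi_k 1%g = (q ^ mu (n - 6))%:R
          & chi = 'chi_l * inflate 'chi_k]))
  /\
  (num_irr F n (mu n - 2))%:Z =
      (q%:Z - 1) * (num_irr F (n - 2) (mu (n - 2) - 2))%:Z
    + q%:Z * (q%:Z - 1) ^+ 2 * (num_irr F (n - 4) (mu (n - 4) - 1))%:Z
    + (2 * q%:Z ^+ 2 + q%:Z - 1) * (q%:Z - 1) ^+ 3
        * (num_irr F (n - 6) (mu (n - 6)))%:Z.
Proof.
move: hn; subst q; case: n => [//|p] Hn; split=> [chi /irrP[i ->] deg|].
  exact: third_degree_shape.
rewrite (num_irr_third F Hn); have := card_F_gt1 F.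
move: (num_irr F _ _) (num_irr F _ _) (num_irr F _ _) => N1 N2 N3.
case: #|F| => // x _; rewrite subSS subn0 !expnS !expn0 !muln1.
rewrite !PoszD !PoszM intS; ring.
Qed.
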